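(* There exist absolute constants $C_1, C_2, C_3 > 0$ and a deterministic algorithm with the following guarantee. The algorithm receives as input a finite Abelian group $\Gamma$ with $|\Gamma| = n$ (given explicitly, e.g. by its addition table) and a symmetric multiset $S$ of elements of $\Gamma$ with $|S| = d$ (counted with multiplicity). It outputs a set $Q \subseteq \Gamma$ with $1 \le |Q| \le n/2$ such that $\phi_G(Q) \le C_1 \cdot \phi(G)$, where $G = \mathrm{Cay}(\Gamma, S)$, and it runs in time at most $n^{C_2} \cdot \exp\{d^{C_3 d}\}$.
   Context: A multiset $S$ of elements of an Abelian group $\Gamma$ is symmetric if for every $x \in \Gamma$ the multiplicities of $x$ and $-x$ in $S$ are equal. The Abelian Cayley graph $\mathrm{Cay}(\Gamma,S)$ has vertex set $\Gamma$ and, for every $v \in \Gamma$ and every element $s$ of $S$ (with multiplicity), an edge $(v, v+s)$; it is an undirected $d$-regular multigraph, possibly with self-loops, where $d = |S|$. For a graph $G$ and $Q \subseteq V(G)$, let $\partial Q$ be the multiset of edges $(i,j)$ with $i \in Q$, $j \notin Q$, and $\mathrm{vol}(Q) = \sum_{i \in Q} \deg(i)$. The conductance of $Q$ is $\phi_G(Q) = |\partial Q|/\mathrm{vol}(Q)$, and $\phi(G) = \min\{\phi_G(Q) : \emptyset \ne Q \subseteq V(G),\ \mathrm{vol}(Q) \le \mathrm{vol}(V(G))/2\}$. *)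

(* Defs.v *)
From Stdlib Require Import Reals.
From mathcomp Require Import all_boot all_algebra.

Set Implicit Arguments.
Unset Strict Implicit.
Unset Printing Implicit Defensive.

Definition symmetric_mset (G : finZmodType) (S : seq G) : Prop :=
  forall x : G, count_mem x S = count_mem (GRing.opp x) S.

(* Cay(G,S): for every v and every element s of S (with multiplicity) there
   is an edge (v, v+s).  |dQ| = number of such edges (v,v+s), v in Q,
   v+s not in Q, counted with multiplicity. *)
Definition cay_boundary (G : finZmodType) (S : seq G) (Q : {set G}) : nat :=
  \sum_(v in Q) count (fun s => GRing.add v s \notin Q) S.

(* vol(Q) = sum of degrees = d * |Q| (the graph is d-regular, d = |S|). *)
Definition cay_vol (G : finZmodType) (S : seq G) (Q : {set G}) : nat :=
  \sum_(v in Q) size S.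

Definition cay_conductance (G : finZmodType) (S : seq G) (Q : {set G}) : R :=
  Rdiv (INR (cay_boundary S Q)) (INR (cay_vol S Q)).

Definition cay_admissible (G : finZmodType) (S : seq G) (Q : {set G}) : bool :=
  (Q != set0) && (2 * cay_vol S Q <= cay_vol S [set: G])%N.

(* phi(G) = min of the conductance over admissible Q.  The seed value 1 of
   the iterated minimum is harmless: every conductance is <= 1 (|dQ| <=
   vol(Q)), and admissible sets exist as soon as |G| >= 2 and |S| >= 1. *)
Definition cay_phi (G : finZmodType) (S : seq G) : R :=
  \big[Rmin/R1]_(Q : {set G} | cay_admissible S Q) cay_conductance S Q.

(* Model of computation: a deterministic unit-cost RAM (registers indexed   *)
(* by nat, holding nat; addition, truncated subtraction, indirect           *)
(* addressing, conditional jump).  A program is a fixed finite list of      *)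
(* instructions; running time = number of executed instructions.           *)

Inductive instr : Type :=
| IConst of nat & nat
| IAdd of nat & nat & nat
| ISub of nat & nat & nat
| ILoad of nat & nat
| IStore of nat & nat
| IJz of nat & nat
| IHalt.

Definition program := seq instr.
Definition ram_state := (nat * (nat -> nat))%type.

Definition mem_upd (m : nat -> nat) (a v : nat) : nat -> nat :=
  fun i => if i == a then v else m i.

(* One step; None when the machine has halted (IHalt or pc out of range). *)
Definition ram_step (P : program) (s : ram_state) : option ram_state :=
  let: (pc, m) := s in
  match nth IHalt P pc with
  | IConst a c => Some (pc.+1, mem_upd m a c)
  | IAdd a b c => Some (pc.+1, mem_upd m a (m b + m c))
  | ISub a b c => Some (pc.+1, mem_upd m a (m b - m c))
  | ILoad a b => Some (pc.+1, mem_upd m a (m (m b)))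
  | IStore a b => Some (pc.+1, mem_upd m (m a) (m b))
  | IJz a l => Some (if m a == 0 then l else pc.+1, m)
  | IHalt => None
  end.

Fixpoint ram_steps (P : program) (k : nat) (s : ram_state) : option ram_state :=
  match k with
  | 0 => Some s
  | k'.+1 => obind (ram_step P) (ram_steps P k' s)
  end.

Definition ram_init (input : seq nat) : ram_state := (0, fun i => nth 0 input i).

Definition ram_output (s : ram_state) : seq nat :=
  [seq s.2 i | i <- iota 1 (s.2 0)].

Definition ram_runs (P : program) (input : seq nat) (t : nat) (out : seq nat) : Prop :=
  exists s, ram_steps P t (ram_init input) = Some s /\ ram_step P s = None
            /\ ram_output s = out.

(* Encoding of the input (Gamma, S).  Elements of Gamma are named by the    *)
(* labels 0..n-1 via an arbitrary bijection; the input is                   *)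
(*   n, d, the n*n addition table (row-major, entry (i,j) = label of        *)
(*   elt i + elt j), then the labels of the d elements of S.                *)

Definition encode_input (G : finZmodType) (elt : 'I_#|G| -> G)
  (lab : G -> 'I_#|G|) (S : seq G) : seq nat :=
  [:: #|G|, size S &
     [seq (lab (GRing.add (elt i) (elt j)) : nat) | i <- enum 'I_#|G|, j <- enum 'I_#|G|]
     ++ [seq (lab s : nat) | s <- S]].

Definition decode_output (G : finZmodType) (lab : G -> 'I_#|G|) (out : seq nat)
  : {set G} := [set x | (lab x : nat) \in out].

(* Main.v *)
Require Import Defs.
From Stdlib Require Import Reals Lra.
From mathcomp Require Import all_boot all_order all_algebra.
From mathcomp Require Import zify ring lra.

(** Let [b Q] be the number of edges leaving [Q].  Taking the union of a few
    translates of a sparsest cut gives a cut [Q] that is sparsest up to a constant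
    and has between [n/5] and [n/2] elements.  Put [B := b Q] and [r := n/(4096 B)].
    Averaging [1_Q] over the box of all sums of generators with multiplicities below
    [4 r] changes it by at most [8 r B] in L1 and yields a function whose variation
    over a ball of radius [r] is at most [1/4].  Hence [Q] agrees, up to [n/128]
    elements, with a union of cells of any partition of the group into cells of
    radius [r].

    The number of cells of a greedy partition is bounded in terms of [d] alone.
    Since every ball with at most [n/2] elements has boundary at least
    proportional to [B/n] times its size, the balls double their size every
    [O(d^2 (r + 1))] steps until they fill half of the group; on the other hand, writing
    an element of a ball as a sum of multiples of the [d] generators shows that the
    balls grow only polynomially with exponent [d].  So all unions of cells can be
    enumerated in time [2^(d^(O(d)))].

    Given a union [P] of cells close to [Q], one minimizes
    [n * b T + lam * #|T /\ P|] over sets [T], with [lam] proportional to [B],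
    where [/\] stands for the symmetric difference.  Relaxing sets to functions
    with values in [{0, .., M}] makes this a convex problem; projected subgradient
    descent in integers needs polynomially many steps, and by the co-area formula
    some level set of some iterate is nearly optimal.  That level set, or its
    complement, is a cut with [O(B)] boundary edges and proportional size.  As [B]
    is not known, all values of [r] and [lam] are tried, and the best cut met on the
    way is returned. *)

Set Implicit Arguments.
Unset Strict Implicit.
Unset Printing Implicit Defensive.
Import GRing.Theory.


(** * A small language compiled to the machine *)

Inductive expr : Type :=
| EC of nat
| EA of nat & expr
| EAdd of expr & expr
| ESub of expr & expr.

Inductive cmd : Type :=
| CSkip
| CWr of nat & expr & expr
| CSeq of cmd & cmd
| CIf of expr & cmd & cmd
| CFor of nat & expr & cmd.

Definition store := nat -> nat -> nat.

Definition upd (s : store) (a i v : nat) : store :=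
  fun b => if b == a then mem_upd (s a) i v else s b.

Fixpoint eval (e : expr) (s : store) : nat :=
  match e with
  | EC c => c
  | EA a e => s a (eval e s)
  | EAdd e1 e2 => eval e1 s + eval e2 s
  | ESub e1 e2 => eval e1 s - eval e2 s
  end.

Fixpoint exec (c : cmd) (s : store) : store :=
  match c with
  | CSkip => s
  | CWr a e1 e2 => upd s a (eval e1 s) (eval e2 s)
  | CSeq c1 c2 => exec c2 (exec c1 s)
  | CIf e c1 c2 => if eval e s == 0 then exec c2 s else exec c1 s
  | CFor v e c => iteri (eval e s) (fun k s => exec c (upd s v 0 k)) s
  end.

(* Register 0 holds [base], and cell [i] of array [a < 64] is kept at address
   [base + 64 * i + a]; [caddr] turns the index in register [k] into that address. *)
Definition caddr (k a : nat) : seq instr :=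
  nseq 6 (IAdd k k k) ++ [:: IConst k.+1 a; IAdd k k k.+1; IAdd k k 0].

Fixpoint cexpr (k : nat) (e : expr) : seq instr :=
  match e with
  | EC c => [:: IConst k c]
  | EA a e => cexpr k e ++ caddr k a ++ [:: ILoad k k]
  | EAdd e1 e2 => cexpr k e1 ++ cexpr k.+1 e2 ++ [:: IAdd k k k.+1]
  | ESub e1 e2 => cexpr k e1 ++ cexpr k.+1 e2 ++ [:: ISub k k k.+1]
  end.

(* [compile p k c] is placed at address [p] and may only use registers at or above [k]. *)
Fixpoint compile (p k : nat) (c : cmd) : seq instr :=
  match c with
  | CSkip => [::]
  | CWr a e1 e2 =>
      cexpr k e1 ++ caddr k a ++ cexpr k.+1 e2 ++ [:: IStore k k.+1]
  | CSeq c1 c2 => let l1 := compile p k c1 in l1 ++ compile (p + size l1) k c2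
  | CIf e c1 c2 =>
      let le := cexpr k e in
      let l1 := compile (p + size le + 1) k c1 in
      let p2 := p + size le + 1 + size l1 + 2 in
      let l2 := compile p2 k c2 in
      le ++ [:: IJz k p2] ++ l1 ++ [:: IConst k 0; IJz k (p2 + size l2)] ++ l2
  | CFor v e c =>
      let le := cexpr k e in
      let pl := p + size le + 1 in
      let lb := compile (pl + 5) k.+3 c in
      le ++ [:: IConst k.+1 0] ++
      [:: ISub k.+2 k k.+1; IJz k.+2 (pl + 5 + size lb + 4);
          IConst k.+2 v; IAdd k.+2 k.+2 0; IStore k.+2 k.+1] ++ lb ++
      [:: IConst k.+2 1; IAdd k.+1 k.+1 k.+2; IConst k.+2 0; IJz k.+2 pl]
  end.

Definition ecost (e : expr) : nat := size (cexpr 0 e).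

Fixpoint cost (c : cmd) (s : store) : nat :=
  match c with
  | CSkip => 0
  | CWr a e1 e2 => ecost e1 + ecost e2 + 10
  | CSeq c1 c2 => cost c1 s + cost c2 (exec c1 s)
  | CIf e c1 c2 => ecost e + 3 + (if eval e s == 0 then cost c2 s else cost c1 s)
  | CFor v e c =>
      ecost e + 3 + \sum_(k < eval e s)
        (9 + cost c (upd (iteri k (fun k s => exec c (upd s v 0 k)) s) v 0 k))
  end.

Fixpoint ewid (e : expr) : nat :=
  match e with
  | EC _ => 1
  | EA _ e => maxn 2 (ewid e)
  | EAdd e1 e2 | ESub e1 e2 => maxn (ewid e1) (ewid e2).+1
  end.

Fixpoint eok (e : expr) : bool :=
  match e with
  | EC _ => true
  | EA a e => (a < 64) && eok e
  | EAdd e1 e2 | ESub e1 e2 => eok e1 && eok e2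
  end.

Fixpoint cwid (c : cmd) : nat :=
  match c with
  | CSkip => 0
  | CWr a e1 e2 => maxn 2 (maxn (ewid e1) (ewid e2).+1)
  | CSeq c1 c2 => maxn (cwid c1) (cwid c2)
  | CIf e c1 c2 => maxn (ewid e) (maxn (cwid c1) (cwid c2))
  | CFor v e c => maxn (ewid e) (cwid c).+3
  end.

Fixpoint cok (c : cmd) : bool :=
  match c with
  | CSkip => true
  | CWr a e1 e2 => [&& a < 64, eok e1 & eok e2]
  | CSeq c1 c2 => cok c1 && cok c2
  | CIf e c1 c2 => [&& eok e, cok c1 & cok c2]
  | CFor v e c => [&& v < 64, eok e & cok c]
  end.

Definition rep (base : nat) (s : store) (m : nat -> nat) : Prop :=
  m 0 = base /\ forall a i, a < 64 -> m (base + 64 * i + a) = s a i.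

Definition code_at (P : program) (p : nat) (l : seq instr) : Prop :=
  forall i, i < size l -> nth IHalt P (p + i) = nth IHalt l i.

Definition reach (P : program) (x : ram_state) (t : nat) (y : ram_state) : Prop :=
  exists2 u, u <= t & ram_steps P u x = Some y.

Lemma ram_stepsD P t u x :
  ram_steps P (t + u) x = obind (ram_steps P u) (ram_steps P t x).
Proof.
elim: u => [|u IH]; first by rewrite addn0; case: ram_steps.
by rewrite addnS /= IH; case: (ram_steps P t x).
Qed.

Lemma reach_trans P x t y u z :
  reach P x t y -> reach P y u z -> reach P x (t + u) z.
Proof.
move=> [t' ht et] [u' hu eu]; exists (t' + u'); first exact: leq_add.
by rewrite ram_stepsD et /= eu.
Qed.

Lemma reach_le P x t u y : t <= u -> reach P x t y -> reach P x u y.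
Proof. by move=> tu [t' ht et]; exists t' => //; exact: leq_trans tu. Qed.

Lemma reach0 P x : reach P x 0 x.
Proof. by exists 0. Qed.

Lemma reach1 P x y : ram_step P x = Some y -> reach P x 1 y.
Proof. by move=> h; exists 1. Qed.

Lemma code_at_cat P p l1 l2 :
  code_at P p (l1 ++ l2) -> code_at P p l1 /\ code_at P (p + size l1) l2.
Proof.
move=> h; split=> i hi.
  by rewrite h ?size_cat ?nth_cat ?hi //; lia.
rewrite -addnA h ?size_cat ?ltn_add2l // nth_cat ifN ?addKn //; lia.
Qed.

Lemma code_at_cons P p x l :
  code_at P p (x :: l) -> nth IHalt P p = x /\ code_at P p.+1 l.
Proof.
move=> h; split; first by have := h 0 isT; rewrite addn0.
by move=> i hi; rewrite addSnnS h.
Qed.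

Definition ram_eff (i : instr) (m : nat -> nat) : nat -> nat :=
  match i with
  | IConst a c => mem_upd m a c
  | IAdd a b c => mem_upd m a (m b + m c)
  | ISub a b c => mem_upd m a (m b - m c)
  | ILoad a b => mem_upd m a (m (m b))
  | IStore a b => mem_upd m (m a) (m b)
  | _ => m
  end.

Definition straight (i : instr) : bool :=
  match i with IJz _ _ | IHalt => false | _ => true end.

Fixpoint srun (l : seq instr) (m : nat -> nat) : nat -> nat :=
  if l is i :: l' then srun l' (ram_eff i m) else m.

Lemma srun_cat l1 l2 m : srun (l1 ++ l2) m = srun l2 (srun l1 m).
Proof. by elim: l1 m => //= i l1 IH m. Qed.

Lemma srun_reach P p l m : all straight l -> code_at P p l ->
  reach P (p, m) (size l) (p + size l, srun l m).
Proof.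
elim: l p m => [|i l IH] p m /=; first by rewrite addn0 => _ _; exact: reach0.
case/andP=> hi hl /code_at_cons[e /(IH _ _ hl) h].
rewrite addnS -addSn -(add1n (size l)).
apply: reach_trans (h (ram_eff i m)); apply: reach1.
by rewrite /ram_step e; case: i hi {e}.
Qed.

Lemma straight_cexpr k e : all straight (cexpr k e).
Proof. by elim: e k => //= [a e IH|e1 IH1 e2 IH2|e1 IH1 e2 IH2] k; rewrite !all_cat ?IH ?IH1 ?IH2. Qed.

Lemma size_cexpr k e : size (cexpr k e) = ecost e.
Proof.
suff h l : size (cexpr k e) = size (cexpr l e) by exact: h.
elim: e k l => //= [a e IH|e1 IH1 e2 IH2|e1 IH1 e2 IH2] k l;
  rewrite !size_cat /=; first by rewrite (IH k l).
- by rewrite (IH1 k l) (IH2 k.+1 l.+1).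
- by rewrite (IH1 k l) (IH2 k.+1 l.+1).
Qed.

Lemma mem_updE m a v i : mem_upd m a v i = if i == a then v else m i.
Proof. by []. Qed.

Definition keeps (k base : nat) (m m' : nat -> nat) : Prop :=
  forall j, j < k \/ base <= j -> m' j = m j.

Lemma keeps_rep k base s m m' :
  0 < k -> keeps k base m m' -> rep base s m -> rep base s m'.
Proof.
move=> k0 h [h0 hr]; split; first by rewrite h //; left.
by move=> a i ha; rewrite h ?hr //; right; rewrite -addnA leq_addr.
Qed.

Lemma keeps_trans k base m1 m2 m3 :
  keeps k base m1 m2 -> keeps k base m2 m3 -> keeps k base m1 m3.
Proof. by move=> h1 h2 j hj; rewrite h2 ?h1. Qed.

Lemma keepsW k l base m m' : l <= k -> keeps k base m m' -> keeps l base m m'.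
Proof. by move=> lk h j hj; apply: h; case: hj => hj; [left; exact: leq_trans lk|right]. Qed.

Lemma keeps_upd k base m a v : k <= a < base -> keeps k base m (mem_upd m a v).
Proof. by move=> h j hj; rewrite mem_updE; case: eqP => // e; lia. Qed.

Lemma caddrP k a base m : 0 < k -> k + 2 <= base ->
  let m' := srun (caddr k a) m in
  m' k = m 0 + 64 * m k + a /\ keeps k base m m'.
Proof.
move=> k0 kb /=.
have e1 : (k == k.+1) = false by lia.
have e2 : (0 == k) = false by lia.
have e3 : (0 == k.+1) = false by lia.
split.
  rewrite /mem_upd !eqxx /= ?e1 ?e2 ?e3 /= ?eqxx; lia.
move=> j hj; rewrite /mem_upd.
have -> : (j == k) = false by lia.
by have -> : (j == k.+1) = false by lia.
Qed.

Lemma cexprP e k base s m : 0 < k -> k + ewid e <= base -> eok e -> rep base s m ->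
  let m' := srun (cexpr k e) m in
  m' k = eval e s /\ keeps k base m m'.
Proof.
elim: e k m => [c|a e IH|e1 IH1 e2 IH2|e1 IH1 e2 IH2] k m k0 /= hw ho hr.
- by split; [rewrite /mem_upd eqxx | apply: keeps_upd; lia].
- case/andP: ho => ha ho.
  have [|E K] := IH k m k0 _ ho hr; first by lia.
  rewrite srun_cat; set m1 := srun (cexpr _ _) _ in E K *.
  rewrite -[[:: _, _ & _]]/(caddr k a ++ [:: ILoad k k]) srun_cat.
  have [|E' K'] := @caddrP k a base m1 k0; first by lia.
  set m2 := srun (caddr _ _) _ in E' K' *; rewrite /=.
  have R1 := keeps_rep k0 K hr; have R2 := keeps_rep k0 K' R1.
  split; last by apply: keeps_trans (keeps_trans K K') _; apply: keeps_upd; lia.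
  by rewrite /mem_upd eqxx E' E (proj1 R1) (proj2 R2).
- case/andP: ho => ho1 ho2.
  have [|E K] := IH1 k m k0 _ ho1 hr; first by lia.
  rewrite !srun_cat; set m1 := srun (cexpr _ _) _ in E K *.
  have R1 := keeps_rep k0 K hr.
  have [||E' K'] := IH2 k.+1 m1 _ _ ho2 R1; [by []|lia|].
  set m2 := srun (cexpr _ _) _ in E' K' *; rewrite /=.
  split; first by rewrite /mem_upd eqxx E' K' ?E //; left.
  apply: keeps_trans (keeps_trans K (keepsW _ K')) _ => //; apply: keeps_upd; lia.
- case/andP: ho => ho1 ho2.
  have [|E K] := IH1 k m k0 _ ho1 hr; first by lia.
  rewrite !srun_cat; set m1 := srun (cexpr _ _) _ in E K *.
  have R1 := keeps_rep k0 K hr.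
  have [||E' K'] := IH2 k.+1 m1 _ _ ho2 R1; [by []|lia|].
  set m2 := srun (cexpr _ _) _ in E' K' *; rewrite /=.
  split; first by rewrite /mem_upd eqxx E' K' ?E //; left.
  apply: keeps_trans (keeps_trans K (keepsW _ K')) _ => //; apply: keeps_upd; lia.
Qed.

#[local] Arguments ram_step : simpl never.

Lemma rep_upd base s m a i v : 0 < base -> a < 64 -> rep base s m ->
  rep base (upd s a i v) (mem_upd m (base + 64 * i + a) v).
Proof.
move=> b0 ha [h0 hr]; split; first by rewrite mem_updE ifN ?h0 //; lia.
move=> b j hb; rewrite /mem_upd /upd hr //.
case: (altP (b =P a)) => [->|ne]; last by rewrite ifN //; lia.
rewrite /mem_upd; case: (altP (j =P i)) => [->|ne]; first by rewrite eqxx.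
by rewrite ifN //; lia.
Qed.

Lemma ewid_gt0 e : 0 < ewid e.
Proof. by elim: e => //= *; rewrite leq_max; apply/orP; right. Qed.

Theorem compP P base c p k s m : code_at P p (compile p k c) ->
  0 < k -> k + cwid c <= base -> cok c -> rep base s m ->
  exists m', [/\ reach P (p, m) (cost c s) (p + size (compile p k c), m'),
    rep base (exec c s) m' & forall j, j < k -> m' j = m j].
Proof.
elim: c p k s m => [|a e1 e2|c1 IH1 c2 IH2|e c1 IH1 c2 IH2|v e c IH] p k s m hc k0.
- by move=> _ _ hr; exists m; split=> //; rewrite addn0; exact: reach0.
- move=> /= hw /and3P[ha ho1 ho2] hr.
  set l := cexpr k e1 ++ caddr k a ++ cexpr k.+1 e2 ++ [:: IStore k k.+1].
  have hs : all straight l.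
    by rewrite /l all_cat straight_cexpr /= all_cat straight_cexpr.
  have hz : size l = cost (CWr a e1 e2) s.
    by rewrite /l !size_cat !size_cexpr /=; lia.
  have Hr := srun_reach m hs hc; rewrite -/l {1}hz in Hr *.
  exists (srun l m); split=> //.
  + have [|E K] := @cexprP e1 k base s m k0 _ ho1 hr; first by lia.
    rewrite /l !srun_cat; set m1 := srun (cexpr _ e1) _ in E K *.
    have [|E' K'] := @caddrP k a base m1 k0; first by lia.
    set m2 := srun (caddr _ _) _ in E' K' *.
    have R1 := keeps_rep k0 K hr; have R2 := keeps_rep k0 K' R1.
    have [||E3 K3] := @cexprP e2 k.+1 base s m2 _ _ ho2 R2; [by []|lia|].
    set m3 := srun (cexpr _ e2) _ in E3 K3 *.
    have R3 := @keeps_rep k.+1 _ _ _ _ isT K3 R2.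
    rewrite /= E3 K3; last by left.
    by rewrite E' E (proj1 R1); apply: rep_upd => //; lia.
  + move=> j hj.
    have [|E K] := @cexprP e1 k base s m k0 _ ho1 hr; first by lia.
    rewrite /l !srun_cat; set m1 := srun (cexpr _ e1) _ in E K *.
    have [|E' K'] := @caddrP k a base m1 k0; first by lia.
    set m2 := srun (caddr _ _) _ in E' K' *.
    have R1 := keeps_rep k0 K hr; have R2 := keeps_rep k0 K' R1.
    have [||E3 K3] := @cexprP e2 k.+1 base s m2 _ _ ho2 R2; [by []|lia|].
    set m3 := srun (cexpr _ e2) _ in E3 K3 *.
    rewrite /= K3; last by left.
    rewrite E' (proj1 R1) mem_updE ifN; last by lia.
    by rewrite K3 ?K' ?K //; left; lia.
- move=> /= hw /andP[ho1 ho2] hr.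
  case/code_at_cat: hc => hc1 hc2.
  have [|m1 [H1 R1 K1]] := IH1 p k s m hc1 k0 _ ho1 hr; first by lia.
  have [|m2 [H2 R2 K2]] := IH2 _ k _ m1 hc2 k0 _ ho2 R1; first by lia.
  exists m2; split=> //; last by move=> j hj; rewrite K2 ?K1.
  by rewrite size_cat addnA; exact: reach_trans H1 H2.
- move=> /= hw /and3P[ho ho1 ho2] hr.
  move: hc; rewrite /=.
  set le := cexpr k e; set l1 := compile _ k c1.
  set p2 := p + size le + 1 + size l1 + 2; set l2 := compile p2 k c2.
  case/code_at_cat=> hce /code_at_cons[hjz /code_at_cat[hc1]].
  case/code_at_cons=> hk /code_at_cons[hj2 hc2].
  have He := srun_reach m (straight_cexpr k e) hce; rewrite size_cexpr in He.
  have [|E K] := @cexprP e k base s m k0 _ ho hr; first by lia.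
  set m1 := srun _ m in He E K.
  have R1 := keeps_rep k0 K hr.
  have Hend : p + size (le ++ [:: IJz k p2] ++ l1 ++
     [:: IConst k 0; IJz k (p2 + size l2)] ++ l2) = p2 + size l2.
    rewrite !size_cat /= /p2; lia.
  rewrite Hend.
  case: eqP => ev.
    have [||m2 [H2 R2 K2]] := IH2 p2 k s m1 _ k0 _ ho2 R1; [|lia|].
      by move: hc2; have -> : ((p + size le).+1 + size l1).+2 = p2 by rewrite /p2; lia.
    exists m2; split=> //; last by move=> j hj; rewrite K2 ?K //; left.
    rewrite -addnA; apply: reach_trans He _.
    apply: (@reach_le _ _ (1 + cost c2 s)); first by lia.
    apply: reach_trans H2; apply: reach1.
    by rewrite /ram_step -(size_cexpr k e) -/le hjz E ev /=.
  have [||m2 [H2 R2 K2]] := IH1 (p + size le + 1) k s m1 _ k0 _ ho1 R1; [|lia|].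
    by rewrite {1}addn1.
  exists (mem_upd m2 k 0); split.
  + rewrite -addnA; apply: reach_trans He _.
    apply: (@reach_le _ _ (1 + (cost c1 s + (1 + 1)))); first by lia.
    apply: (@reach_trans _ _ _ (p + size le + 1, m1)).
      apply: reach1; rewrite /ram_step -(size_cexpr k e) -/le hjz E addn1.
      by case: eqP ev.
    apply: reach_trans H2 _; rewrite -/l1.
    apply: (@reach_trans _ _ _ ((p + size le + 1 + size l1).+1, mem_upd m2 k 0)).
      by apply: reach1; rewrite /ram_step addn1 hk.
    by apply: reach1; rewrite /ram_step addn1 hj2 /mem_upd eqxx.
  + by apply: (keeps_rep k0 _ R2); apply: keeps_upd; have := ewid_gt0 e; lia.
  + by move=> j hj; rewrite mem_updE ifN ?K2 ?K //; [left|lia].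
- move=> /= hw /and3P[hv ho hoc] hr.
  move: hc; rewrite /=.
  set le := cexpr k e; set pl := p + size le + 1.
  set lb := compile _ _ c; set pe := pl + 5 + size lb + 4.
  case/code_at_cat=> hce /code_at_cons[h0].
  case/code_at_cons=> h1; case/code_at_cons=> h2; case/code_at_cons=> h3.
  case/code_at_cons=> h4; case/code_at_cons=> h5 /code_at_cat[hb].
  case/code_at_cons=> h6; case/code_at_cons=> h7; case/code_at_cons=> h8.
  case/code_at_cons=> h9 _.
  have He := srun_reach m (straight_cexpr k e) hce; rewrite size_cexpr in He.
  have [|E K] := @cexprP e k base s m k0 _ ho hr; first by lia.
  set m1 := srun _ m in He E K.
  have R1 := keeps_rep k0 K hr.
  set f := fun (k0 : nat) (s0 : store) => exec c (upd s0 v 0 k0).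
  set cst := fun i : nat => 9 + cost c (upd (iteri i f s) v 0 i).
  set n := eval e s in E *.
  have Hend : p + size (le ++ IConst k.+1 0 :: [:: ISub k.+2 k k.+1,
      IJz k.+2 pe, IConst k.+2 v, IAdd k.+2 k.+2 0, IStore k.+2 k.+1
       & lb ++ [:: IConst k.+2 1; IAdd k.+1 k.+1 k.+2;
                IConst k.+2 0; IJz k.+2 pl]]) = pe.
    by rewrite /= !size_cat /= !size_cat /= /pe /pl; lia.
  rewrite Hend.
  have inv : forall i, i <= n -> exists m', [/\ reach P (p, m)
      (ecost e + 1 + \sum_(j < i) cst j) (pl, m'), rep base (iteri i f s) m',
      m' k = n, m' k.+1 = i & forall j, j < k -> m' j = m j].
    elim=> [|i IHi] hi.
      exists (mem_upd m1 k.+1 0); split=> //=.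
      * rewrite big_ord0 addn0; apply: reach_trans He _.
        by apply: reach1; rewrite /ram_step -(size_cexpr k e) -/le h0 /pl addn1.
      * by apply: (keeps_rep k0 _ R1); apply: keeps_upd; have := ewid_gt0 e; lia.
      * by rewrite mem_updE ifN //; lia.
      * by rewrite mem_updE eqxx.
      * by move=> j hj; rewrite mem_updE ifN ?K //; [left|lia].
    have [|m2 [H2 R2 E2 E2' K2]] := IHi; first exact: ltnW.
    pose m3 := mem_upd (mem_upd (mem_upd m2 k.+2 (n - i)) k.+2 v) k.+2 (v + base).
    have R3 : rep base (iteri i f s) m3.
      by apply: (@keeps_rep k _ _ m2) => // j hj; rewrite /m3 !mem_updE; case: eqP => //; lia.
    pose m4 := mem_upd m3 (base + 64 * 0 + v) i.
    have R4 : rep base (upd (iteri i f s) v 0 i) m4.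
      by apply: rep_upd => //; lia.
    have [|||m5 [H5 R5 K5]] := IH (pl + 5) k.+3 _ m4 _ _ _ hoc R4.
    + by move: hb; rewrite /pl; congr code_at; lia.
    + by [].
    + lia.
    have K4 j : j < k.+2 -> m4 j = m2 j.
      by move=> hj; rewrite /m4 /m3 !mem_updE; case: eqP; last case: eqP; lia.
    pose m6 := mem_upd (mem_upd (mem_upd m5 k.+2 1) k.+1 i.+1) k.+2 0.
    exists m6; split.
    + rewrite big_ord_recr /= addnA; apply: reach_trans H2 _.
      rewrite /cst; apply: (@reach_le _ _ (5 + (cost c (upd (iteri i f s) v 0 i) + 4))); first by lia.
      apply: (@reach_trans _ _ _ (pl + 5, m4)).
        exists 5 => //=.
        have q1 : ram_step P (pl, m2) = Some (pl.+1, mem_upd m2 k.+2 (n - i)).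
          by rewrite /ram_step /pl addn1 h1 E2 E2'.
        have q2 : ram_step P (pl.+1, mem_upd m2 k.+2 (n - i)) =
           Some (pl.+2, mem_upd m2 k.+2 (n - i)).
          by rewrite /ram_step /pl addn1 h2 mem_updE eqxx ifN //; lia.
        have q3 : ram_step P (pl.+2, mem_upd m2 k.+2 (n - i)) =
           Some (pl.+3, mem_upd (mem_upd m2 k.+2 (n - i)) k.+2 v).
          by rewrite /ram_step /pl addn1 h3.
        have q4 : ram_step P (pl.+3, mem_upd (mem_upd m2 k.+2 (n - i)) k.+2 v) =
           Some (pl.+4, m3).
          by rewrite /ram_step /pl addn1 h4 /m3 !mem_updE eqxx /= (proj1 R2).
        have q5 : ram_step P (pl.+4, m3) = Some (pl + 5, m4).
          have -> : pl + 5 = pl.+4.+1 by lia.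
          rewrite /ram_step {1}/pl addn1 h5 /m4; congr (Some (_, mem_upd _ _ _)).
            by rewrite /m3 mem_updE eqxx; lia.
          by rewrite /m3 !mem_updE !ifN ?E2' //; lia.
        by rewrite q1 /= q2 /= q3 /= q4 /= q5.
      apply: reach_trans H5 _; exists 4 => //=.
      rewrite -/lb; set q := pl + 5 + size lb.
      have hq : (p + size le).+1.+1.+4 + size lb = q by rewrite /q /pl; lia.
      rewrite hq in h6 h7 h8 h9.
      have q1 : ram_step P (q, m5) = Some (q.+1, mem_upd m5 k.+2 1).
        by rewrite /ram_step h6.
      have q2 : ram_step P (q.+1, mem_upd m5 k.+2 1) =
         Some (q.+2, mem_upd (mem_upd m5 k.+2 1) k.+1 i.+1).
        rewrite /ram_step h7; congr (Some (_, mem_upd _ _ _)).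
        by rewrite !mem_updE eqxx ifN ?K5 ?K4 ?E2' ?addn1 //; lia.
      have q3 : ram_step P (q.+2, mem_upd (mem_upd m5 k.+2 1) k.+1 i.+1) =
         Some (q.+3, m6).
        by rewrite /ram_step h8.
      have q4 : ram_step P (q.+3, m6) = Some (pl, m6).
        by rewrite /ram_step h9 /m6 mem_updE eqxx.
      by rewrite q1 /= q2 /= q3 /= q4.
    + rewrite /=; apply: (@keeps_rep k _ _ m5) => // j hj.
      by rewrite /m6 !mem_updE; case: eqP; last case: eqP; lia.
    + by rewrite /m6 !mem_updE !ifN ?K5 ?K4 //; lia.
    + by rewrite /m6 !mem_updE ifN ?eqxx //; lia.
    + by move=> j hj; rewrite /m6 !mem_updE !ifN ?K5 ?K4 ?K2 //; lia.
  have [|m2 [H2 R2 E2 E2' K2]] := inv n; first exact: leqnn.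
  exists (mem_upd m2 k.+2 0); split.
  + apply: (@reach_le _ _ ((ecost e + 1 + \sum_(j < n) cst j) + 2)).
      by rewrite -[X in _ <= X]/(ecost e + 3 + \sum_(j < n) cst j) addnAC leq_add2r -addnA.
    apply: reach_trans H2 _; exists 2 => //=.
    have q1 : ram_step P (pl, m2) = Some (pl.+1, mem_upd m2 k.+2 0).
      by rewrite /ram_step /pl addn1 h1 E2 E2' subnn.
    have q2 : ram_step P (pl.+1, mem_upd m2 k.+2 0) = Some (pe, mem_upd m2 k.+2 0).
      by rewrite /ram_step /pl addn1 h2 mem_updE eqxx.
    by rewrite q1 /= q2.
  + by apply: (@keeps_rep k _ _ m2) => // j hj; rewrite mem_updE; case: eqP => //; lia.
  + by move=> j hj; rewrite mem_updE ifN ?K2 //; lia.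
Qed.

(** * Frames and static costs *)

(* A variable is cell 0 of its own array. *)
Definition V (v : nat) : expr := EA v (EC 0).
Definition Asg (v : nat) (e : expr) : cmd := CWr v (EC 0) e.
Definition Map (v a : nat) (b e : expr) : cmd := CFor v b (CWr a (V v) e).

Fixpoint reads (e : expr) : seq nat :=
  match e with
  | EC _ => [::]
  | EA a e => a :: reads e
  | EAdd e1 e2 | ESub e1 e2 => reads e1 ++ reads e2
  end.

Fixpoint writes (c : cmd) : seq nat :=
  match c with
  | CSkip => [::]
  | CWr a _ _ => [:: a]
  | CSeq c1 c2 | CIf _ c1 c2 => writes c1 ++ writes c2
  | CFor v _ c => v :: writes c
  end.

Fixpoint bounds (c : cmd) : seq nat :=
  match c with
  | CSkip | CWr _ _ _ => [::]
  | CSeq c1 c2 | CIf _ c1 c2 => bounds c1 ++ bounds c2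
  | CFor _ e c => reads e ++ bounds c
  end.

Fixpoint scost (c : cmd) (s : store) : nat :=
  match c with
  | CSkip => 0
  | CWr a e1 e2 => ecost e1 + ecost e2 + 10
  | CSeq c1 c2 => scost c1 s + scost c2 s
  | CIf e c1 c2 => ecost e + 3 + (scost c1 s + scost c2 s)
  | CFor v e c => ecost e + 3 + eval e s * (9 + scost c s)
  end.

Lemma eval_ext e s s' : {in reads e, forall a, s a =1 s' a} -> eval e s = eval e s'.
Proof.
elim: e => //= [a e IH|e1 IH1 e2 IH2|e1 IH1 e2 IH2] h.
- rewrite h ?mem_head // IH // => b hb; apply: h; by rewrite inE hb orbT.
- by rewrite IH1 ?IH2 // => b hb; apply: h; rewrite mem_cat hb ?orbT.
- by rewrite IH1 ?IH2 // => b hb; apply: h; rewrite mem_cat hb ?orbT.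
Qed.

Lemma upd_ne s a i v b : b != a -> upd s a i v b = s b.
Proof. by rewrite /upd => /negbTE ->. Qed.

Lemma upd_same s a i v j : upd s a i v a j = if j == i then v else s a j.
Proof. by rewrite /upd eqxx. Qed.

Lemma upd0 s a v : upd s a 0 v a 0 = v.
Proof. by rewrite upd_same. Qed.

Lemma exec_frame c s a : a \notin writes c -> exec c s a = s a.
Proof.
elim: c s => //= [b e1 e2|c1 IH1 c2 IH2|e c1 IH1 c2 IH2|v e c IH] s.
- by rewrite inE => h; rewrite upd_ne.
- by rewrite mem_cat negb_or => /andP[h1 h2]; rewrite IH2 ?IH1.
- by rewrite mem_cat negb_or => /andP[h1 h2]; case: ifP; rewrite ?IH2 ?IH1.
- rewrite inE negb_or => /andP[h1 h2].
  by elim: (eval e s) => //= k IHk; rewrite IH // upd_ne.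
Qed.

Lemma for_ind (P : nat -> store -> Prop) v e c s :
  P 0 s ->
  (forall k s', k < eval e s -> (forall a, a \notin v :: writes c -> s' a = s a) ->
     P k s' -> P k.+1 (exec c (upd s' v 0 k))) ->
  P (eval e s) (exec (CFor v e c) s).
Proof.
move=> P0 PS /=; set f := fun k s0 => _.
suff [] : P (eval e s) (iteri (eval e s) f s) /\
  (forall a, a \notin v :: writes c -> iteri (eval e s) f s a = s a) by [].
elim: {1 3 4 5}(eval e s) (leqnn (eval e s)) => //= k IH hk.
have [h1 h2] := IH (ltnW hk); split; first exact: PS.
move=> a ha; rewrite /f exec_frame ?upd_ne ?h2 //.
  by move: ha; rewrite inE negb_or => /andP[].
by move: ha; rewrite inE negb_or => /andP[].
Qed.

Lemma exec_map v a b e s : v != a -> a \notin reads e ->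
  forall i, exec (Map v a b e) s a i =
    if i < eval b s then eval e (upd s v 0 i) else s a i.
Proof.
move=> va ae.
pose P k (s' : store) := forall i, s' a i = if i < k then eval e (upd s v 0 i) else s a i.
pose Q k s' := P k s' /\ forall j, j != 0 -> s' v j = s v j.
suff [] : Q (eval b s) (exec (Map v a b e) s) by [].
apply: for_ind => [//|k s' hk fr [IH IHv]] /=.
split=> [i|j hj]; last first.
  by rewrite upd_ne // upd_same (negbTE hj) IHv.
rewrite upd_same upd0 upd_ne 1?eq_sym // IH ltnS.
have -> : eval e (upd s' v 0 k) = eval e (upd s v 0 k).
  apply: eval_ext => c hc j; case: (altP (c =P v)) => [->|cv].
    by rewrite !upd_same; case: eqP => // /eqP; exact: IHv.
  rewrite !upd_ne // fr // !inE negb_or cv /=.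
  by apply: contraNneq ae => <-.
by case: (ltngtP i k) => // ->.
Qed.

Lemma scost_ext c s s' : {in bounds c, forall a, s a =1 s' a} -> scost c s = scost c s'.
Proof.
elim: c => //= [c1 IH1 c2 IH2|e c1 IH1 c2 IH2|v e c IH] h.
- by rewrite IH1 ?IH2 // => b hb; apply: h; rewrite mem_cat hb ?orbT.
- by rewrite IH1 ?IH2 // => b hb; apply: h; rewrite mem_cat hb ?orbT.
- rewrite IH; last by move=> b hb; apply: h; rewrite mem_cat hb ?orbT.
  by rewrite (@eval_ext e s s') // => b hb; apply: h; rewrite mem_cat hb.
Qed.

Definition static (c : cmd) : bool := all (fun a => a \notin writes c) (bounds c).

Lemma cost_static c s : static c -> cost c s <= scost c s.
Proof.
move=> hc; have {hc} : {in bounds c, forall a, a \notin writes c} by exact/allP.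
elim: c s => //= [c1 IH1 c2 IH2|e c1 IH1 c2 IH2|v e c IH] s h.
- apply: leq_add.
    apply: IH1 => a ha; have := h a; rewrite !mem_cat ha => /(_ isT).
    by rewrite negb_or => /andP[].
  apply: leq_trans (IH2 _ _) _ => [a ha|].
    have := h a; rewrite !mem_cat ha orbT => /(_ isT).
    by rewrite negb_or => /andP[].
  rewrite (@scost_ext c2 _ s) // => a ha j; rewrite exec_frame //.
  by have := h a; rewrite !mem_cat ha orbT => /(_ isT); rewrite negb_or => /andP[].
- rewrite leq_add2l; case: ifP => _.
    apply: leq_trans (IH2 _ _) (leq_addl _ _) => a ha.
    by have := h a; rewrite !mem_cat ha orbT => /(_ isT); rewrite negb_or => /andP[].
  apply: leq_trans (IH1 _ _) (leq_addr _ _) => a ha.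
  by have := h a; rewrite !mem_cat ha => /(_ isT); rewrite negb_or => /andP[].
- rewrite leq_add2l.
  have h' a : a \in bounds c -> a != v /\ a \notin writes c.
    move=> ha; have := h a; rewrite !mem_cat ha orbT => /(_ isT).
    by rewrite inE negb_or => /andP[].
  apply: (@leq_trans (\sum_(k < eval e s) (9 + scost c s))).
    apply: leq_sum => k _; rewrite leq_add2l.
    apply: leq_trans (IH _ _) _ => [a /h'[]//|].
    rewrite (@scost_ext c _ s) // => a /h'[a1 a2] j; rewrite upd_ne //.
    by elim: (val k) => //= l IHl; rewrite exec_frame // upd_ne.
  by rewrite sum_nat_const card_ord.
Qed.

(** * Balanced sparse cuts *)

Section Boundary.
Variables (G : finZmodType) (S : seq G).
Implicit Types (Q T : {set G}) (g s x y : G).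
Local Notation n := #|G|.
Local Notation b := (cay_boundary S).

Definition out s Q := #|[set v in Q | (v + s)%R \notin Q]|.

Lemma boundaryE Q : b Q = \sum_(s <- S) out s Q.
Proof.
rewrite /cay_boundary (eq_bigr (fun v => \sum_(s <- S) ((v + s)%R \notin Q : nat))); last first.
  by move=> v _; rewrite -sum1_count big_mkcond.
rewrite exchange_big; apply: eq_bigr => s _.
by rewrite /out -sum1_card -big_mkcondr /=; apply: eq_bigl => v; rewrite inE.
Qed.

Definition shift g Q : {set G} := [set x | (x - g)%R \in Q].

Lemma card_shift g Q : #|shift g Q| = #|Q|.
Proof.
rewrite -[RHS](card_imset _ (@addrI _ g)); apply: eq_card => x.
rewrite inE; apply/idP/imsetP => [h|[y hy ->]]; last by rewrite addrAC subrr add0r.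
by exists (x - g)%R => //; rewrite addrC subrK.
Qed.

Lemma out_shift s g Q : out s (shift g Q) = out s Q.
Proof.
rewrite /out -(card_shift g [set v in Q | _]); apply: eq_card => x.
by rewrite !inE addrAC.
Qed.

Lemma boundary_shift g Q : b (shift g Q) = b Q.
Proof. by rewrite !boundaryE; apply: eq_bigr => s _; exact: out_shift. Qed.

Lemma boundaryU Q T : b (Q :|: T) <= b Q + b T.
Proof.
rewrite !boundaryE -big_split; apply: leq_sum => s _.
apply: leq_trans (leq_card_setU _ _); apply: subset_leq_card.
by apply/subsetP => x; rewrite !inE negb_or => /andP[/orP[]-> /andP[-> ->]]; rewrite ?orbT.
Qed.

Lemma boundary0 : b set0 = 0.
Proof. by rewrite /cay_boundary big_set0. Qed.

Lemma outC s Q : out s (~: Q) = out s Q.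
Proof.
have h1 := cardsID [set v | (v + s)%R \in Q] Q.
have h2 := cardsID Q [set v | (v + s)%R \in Q].
have e1 : #|Q :\: [set v | (v + s)%R \in Q]| = out s Q.
  by apply: eq_card => v; rewrite !inE andbC.
have e2 : #|[set v | (v + s)%R \in Q] :\: Q| = out s (~: Q).
  by apply: eq_card => v; rewrite !inE negbK.
have e3 : #|[set v | (v + s)%R \in Q]| = #|Q|.
  by rewrite -(card_shift (- s)%R Q); apply: eq_card => v; rewrite !inE opprK.
by rewrite e1 in h1; rewrite e2 e3 setIC in h2; exact: (addnI (etrans h2 (esym h1))).
Qed.

Lemma boundaryC Q : b (~: Q) = b Q.
Proof. by rewrite !boundaryE; apply: eq_bigr => s _; exact: outC. Qed.

Lemma boundary_le Q : b Q <= #|Q| * size S.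
Proof.
rewrite /cay_boundary -sum_nat_const; apply: leq_sum => v _; exact: count_size.
Qed.

Definition adm Q := (0 < #|Q|) && (2 * #|Q| <= n).

(* By averaging over all translations. *)
Lemma exists_shift Q (U : {set G}) : 0 < n ->
  exists g, #|U :\: shift g Q| * n <= #|U| * (n - #|Q|).
Proof.
move=> n0; have [x0 _] : exists x : G, true.
  by move: n0; rewrite -cardsT card_gt0 => /set0Pn[x _]; exists x.
pose g := [arg min_(g < x0) #|U :\: shift g Q|]; exists g.
have hmin h : #|U :\: shift g Q| <= #|U :\: shift h Q|.
  by rewrite /g; case: arg_minnP => // i _; apply.
have -> : #|U| * (n - #|Q|) = \sum_(h : G) #|U :\: shift h Q|.
  rewrite (eq_bigr (fun h => \sum_(x in U) ((x - h)%R \notin Q : nat))); last first.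
    move=> h _; rewrite -sum1_card -big_mkcondr; apply: eq_bigl => x.
    by rewrite !inE andbC.
  rewrite exchange_big -sum_nat_const; apply: eq_bigr => x _.
  rewrite -big_mkcond sum1_card.
  have -> : n - #|Q| = #|~: Q| by rewrite -(cardsC Q) addKn.
  have inj : injective (fun h => x - h)%R by move=> h1 h2 /addrI /oppr_inj.
  rewrite -(card_imset _ inj); apply: eq_card => y; rewrite inE.
  apply/idP/imsetP => [hy|[h hh ->]].
    by exists (x - y)%R; rewrite ?subKr // unfold_in subKr.
  by move: hh; rewrite unfold_in.
rewrite mulnC -sum_nat_const; exact: leq_sum.
Qed.

Lemma bernoulli_aux m q k : q <= m -> (m - q) ^ k * (m + k * q) <= m ^ k.+1.
Proof.
move=> qm; elim: k => [|k IH]; first by rewrite expn0 mul0n addn0 mul1n expn1.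
rewrite [_ ^ k.+1]expnS [m ^ k.+2]expnS.
apply: (@leq_trans (m * ((m - q) ^ k * (m + k * q)))); last by rewrite leq_mul2l IH orbT.
rewrite mulnAC mulnC [X in _ <= X]mulnCA leq_mul2l; apply/orP; right.
nia.
Qed.

Lemma cover_aux Q k : 0 < n -> exists T, [/\ #|T| <= k * #|Q|, b T <= k * b Q &
  #|~: T| * n ^ k <= n * (n - #|Q|) ^ k].
Proof.
move=> n0; elim: k => [|k [T [h1 h2 h3]]].
  by exists set0; rewrite cards0 boundary0 !expn0 setC0 cardsT.
have [g hg] := exists_shift Q (~: T) n0.
exists (T :|: shift g Q); split.
- by rewrite mulSnr -(card_shift g Q); apply: leq_trans (leq_card_setU _ _) _; rewrite leq_add2r card_shift.
- by rewrite mulSnr -(boundary_shift g Q); apply: leq_trans (boundaryU _ _) _; rewrite leq_add2r boundary_shift.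
- rewrite setCU -setDE !expnS mulnA (mulnCA n).
  apply: (@leq_trans (#|~: T| * (n - #|Q|) * n ^ k)); first by rewrite leq_mul2r hg orbT.
  by rewrite -mulnA mulnCA leq_mul2l h3 orbT.
Qed.

Lemma enlarge Q : adm Q -> exists T,
  [/\ n <= 5 * #|T|, 2 * #|T| <= n & 2 * #|Q| * b T <= n * b Q].
Proof.
case/andP=> q0 qn; have n0 : 0 < n by lia.
set q := #|Q| in q0 qn *; set k := n %/ (2 * q).
have [T [h1 h2 h3]] := cover_aux Q k n0; rewrite -/q in h1 h3.
have k1 : 0 < k by rewrite divn_gt0; lia.
have k2 : k * (2 * q) <= n by exact: leq_trunc_div.
have k3 : n < k.+1 * (2 * q) by rewrite ltn_ceil //; lia.
exists T; split; last 2 first.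
- nia.
- by apply: (@leq_trans (2 * q * (k * b Q))); [rewrite leq_mul2l h2 orbT | nia].
have h4 : #|~: T| * (n + k * q) <= n * n.
  have qn' : q <= n by lia.
  have hb := bernoulli_aux k qn'.
  have nk : 0 < n ^ k by rewrite expn_gt0 n0.
  rewrite -(leq_pmul2r nk) mulnAC.
  apply: (@leq_trans (n * (n - q) ^ k * (n + k * q))); first by rewrite leq_mul2r h3 orbT.
  by rewrite -mulnA -[X in _ <= X]mulnA -expnS leq_mul2l hb orbT.
have h5 : #|~: T| * 5 <= 4 * n.
  have hq : q <= k * q by rewrite leq_pmull.
  have h6 : 5 * n <= 4 * (n + k * q) by rewrite mulSn in k3; lia.
  rewrite -(leq_pmul2r n0) -mulnA; apply: (@leq_trans (4 * (#|~: T| * (n + k * q)))).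
    by rewrite (mulnCA 4) leq_mul2l h6 orbT.
  by rewrite -mulnA leq_mul2l h4 orbT.
by move: h5; rewrite -(cardsC T); move: #|~: T| #|T| => u v; lia.
Qed.

Lemma cross_mult a c q t u w F :
  0 < F -> q * u = F -> t * w = F -> a * u <= c * w -> a * t <= c * q.
Proof.
move=> F0 e1 e2 h; rewrite -(leq_pmul2r F0) -{1}e1 -e2.
apply: (@leq_trans (q * t * (a * u))); first by nia.
by apply: (@leq_trans (q * t * (c * w))); [rewrite leq_mul2l h orbT|nia].
Qed.

Lemma ex_sparsest Q0 : adm Q0 -> exists2 Q, adm Q &
  forall T, adm T -> b Q * #|T| <= b T * #|Q|.
Proof.
move=> h0; pose F Q := b Q * (n`! %/ #|Q|).
case: (arg_minnP F h0) => Q hQ hmin; exists Q => // T hT.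
have hd U : adm U -> #|U| * (n`! %/ #|U|) = n`!.
  by case/andP=> u0 _; rewrite mulnC divnK // dvdn_fact // u0 max_card.
exact: cross_mult (fact_gt0 n) (hd Q hQ) (hd T hT) (hmin T hT).
Qed.

Lemma balanced_cut Q0 : adm Q0 -> exists Q, [/\ n <= 5 * #|Q|, 2 * #|Q| <= n &
  forall T, adm T -> 2 * b Q * #|T| <= n * b T].
Proof.
move=> h0; have [Q hQ hmin] := ex_sparsest h0.
have [T [h1 h2 h3]] := enlarge hQ; exists T; split=> // U hU.
have q0 : 0 < #|Q| by case/andP: hQ.
rewrite -(leq_pmul2r q0).
have := hmin U hU; nia.
Qed.

End Boundary.

(** * Averages over boxes *)

Section Balls.
Variables (G : finZmodType) (S : seq G).
Implicit Types (Q T : {set G}) (g s x y : G).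

Fixpoint ball (r : nat) (x : G) : {set G} :=
  if r is r'.+1 then
    [set y | (y \in ball r' x) || has (fun s => (y - s)%R \in ball r' x) S]
  else [set x].

Lemma ball_ind (P : nat -> G -> Prop) x :
  P 0 x -> (forall r y, P r y -> P r.+1 y) ->
  (forall r y s, s \in S -> P r y -> P r.+1 (y + s)%R) ->
  forall r y, y \in ball r x -> P r y.
Proof.
move=> h0 h1 h2; elim=> [|r IH] y /=; first by rewrite inE => /eqP->.
rewrite inE => /orP[/IH/h1//|/hasP[s hs /IH h]].
by rewrite -(subrK s y); exact: h2.
Qed.

End Balls.

Section Averages.
Import Order.TTheory Num.Theory.
Variables (G : finZmodType).
Implicit Types (S : seq G) (Q : {set G}) (s x y : G) (f : G -> rat).
Local Open Scope ring_scope.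

Fixpoint avg (l : nat) S f (x : G) : rat :=
  if S is s :: S' then (\sum_(j < l) avg l S' f (x + s *+ j)) / l%:R else f x.

Lemma sum_translate f g : \sum_(x : G) f (x + g) = \sum_x f x.
Proof.
symmetry; rewrite (reindex_inj (addIr g)) /=; exact: eq_bigr.
Qed.

Lemma avg_bound l S f x : (0 < l)%N -> (forall y, 0 <= f y <= 1) ->
  0 <= avg l S f x <= 1.
Proof.
move=> l0 hf; elim: S x => //= s S IH x.
have lp : 0 < l%:R :> rat by rewrite ltr0n.
apply/andP; split.
  by apply: divr_ge0; [apply: sumr_ge0 => j _; case/andP: (IH (x + s *+ j))|exact: ltW].
rewrite ler_pdivrMr // mul1r -[leRHS]mulr1n.
have -> : (1 *+ l *+ 1 : rat) = \sum_(j < l) 1 by rewrite sumr_const card_ord.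
by apply: ler_sum => j _; case/andP: (IH (x + s *+ j)).
Qed.

Lemma variation_mul f s j :
  \sum_x `|f (x + s *+ j) - f x| <= j%:R * \sum_x `|f (x + s) - f x|.
Proof.
elim: j => [|j IH].
  by rewrite mul0r mulr0n big1 // => x _; rewrite addr0 subrr normr0.
rewrite -natr1 mulrDl mul1r.
apply: le_trans (lerD IH (lexx _)).
rewrite -[X in _ <= _ + X](sum_translate (fun x => `|f (x + s) - f x|) (s *+ j)) -big_split /=.
apply: ler_sum => x _; rewrite mulrSr addrA.
by rewrite [leRHS]addrC ler_distD.
Qed.

Lemma avg_close l S f : (0 < l)%N ->
  \sum_x `|avg l S f x - f x| <= l%:R * \sum_(s <- S) \sum_x `|f (x + s) - f x|.
Proof.
move=> l0; have lp : 0 < l%:R :> rat by rewrite ltr0n.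
elim: S => [|s S IH] /=.
  by rewrite big_nil mulr0 big1 // => x _; rewrite subrr normr0.
rewrite big_cons mulrDr.
set V := \sum_x `|f (x + s) - f x|; set W := _ * \sum_(_ <- S) _ in IH *.
apply: (@le_trans _ _ (\sum_x (\sum_(j < l)
    (`|avg l S f (x + s *+ j) - f (x + s *+ j)| + `|f (x + s *+ j) - f x|)) / l%:R)).
  apply: ler_sum => x _.
  have -> : f x = (\sum_(j < l) f x) / l%:R.
    by rewrite sumr_const card_ord -[f x *+ l]mulr_natr mulfK // gt_eqF.
  rewrite -mulrBl -sumrB normrM [`|_^-1|]ger0_norm ?invr_ge0 ?ler0n //.
  rewrite ler_pM2r ?invr_gt0 //.
  apply: le_trans (ler_norm_sum _ _ _) _; apply: ler_sum => j _.
  have -> : (\sum_(j0 < l) f x) / l%:R = f x.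
    by rewrite sumr_const card_ord -[f x *+ l]mulr_natr mulfK // gt_eqF.
  exact: ler_distD.
rewrite -mulr_suml exchange_big /= ler_pdivrMr //.
have -> : (l%:R * V + W) * l%:R = \sum_(j < l) (W + l%:R * V).
  by rewrite sumr_const card_ord -[RHS]mulr_natr addrC.
apply: ler_sum => j _; rewrite big_split /=.
apply: lerD.
  by rewrite (sum_translate (fun x => `|avg l S f x - f x|)).
apply: le_trans (variation_mul _ _ _) _; apply: ler_wpM2r.
  by apply: sumr_ge0.
by rewrite ler_nat ltnW.
Qed.

Lemma telescope_translate f t x l :
  \sum_(j < l) f (x + t + t *+ j) - \sum_(j < l) f (x + t *+ j) =
  f (x + t *+ l) - f x.
Proof.
elim: l => [|l IH]; first by rewrite !big_ord0 subr0 mulr0n addr0 subrr.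
rewrite !big_ord_recr /= opprD addrACA IH -[x + t + _]addrA -mulrS.
by rewrite addrC addrA subrK.
Qed.

Lemma avg_lip l S f s x : (0 < l)%N -> (forall y, 0 <= f y <= 1) -> s \in S ->
  `|avg l S f (x + s) - avg l S f x| <= l%:R^-1.
Proof.
move=> l0 hf; have lp : 0 < l%:R :> rat by rewrite ltr0n.
elim: S x => //= t S IH x; rewrite inE => /orP[/eqP->|hs].
  rewrite -mulrBl normrM [`|_^-1|]ger0_norm ?invr_ge0 ?ler0n //.
  rewrite -[leRHS]mul1r ler_pM2r ?invr_gt0 //.
  rewrite (telescope_translate (avg l S f)).
  have := avg_bound S (x + t *+ l) l0 hf; have := avg_bound S x l0 hf.
  move=> /andP[? ?] /andP[? ?]; rewrite ler_norml; lra.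
rewrite -mulrBl -sumrB normrM [`|_^-1|]ger0_norm ?invr_ge0 ?ler0n //.
rewrite ler_pdivrMr //.
apply: le_trans (ler_norm_sum _ _ _) _.
have -> : l%:R^-1 * l%:R = \sum_(j < l) l%:R^-1 :> rat.
  by rewrite sumr_const card_ord -[RHS]mulr_natr.
by apply: ler_sum => j _; rewrite addrAC; exact: IH.
Qed.

Lemma avg_ball l S f r x y : (0 < l)%N -> (forall y, 0 <= f y <= 1) ->
  y \in ball S r x -> `|avg l S f y - avg l S f x| <= r%:R / l%:R.
Proof.
move=> l0 hf; have li : 0 <= l%:R^-1 :> rat by rewrite invr_ge0 ler0n.
move: r y; apply: ball_ind => [|r y h|r y s hs h].
- by rewrite subrr normr0 mul0r.
- by apply: le_trans h _; rewrite ler_wpM2r // ler_nat.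
- rewrite -natr1 mulrDl mul1r.
  rewrite [leRHS]addrC; apply: le_trans (ler_distD (avg l S f y) _ _) _.
  by apply: lerD => //; exact: avg_lip.
Qed.

Lemma variation_set S Q :
  \sum_(s <- S) \sum_x `|(x + s \in Q)%:R - (x \in Q)%:R| = (2 * cay_boundary S Q)%:R :> rat.
Proof.
rewrite boundaryE big_distrr natr_sum; apply: eq_bigr => s _ /=.
rewrite mul2n -addnn -{1}outC natrD.
have e T : (out s T)%:R = \sum_x ((x \in T) && (x + s \notin T))%:R :> rat.
  rewrite /out -sum1_card natr_sum big_mkcond; apply: eq_bigr => x _.
  by rewrite inE; case: (_ && _).
rewrite !e -big_split; apply: eq_bigr => x _ /=; rewrite !inE.
by case: (x \in Q); case: (x + s \in Q) => //=.
Qed.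

(* Nearby points have nearly the same average of [1_Q] over a box with sides
   [4 * r], so rounding the average at the centre [c x] recovers [Q]. *)
Lemma seed_exists S Q r : (r * (4096 * cay_boundary S Q) <= #|G|)%N ->
  exists sg : G -> bool, forall c : G -> G, (forall x, x \in ball S r (c x)) ->
  (128 * #|[set x | sg (c x) != (x \in Q)]| <= #|G|)%N.
Proof.
case: (posnP r) => [-> _|r0 hr].
  exists (fun x => x \in Q) => c hc; rewrite (_ : [set x | _] = set0) ?cards0 //.
  by apply/setP => x; have := hc x; rewrite !inE => /eqP <-; rewrite eqxx.
set l := (4 * r)%N; have l0 : (0 < l)%N by rewrite /l; lia.
pose f x : rat := (x \in Q)%:R.
have hf x : 0 <= f x <= 1 by rewrite /f; case: (x \in Q).
pose h := avg l S f.
exists (fun x => 2^-1 <= h x) => c hc; set D := [set x | _].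
have h1 : (#|D|)%:R / 4 <= \sum_x `|h x - f x|.
  rewrite -sum1_card natr_sum mulr_suml big_mkcond; apply: ler_sum => x _.
  case: ifP => [|_]; last exact: normr_ge0.
  rewrite inE => hx; have := avg_ball l0 hf (hc x); rewrite -/h.
  have -> : r%:R / l%:R = 4^-1 :> rat.
    rewrite /l natrM invfM mulrCA divff ?mulr1 // pnatr_eq0; lia.
  rewrite ler_norml /f => /andP[a1 a2]; rewrite ler_normr.
  move: (h x) (h (c x)) a1 a2 hx => u v a1 a2.
  by case: (x \in Q); case: (lerP 2^-1 v) => uv //= _; apply/orP; [right|left]; lra.
have := avg_close S f l0; rewrite -/h variation_set => h2.
have := le_trans h1 h2; rewrite ler_pdivrMr // -!natrM ler_nat /l.
nia.
Qed.

End Averages.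

(** * Growth of balls and the size of nets *)

Lemma sum_seq_const (I : Type) (s : seq I) a : \sum_(i <- s) a = size s * a.
Proof. by rewrite big_const_seq count_predT iter_addn_0 mulnC. Qed.

Section Growth.
Variables (G : finZmodType) (S : seq G).
Implicit Types (Q T : {set G}) (g s x y z : G).
Local Notation n := #|G|.
Local Notation d := (size S).
Local Notation b := (cay_boundary S).
Local Notation ball := (ball S).

Lemma ball_self r x : x \in ball r x.
Proof. by elim: r => /= [|r IH]; rewrite inE ?IH. Qed.

Lemma ballS r x : ball r x \subset ball r.+1 x.
Proof. by apply/subsetP => y hy; rewrite /= inE hy. Qed.

Lemma ballW r r' x : r <= r' -> ball r x \subset ball r' x.
Proof.
move/subnKC <-; elim: (r' - r) => [|k IH]; first by rewrite addn0.
by rewrite addnS; apply: subset_trans IH _; exact: ballS.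
Qed.

Lemma ball_step r x y s : s \in S -> y \in ball r x -> (y + s)%R \in ball r.+1 x.
Proof. by move=> hs hy; rewrite /= inE; apply/orP; right; apply/hasP; exists s => //; rewrite addrK. Qed.

Lemma ball_trans r r' x y z : y \in ball r x -> z \in ball r' y -> z \in ball (r + r') x.
Proof.
move=> hy; move: r' z; apply: ball_ind => [|r' z h|r' z s hs h].
- by rewrite addn0.
- by rewrite addnS; apply: (subsetP (ballS _ _)).
- by rewrite addnS; exact: ball_step.
Qed.

Lemma ball_translate r x y g : y \in ball r x -> (y + g)%R \in ball r (x + g)%R.
Proof.
move: r y; apply: ball_ind => [|r y h|r y s hs h]; first exact: ball_self.
  exact: (subsetP (ballS _ _)).
by rewrite addrAC; exact: ball_step.
Qed.

Lemma card_ball r x : #|ball r x| = #|ball r 0%R|.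
Proof.
rewrite -[RHS](card_shift x); apply: eq_card => y; rewrite inE.
apply/idP/idP => h; first by rewrite -(subrr x); exact: ball_translate.
by rewrite -(subrK x y) -[X in ball r X](add0r x); exact: ball_translate.
Qed.

Lemma ball_sum r r' x y : x \in ball r 0%R -> y \in ball r' 0%R ->
  (x + y)%R \in ball (r + r') 0%R.
Proof.
move=> hx /(ball_translate x); rewrite add0r addrC => hy; exact: ball_trans hx hy.
Qed.

Lemma ball_sym r x y : symmetric_mset S -> y \in ball r x -> x \in ball r y.
Proof.
move=> hS; move: r y; apply: ball_ind => [|r y h|r y s hs h]; first exact: ball_self.
  exact: (subsetP (ballS _ _)).
have hs' : (- s)%R \in S.
  by move: hs; rewrite -!has_pred1 !has_count hS.
rewrite -add1n; apply: ball_trans h.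
by have := ball_step hs' (ball_self 0 (y + s)%R); rewrite addrK.
Qed.

Lemma card_bigcup_disjoint (I : eqType) (F : I -> {set G}) (cs : seq I) :
  pairwise (fun i j => [disjoint F i & F j]) cs ->
  \sum_(i <- cs) #|F i| = #|\bigcup_(i <- cs) F i|.
Proof.
elim: cs => [|i cs IH] /=; first by rewrite !big_nil cards0.
case/andP=> hi /IH e; rewrite !big_cons e cardsU (_ : _ :&: _ = set0) ?cards0 ?subn0 //.
apply/eqP; rewrite setI_eq0; apply/pred0P => x /=; apply/negbTE/negP => /andP[h1].
elim: cs hi {IH e} => [|j cs IH] /=; first by rewrite big_nil inE.
case/andP=> hj /IH{}IH; rewrite big_cons inE => /orP[h2|//].
by have /pred0P/(_ x) := hj; rewrite /= h1 h2.
Qed.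

Lemma packing r k cs : symmetric_mset S -> 2 * k <= r ->
  pairwise (fun x y => y \notin ball r x) cs -> size cs * #|ball k 0%R| <= n.
Proof.
move=> hS kr hp.
have <- : \sum_(c <- cs) #|ball k c| = size cs * #|ball k 0%R|.
  by rewrite (eq_bigr _ (fun c _ => card_ball k c)) sum_seq_const.
rewrite card_bigcup_disjoint ?max_card //.
apply: sub_pairwise hp => x y hxy; apply/pred0P => z /=.
apply: contraNF hxy => /andP[hx hy].
apply: (subsetP (ballW x kr)); rewrite mul2n -addnn.
by apply: ball_trans hx _; exact: ball_sym.
Qed.

Lemma boundary_ball r x : b (ball r x) + d * #|ball r x| <= d * #|ball r.+1 x|.
Proof.
have -> : #|ball r.+1 x| = #|ball r.+1 x :\: ball r x| + #|ball r x|.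
  rewrite -(cardsID (ball r x) (ball r.+1 x)) addnC; congr (_ + _).
  by apply: eq_card => y; rewrite inE andb_idl //; apply: (subsetP (ballS _ _)).
rewrite mulnDr leq_add2r boundaryE -sum_seq_const big_seq [X in _ <= X]big_seq.
apply: leq_sum => s hs; rewrite /out -(card_imset _ (addIr s)).
apply: subset_leq_card; apply/subsetP => _ /imsetP[v + ->].
by rewrite inE => /andP[hv hvs]; rewrite in_setD hvs ball_step.
Qed.

Section Doubling.
Variable B : nat.
Hypothesis iso : forall T, adm T -> 2 * B * #|T| <= n * b T.

Lemma ball_growth j k : 2 * #|ball (j + k) 0%R| <= n ->
  n * d * #|ball j 0%R| + k * (2 * B * #|ball j 0%R|) <= n * d * #|ball (j + k) 0%R|.
Proof.
elim: k => [|k IH] h; first by rewrite addn0 mul0n addn0.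
have hk : #|ball (j + k) 0%R| <= #|ball (j + k.+1) 0%R|.
  by rewrite addnS; apply: subset_leq_card; exact: ballS.
have {}IH := IH (leq_trans (leq_mul (leqnn 2) hk) h).
have hj : #|ball j 0%R| <= #|ball (j + k) 0%R|.
  by apply: subset_leq_card; apply: ballW; exact: leq_addr.
have ha : adm (ball (j + k) 0%R).
  rewrite /adm (leq_trans (leq_mul (leqnn 2) hk) h) andbT.
  by apply/card_gt0P; exists 0%R; exact: ball_self.
have h1 := iso ha; have h2 := boundary_ball (j + k) 0%R.
rewrite addnS mulSn addnCA.
apply: (@leq_trans (2 * B * #|ball (j + k) 0%R| + n * d * #|ball (j + k) 0%R|)).
  by apply: leq_add IH; rewrite leq_mul2l hj orbT.
apply: leq_trans (leq_add h1 (leqnn _)) _.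
by rewrite -!mulnA -mulnDr leq_mul2l h2 orbT.
Qed.

Lemma ball_doubling j k i : n * d <= k * (2 * B) -> 0 < n * d ->
  2 * #|ball (j + i * k) 0%R| <= n -> 2 ^ i * #|ball j 0%R| <= #|ball (j + i * k) 0%R|.
Proof.
move=> hk nd; elim: i => [|i IH] h; first by rewrite mul1n addn0.
have e : j + i.+1 * k = j + i * k + k by rewrite mulSn addnA addnAC.
rewrite e in h *.
have h1 : #|ball (j + i * k) 0%R| <= #|ball (j + i * k + k) 0%R|.
  by apply: subset_leq_card; apply: ballW; exact: leq_addr.
have {}IH := IH (leq_trans (leq_mul (leqnn 2) h1) h).
have h2 := ball_growth h.
rewrite expnS -mulnA; apply: leq_trans (leq_mul (leqnn 2) IH) _.
rewrite -(leq_pmul2l nd); apply: leq_trans h2.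
by rewrite mulnCA mul2n -addnn leq_add2l mulnA leq_mul2r hk orbT.
Qed.

End Doubling.

Lemma ball_coords r y : y \in ball r 0%R -> exists2 a : 'I_d -> nat,
  \sum_i a i <= r & y = (\sum_i tnth (in_tuple S) i *+ a i)%R.
Proof.
move: r y; apply: ball_ind => [|r y [a h e]|r y s hs [a h e]].
- by exists (fun=> 0); rewrite ?big1.
- by exists a => //; exact: leqW.
- move: hs; rewrite -[S]/(tval (in_tuple S)) => /tnthP[i0 ->].
  exists (fun i => a i + (i == i0)).
    rewrite big_split /= (_ : \sum_i (i == i0) = 1) ?addn1 //.
    by rewrite (bigD1 i0) //= eqxx big1 // => i /negbTE ->.
  rewrite (eq_bigr (fun i => tnth (in_tuple S) i *+ a i + tnth (in_tuple S) i *+ (i == i0))%R); last first.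
    by move=> i _; rewrite mulrnDr.
  rewrite big_split /= -e; congr (_ + _)%R.
  by rewrite (bigD1 i0) //= eqxx mulr1n big1 ?addr0 // => i /negbTE ->; rewrite mulr0n.
Qed.

Lemma coords_ball (a : 'I_d -> nat) :
  (\sum_i tnth (in_tuple S) i *+ a i)%R \in ball (\sum_i a i) 0%R.
Proof.
apply: (big_ind2 (fun x k => x \in ball k 0%R)) => [|x1 k1 x2 k2|i _].
- exact: ball_self.
- exact: ball_sum.
- elim: (a i) => [|k IH]; first by rewrite mulr0n ball_self.
  by rewrite mulrSr; apply: ball_step => //; exact: mem_tnth.
Qed.

Lemma ball_cover k t : 0 < d ->
  #|ball ((k %/ d).+1 * t) 0%R| <= t.+1 ^ d * #|ball k 0%R|.
Proof.
move=> d0; set m := (k %/ d).+1.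
pose F (u : {ffun 'I_d -> 'I_t.+1} * G) : G :=
  (\sum_i tnth (in_tuple S) i *+ (m * u.1 i)%N + u.2)%R.
have -> : t.+1 ^ d * #|ball k 0%R| = #|setX [set: {ffun 'I_d -> 'I_t.+1}] (ball k 0%R)|.
  by rewrite cardsX cardsT card_ffun !card_ord.
apply: leq_trans (leq_imset_card F _); apply: subset_leq_card.
apply/subsetP => y /ball_coords[a ha ->].
have ha' i : a i %/ m < t.+1.
  rewrite ltnS -(mulKn t (ltn0Sn (k %/ d))) leq_div2r //.
  by apply: leq_trans ha; rewrite (bigD1 i) //= leq_addr.
apply/imsetP; exists ([ffun i => Ordinal (ha' i)],
   (\sum_i tnth (in_tuple S) i *+ (a i %% m))%R); last first.
  rewrite /F /= -big_split; apply: eq_bigr => i _ /=.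
  by rewrite ffunE /= -mulrnDr mulnC -divn_eq.
rewrite !inE /=; apply: (subsetP (ballW _ _)) (coords_ball (fun i => a i %% m)).
apply: (@leq_trans (\sum_(i < d) k %/ d)); last first.
  by rewrite sum_nat_const card_ord mulnC leq_trunc_div.
by apply: leq_sum => i _; rewrite -ltnS ltn_mod.
Qed.

(* With [r] of order [n/(4096 B)] and [m = (r/2)/d + 1], balls double every
   [4096 d^2 m] steps, so [30 d^2] doublings take at most [m t] steps, where
   [t = d + 30 d^2 * 4096 d^2 < 2^17 d^4]. *)
Definition cell_bound (e : nat) := 2 * (2 ^ 17 * e ^ 4) ^ e.

Lemma pow_bound c e : 0 < e -> 2 ^ c * e ^ 4 <= 2 ^ (c * e) * (2 ^ e) ^ 4.
Proof.
move=> e0; rewrite leq_mul //; first by rewrite leq_pexp2l // leq_pmulr.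
by rewrite leq_exp2r // ltnW // ltn_expl.
Qed.

Lemma net_size B r cs : symmetric_mset S -> 0 < d -> 0 < B ->
  (forall T, adm T -> 2 * B * #|T| <= n * b T) -> n < r.+1 * (4096 * B) ->
  pairwise (fun x y => y \notin ball r x) cs -> size cs <= cell_bound d.
Proof.
move=> hS d0 B0 iso hr hp.
set k := r %/ 2; set m := (k %/ d).+1.
pose N0 := 4096 * (d * d); pose i := 30 * d * d; pose t := d + i * N0.
have t_le : t.+1 <= 2 ^ 17 * d ^ 4.
  rewrite (expnD 2 5 12) (expnD d 2 2) -[2 ^ 5]/32 -[2 ^ 12]/4096 -[d ^ 2]/(d * d).
  rewrite /t /i /N0; have : 1 <= d * d by rewrite muln_gt0 d0.
  have : d <= d * d by rewrite leq_pmull.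
  rewrite -[30 * d * d]mulnA; move: (d * d) => x dx x1.
  rewrite [30 * x * _]mulnACA; have : x <= x * x by rewrite leq_pmull.
  by move: (x * x) => y xy; lia.
have t_lt : t.+1 < 2 ^ (30 * d).
  apply: leq_ltn_trans t_le _.
  apply: leq_ltn_trans (pow_bound 17 d0) _.
  by rewrite -expnM -expnD ltn_exp2l //; lia.
have km : r.+1 <= 2 * (d * m).
  have : k < m * d by rewrite ltn_ceil.
  have : r < k.+1 * 2 by rewrite ltn_ceil.
  lia.
have hk : n * d <= (N0 * m) * (2 * B).
  apply: (@leq_trans (r.+1 * (4096 * B) * d)); first by rewrite leq_mul2r (ltnW hr) orbT.
  apply: (@leq_trans (2 * (d * m) * (4096 * B) * d)); first by rewrite !leq_mul2r km !orbT.
  by rewrite /N0; nia.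
have n0 : 0 < n by apply/card_gt0P; exists 0%R.
have b0 : 0 < #|ball k 0%R| by apply/card_gt0P; exists 0%R; exact: ball_self.
have hpk : size cs * #|ball k 0%R| <= n by apply: packing hp => //; rewrite mulnC leq_trunc_div.
have cov := ball_cover k t d0; rewrite -/m in cov.
have big : n < 2 * #|ball (m * t) 0%R|.
  rewrite ltnNge; apply/negP => h.
  have e : m * t = d * m + i * (N0 * m) by rewrite /t mulnDr (mulnCA m) (mulnC m N0) (mulnC m d).
  have h1 := @ball_doubling B iso (d * m) (N0 * m) i hk; rewrite muln_gt0 n0 d0 -e in h1.
  have {}h1 := h1 isT h.
  have h2 : #|ball k 0%R| <= #|ball (d * m) 0%R|.
    by apply: subset_leq_card; apply: ballW; rewrite mulnC ltnW // ltn_ceil.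
  have h3 : 2 ^ i * #|ball k 0%R| <= t.+1 ^ d * #|ball k 0%R|.
    by apply: leq_trans cov; apply: leq_trans h1; rewrite leq_mul2l h2 orbT.
  by move: h3; rewrite leq_pmul2r // /i expnM leq_exp2r // leqNgt t_lt.
have : size cs * #|ball k 0%R| < 2 * t.+1 ^ d * #|ball k 0%R|.
  by apply: leq_ltn_trans hpk (leq_trans big _); rewrite -mulnA leq_mul2l cov orbT.
rewrite ltn_pmul2r // => /ltnW h; apply: leq_trans h _.
by rewrite /cell_bound leq_mul2l leq_exp2r.
Qed.

End Growth.

(** * Subgradient descent *)

Section Descent.
Import Order.TTheory Num.Theory.
Variables (G : finZmodType) (S : seq G).
Implicit Types (Q T P : {set G}) (s x y : G) (h : G -> nat).
Local Notation n := #|G|.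
Local Notation d := (size S).
Local Notation b := (cay_boundary S).

Definition sdiff T P : {set G} := [set x | (x \in T) != (x \in P)].

Definition up h x := count (fun s => h x < h (x + s)%R) S.
Definition dn h x := count (fun s => h (x + s)%R < h x) S.

Definition descend (M lam : nat) P h : G -> nat := fun x =>
  minn M (h x + (n * up h x + lam * (x \in P)) - (n * dn h x + lam * (x \notin P))).

Definition energy lam P T := n * b T + lam * #|sdiff T P|.

Definition level h (th : nat) : {set G} := [set x | th < h x].

Definition tv h := \sum_(x : G) \sum_(s <- S) (h x - h (x + s)%R).

Definition fit M P h := \sum_(x : G) (if x \in P then M - h x else h x).

Lemma sum_interval (M a c : nat) : a <= M -> \sum_(th < M) ((c <= th) && (th < a)) = a - c.
Proof.
move=> aM; elim: M a aM => [|M IH] a aM.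
  by rewrite big_ord0; lia.
rewrite big_ord_recr /=; case: (ltnP M a) => Ma.
  have -> : a = M.+1 by lia.
  rewrite (eq_bigr (fun th : 'I_M => ((c <= th) && (th < M) : nat))); last first.
    by move=> th _; have := ltn_ord th; lia.
  by rewrite IH //; lia.
by rewrite IH // andbF addn0.
Qed.

Lemma tv_levels M h : (forall x, h x <= M) -> tv h = \sum_(th < M) b (level h th).
Proof.
move=> hM; rewrite /tv.
rewrite (eq_bigr (fun x => \sum_(th < M) \sum_(s <- S) ((h (x + s)%R <= th) && (th < h x)))); last first.
  by move=> x _; rewrite exchange_big; apply: eq_bigr => s _ /=; rewrite sum_interval.
rewrite exchange_big; apply: eq_bigr => th _; rewrite /cay_boundary [RHS]big_mkcond.
apply: eq_bigr => x _; rewrite inE; case: ifP => hx; last first.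
  by rewrite big1 // => s _; rewrite andbF.
by rewrite -sum1_count [RHS]big_mkcond; apply: eq_bigr => s _; rewrite inE andbT -leqNgt; case: (_ <= _).
Qed.

Lemma fit_levels M P h : (forall x, h x <= M) ->
  fit M P h = \sum_(th < M) #|sdiff (level h th) P|.
Proof.
move=> hM; rewrite /fit.
rewrite (eq_bigr (fun x => \sum_(th < M) (x \in sdiff (level h th) P))); last first.
  move=> x _; case: ifP => hx.
    rewrite -(sum_interval (h x) (leqnn M)); apply: eq_bigr => th _.
    by rewrite !inE hx ltn_ord andbT eqb_id -leqNgt.
  rewrite -{1}[h x]subn0 -(sum_interval 0 (hM x)); apply: eq_bigr => th _.
  by rewrite !inE hx /=; case: (_ < _).
by rewrite exchange_big; apply: eq_bigr => th _; rewrite -sum1_card [RHS]big_mkcond.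
Qed.

Definition objective M lam P h := n * tv h + lam * fit M P h.

Lemma objective_levels M lam P h : (forall x, h x <= M) ->
  objective M lam P h = \sum_(th < M) energy lam P (level h th).
Proof.
by move=> hM; rewrite /objective (tv_levels hM) (fit_levels P hM) !big_distrr -big_split.
Qed.

Lemma objective_indicator M lam P Q :
  objective M lam P (fun x => M * (x \in Q)) = M * energy lam P Q.
Proof.
rewrite objective_levels; last by move=> x; case: (x \in Q); rewrite ?muln1 ?muln0.
rewrite -[M in RHS]card_ord -sum_nat_const; apply: eq_bigr => th _; congr energy.
by apply/setP => x; rewrite inE; case: (x \in Q); rewrite /= ?muln1 ?muln0 ?ltn_ord.
Qed.

Hypothesis S_sym : symmetric_mset S.

Lemma perm_opp : perm_eq S (map (@GRing.opp G) S).
Proof.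
apply/allP => x _ /=; apply/eqP; rewrite count_map S_sym; apply: eq_count => y /=.
by rewrite -eqr_oppLR.
Qed.

Local Open Scope ring_scope.

Lemma sum_opp (f : G -> int) : \sum_(s <- S) f (- s) = \sum_(s <- S) f s.
Proof. by rewrite [RHS](perm_big _ perm_opp) big_map. Qed.

Definition grad (lam : nat) P h x : int :=
  (n * dn h x + lam * (x \notin P))%N%:Z - (n * up h x + lam * (x \in P))%N%:Z.

Lemma countZ (p : pred G) : (count p S)%:Z = \sum_(s <- S) (p s : nat)%:Z.
Proof.
elim: S => [|s S' IH] /=; first by rewrite big_nil.
by rewrite big_cons -IH PoszD.
Qed.

Lemma natzM (p q : nat) : (p * q)%N%:Z = p%:Z * q%:Z.
Proof. by []. Qed.

Lemma sumZ (I : Type) (r : seq I) (f : I -> nat) :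
  (\sum_(i <- r) f i)%N%:Z = \sum_(i <- r) (f i)%:Z.
Proof.
elim: r => [|i r IH]; first by rewrite !big_nil.
by rewrite !big_cons PoszD IH.
Qed.

Lemma tv_convex h h' :
  (tv h)%:Z - (tv h')%:Z <=
  \sum_x ((dn h x)%:Z - (up h x)%:Z) * ((h x)%:Z - (h' x)%:Z).
Proof.
pose e x : int := (h x)%:Z - (h' x)%:Z.
pose I x y : int := (h y < h x)%N%:Z.
apply: (@le_trans _ _ (\sum_x \sum_(s <- S) I x (x + s) * (e x - e (x + s)))).
  rewrite /tv !sumZ -sumrB; apply: ler_sum => x _.
  rewrite !sumZ -sumrB; apply: ler_sum => s _; rewrite /I /e.
  by case: ltnP => hx /=; lia.
rewrite le_eqVlt; apply/orP; left; apply/eqP.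
rewrite (eq_bigr (fun x => \sum_(s <- S) I x (x + s) * e x
   - \sum_(s <- S) I x (x + s) * e (x + s))); last first.
  by move=> x _; rewrite -sumrB; apply: eq_bigr => s _; rewrite mulrBr.
rewrite sumrB.
have -> : \sum_x \sum_(s <- S) I x (x + s) * e (x + s) = \sum_x \sum_(s <- S) I (x + s) x * e x.
  rewrite exchange_big [RHS]exchange_big /=.
  rewrite -(sum_opp (fun s => \sum_x I (x + s) x * e x)); apply: eq_bigr => s _.
  rewrite [RHS](reindex_inj (addIr s)) /=.
  by apply: eq_bigr => x _; rewrite addrK.
rewrite -sumrB; apply: eq_bigr => x _.
by rewrite mulrBl /dn /up !countZ !mulr_suml.
Qed.

Lemma fit_convex M P h h' : (forall x, (h x <= M)%N) -> (forall x, (h' x <= M)%N) ->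
  (fit M P h)%:Z - (fit M P h')%:Z =
  \sum_x ((x \notin P)%:Z - (x \in P)%:Z) * ((h x)%:Z - (h' x)%:Z).
Proof.
move=> hM hM'; rewrite /fit !sumZ -sumrB; apply: eq_bigr => x _.
by have := hM x; have := hM' x; case: (x \in P) => /=; lia.
Qed.

Lemma objective_convex M lam P h h' :
  (forall x, (h x <= M)%N) -> (forall x, (h' x <= M)%N) ->
  (objective M lam P h)%:Z - (objective M lam P h')%:Z <=
  \sum_x grad lam P h x * ((h x)%:Z - (h' x)%:Z).
Proof.
move=> hM hM'.
have -> : \sum_x grad lam P h x * ((h x)%:Z - (h' x)%:Z) =
   n%:Z * (\sum_x ((dn h x)%:Z - (up h x)%:Z) * ((h x)%:Z - (h' x)%:Z)) +
   lam%:Z * ((fit M P h)%:Z - (fit M P h')%:Z).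
  rewrite fit_convex // !mulr_sumr -big_split; apply: eq_bigr => x _ /=.
  by rewrite /grad !PoszD !natzM; ring.
rewrite /objective !PoszD !natzM.
have -> : n%:Z * (tv h)%:Z + lam%:Z * (fit M P h)%:Z
    - (n%:Z * (tv h')%:Z + lam%:Z * (fit M P h')%:Z) =
  n%:Z * ((tv h)%:Z - (tv h')%:Z) + lam%:Z * ((fit M P h)%:Z - (fit M P h')%:Z) by ring.
by rewrite lerD2r ler_wpM2l // tv_convex.
Qed.

Definition sqdist h h' : int := \sum_x ((h x)%:Z - (h' x)%:Z) ^+ 2.

Lemma clip_sq (M p q s u : nat) : (s <= M)%N ->
  ((minn M (u + q - p))%:Z - s%:Z) ^+ 2 <= (u%:Z - s%:Z - (p%:Z - q%:Z)) ^+ 2.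
Proof.
move=> sM; set z : int := (minn _ _)%:Z - _; set w : int := _ - (_ - _).
have : `|z| <= `|w| by rewrite /z /w; lia.
by rewrite -ler_sqr ?nnegrE // !real_normK ?num_real.
Qed.

Lemma sqdist_descend M lam P h h' : (forall x, (h' x <= M)%N) ->
  sqdist (descend M lam P h) h' <= sqdist h h'
   - 2 * (\sum_x grad lam P h x * ((h x)%:Z - (h' x)%:Z))
   + \sum_x grad lam P h x ^+ 2.
Proof.
move=> hM'; rewrite /sqdist mulr_sumr -sumrB -big_split; apply: ler_sum => x _ /=.
apply: le_trans (clip_sq _ _ _ (hM' x)) _; rewrite /grad.
move: (Posz (n * dn _ _ + _)%N) (Posz (n * up _ _ + _)%N) (Posz _) (Posz _) => p q u v.
rewrite le_eqVlt; apply/orP; left; apply/eqP; ring.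
Qed.

Lemma grad_sq M lam P h x : ((n * d + lam) ^ 2 <= M)%N -> grad lam P h x ^+ 2 <= M%:Z.
Proof.
move=> hM; apply: (@le_trans _ _ ((n * d + lam) ^ 2)%N%:Z) => //.
have h1 : (n * dn h x <= n * d)%N by rewrite leq_mul2l count_size orbT.
have h2 : (n * up h x <= n * d)%N by rewrite leq_mul2l count_size orbT.
have : `|grad lam P h x| <= (n * d + lam)%N%:Z.
  rewrite /grad; move: (n * dn h x)%N (n * up h x)%N (n * d)%N h1 h2 => p q m h1 h2.
  by case: (x \in P); rewrite /= ?muln1 ?muln0; lia.
rewrite -ler_sqr ?nnegrE // real_normK ?num_real // => /le_trans; apply.
Qed.

Lemma descent_finds M lam P Q B : (0 < M)%N -> (0 < n * B)%N ->
  ((n * d + lam) ^ 2 <= M)%N -> (energy lam P Q <= 2 * (n * B))%N ->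
  exists t th, [/\ (t <= M)%N, (th < M)%N &
   (energy lam P (level (iter t (descend M lam P) (fun=> 0%N)) th) < 3 * (n * B))%N].
Proof.
move=> M0 nB hM hQ; pose H t := iter t (descend M lam P) (fun=> 0%N).
have HM t x : (H t x <= M)%N by case: t => [|t] //=; exact: geq_minl.
pose hs x := (M * (x \in Q))%N.
have hsM x : (hs x <= M)%N by rewrite /hs; case: (x \in Q); rewrite /= ?muln1 ?muln0.
case: (boolP [exists t : 'I_M.+1, exists th : 'I_M,
   (energy lam P (level (H t) th) < 3 * (n * B))%N]).
  case/existsP=> t /existsP[th h]; exists (t : nat), (th : nat); split=> //.
  by rewrite -ltnS.
rewrite negb_exists => /forallP hno; exfalso.
have key t : (t <= M)%N ->
    sqdist (descend M lam P (H t)) hs <= sqdist (H t) hs - M%:Z * n%:Z.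
  rewrite -ltnS => ht; have := hno (Ordinal ht); rewrite negb_exists => /forallP{}hno.
  have h1 : (M * (3 * (n * B)) <= objective M lam P (H t))%N.
    rewrite (objective_levels lam P (HM t)) -{1}[M in X in (X <= _)%N]card_ord -sum_nat_const.
    by apply: leq_sum => th _; rewrite leqNgt; exact: hno.
  have h2 : (objective M lam P hs <= M * (2 * (n * B)))%N.
    by rewrite objective_indicator leq_mul2l hQ orbT.
  have h3 := objective_convex lam P (HM t) hsM.
  have h4 := sqdist_descend lam P (H t) hsM.
  have h5 : \sum_x grad lam P (H t) x ^+ 2 <= M%:Z * n%:Z.
    apply: (@le_trans _ _ (\sum_(x : G) M%:Z)).
      by apply: ler_sum => x _; exact: grad_sq.
    by rewrite sumr_const -mulr_natr natz.
  have h6 : (M * n <= M * (n * B))%N by rewrite !leq_mul2l leq_pmulr ?orbT //; move: nB; rewrite muln_gt0 => /andP[].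
  move: h3 h4 h5; set X := \sum_x _ * _; set Y := \sum_x _ ^+ 2.
  move: (objective _ _ _ _) (objective _ _ _ _) h1 h2 => o1 o2 h1 h2.
  by move: (sqdist (H t) hs) (sqdist (descend _ _ _ _) hs) => D0 D1; lia.
have : sqdist (H M.+1) hs <= n%:Z * (M%:Z ^+ 2) - (M.+1)%:Z * (M%:Z * n%:Z).
  elim: {-2}M.+1 (leqnn M.+1) => [_|t IH ht].
    rewrite mul0r subr0 /sqdist; apply: (@le_trans _ _ (\sum_(x : G) M%:Z ^+ 2)).
      by apply: ler_sum => x _; rewrite sub0r sqrrN /hs; case: (x \in Q);
        rewrite /= ?muln1 ?muln0 ?expr0n //= ?sqr_ge0.
    by rewrite sumr_const -mulr_natl natz.
  apply: le_trans (key t ht) _; have := IH (ltnW ht).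
  have -> : (t.+1)%:Z = t%:Z + 1 by lia.
  by rewrite mulrDl mul1r; lia.
have : 0 <= sqdist (H M.+1) hs by apply: sumr_ge0 => x _; exact: sqr_ge0.
move=> h1 h2; have := le_trans h1 h2.
have n0 : (0 < n)%N by move: nB; rewrite muln_gt0 => /andP[].
have -> : n%:Z * (M%:Z ^+ 2) - (M.+1)%:Z * (M%:Z * n%:Z) = - (M%:Z * n%:Z).
  have -> : (M.+1)%:Z = M%:Z + 1 by lia.
  by ring.
by rewrite oppr_ge0 -natzM lez_nat leqn0 muln_eq0 !gtn_eqF.
Qed.

End Descent.

(** * The search finds a sparse cut *)

Section Main.
Variables (G : finZmodType) (S : seq G).
Implicit Types (Q T P : {set G}) (s x y : G).
Local Notation n := #|G|.
Local Notation d := (size S).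
Local Notation b := (cay_boundary S).
Local Notation ball := (ball S).

Lemma ball_stable x : ball n.+1 x = ball n x.
Proof.
suff h r : ball r.+1 x = ball r x \/ r < #|ball r x|.
  by case: (h n) => //; by rewrite ltnNge max_card.
pose F (T : {set G}) : {set G} := [set y | (y \in T) || has (fun s => (y - s)%R \in T) S].
elim: r => [|r [IH|IH]]; first by right; rewrite cards1.
  by left; rewrite -[ball r.+2 x]/(F (ball r.+1 x)) IH; exact: IH.
case: (eqVneq (ball r.+1 x) (ball r x)) => e.
  by left; rewrite -[ball r.+2 x]/(F (ball r.+1 x)) e; exact: e.
right; apply: leq_ltn_trans IH _.
by apply: proper_card; rewrite properEneq eq_sym e ballS.
Qed.

Lemma ball_closed Q x r : b Q = 0 -> x \in Q -> ball r x \subset Q.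
Proof.
move=> bQ hx; apply/subsetP => y; move: r y; apply: ball_ind => // r y s hs hy.
apply/negPn/negP => h; suff : 0 < b Q by rewrite bQ.
rewrite boundaryE (big_rem s hs) /= addn_gt0; apply/orP; left.
by apply/card_gt0P; exists y; rewrite inE hy.
Qed.

Lemma component Q x : adm Q -> b Q = 0 -> b (ball n x) = 0 /\ adm (ball n x).
Proof.
case/andP=> /card_gt0P[y hy] hQ bQ; split.
  have := boundary_ball S n x; rewrite ball_stable; lia.
rewrite /adm card_ball -(card_ball _ _ y); apply/andP; split.
  by apply/card_gt0P; exists y; exact: ball_self.
apply: leq_trans hQ; rewrite leq_mul2l /=; apply: subset_leq_card; exact: ball_closed.
Qed.

Definition is_net r (cs : seq G) (asg : G -> nat) : Prop :=
  pairwise (fun x y => y \notin ball r x) cs /\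
  forall x, asg x < size cs /\ x \in ball r (nth 0%R cs (asg x)).

Definition lam_bound := 256 * (n * d).
Definition height := (2 * lam_bound) ^ 2.

Definition pattern (sel : nat -> bool) (asg : G -> nat) : {set G} :=
  [set x | (asg x < cell_bound d) && sel (asg x)].

Definition candidate lam P t th : {set G} :=
  level (iter t (descend S height lam P) (fun=> 0)) th.

Definition searched (cons : {set G} -> Prop) : Prop :=
  forall r, r <= n -> exists cs asg, [/\ is_net r cs asg,
    forall c, c \in cs -> cons (ball r c) &
    forall sel lam t th, lam < lam_bound -> t <= height -> th < height ->
      let T := candidate lam (pattern sel asg) t th in cons T /\ cons (~: T)].

Lemma sdiff_card T P Q : #|sdiff T Q| <= #|sdiff T P| + #|sdiff P Q|.
Proof.
apply: leq_trans (leq_card_setU _ _); apply: subset_leq_card; apply/subsetP => x.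
by rewrite !inE; case: (x \in T); case: (x \in P); case: (x \in Q).
Qed.

Lemma sdiffC T P : sdiff T P = sdiff P T.
Proof. by apply/setP => x; rewrite !inE eq_sym. Qed.

Lemma card_sdiff T P : #|T| <= #|P| + #|sdiff T P|.
Proof.
apply: leq_trans (leq_card_setU _ _); apply: subset_leq_card; apply/subsetP => x.
by rewrite !inE; case: (x \in T); case: (x \in P).
Qed.

Hypotheses (S_sym : symmetric_mset S) (n2 : 2 <= n) (d1 : 0 < d).

Theorem search_approx (cons : {set G} -> Prop) : searched cons ->
  exists T, [/\ cons T, adm T & forall Q, adm Q -> b T * #|Q| <= 10 * (b Q * #|T|)].
Proof.
move=> hs.
have h0 : adm [set (0%R : G)] by rewrite /adm cards1 muln1.
have [Q [q5 q2 iso]] := balanced_cut S h0.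
have Qadm : adm Q by rewrite /adm q2 andbT; move: q5 n2; case: #|Q| => //; lia.
case: (posnP (b Q)) => [bQ|B0].
  have [cs [asg [[_ ha] hc _]]] := hs n (leqnn n).
  have [a1 _] := ha 0%R; set c := nth 0%R cs (asg 0%R).
  have [bc ac] := component c Qadm bQ.
  exists (ball n c); split=> //; first by apply: hc; exact: mem_nth.
  by move=> T hT; rewrite bc.
set B := b Q in iso B0.
have B4 : 0 < 4096 * B by rewrite muln_gt0.
pose r := n %/ (4096 * B).
have rn : r <= n by exact: leq_div.
have [sg hsg] : exists sg : G -> bool, forall c : G -> G,
    (forall x, x \in ball r (c x)) -> 128 * #|[set x | sg (c x) != (x \in Q)]| <= n.
  by apply: seed_exists; rewrite leq_trunc_div.
have [cs [asg [[sep ha] _ hc]]] := hs r rn.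
have hK : size cs <= cell_bound d.
  by apply: net_size iso _ sep => //; rewrite ltn_ceil.
pose sel k := sg (nth 0%R cs k).
set P := pattern sel asg.
have hP : 128 * #|sdiff P Q| <= n.
  have -> : sdiff P Q = [set x | sg (nth 0%R cs (asg x)) != (x \in Q)].
    by apply/setP => x; rewrite !inE (leq_trans (proj1 (ha x)) hK).
  by apply: hsg => x; case: (ha x).
have hB : 2 * B <= n * d.
  have := boundary_le S Q; rewrite -/B; move: #|Q| q2 => q q2 h.
  apply: leq_trans (leq_mul (leqnn 2) h) _; by rewrite mulnA leq_mul2r q2 orbT.
pose lam := 128 * B.
have lamb : lam < lam_bound by rewrite /lam /lam_bound; lia.
have M0 : 0 < height by rewrite /height expn_gt0 muln_gt0 (leq_ltn_trans _ lamb).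
have nB : 0 < n * B by rewrite muln_gt0 B0 (leq_trans _ n2).
have hM : (n * d + lam) ^ 2 <= height.
  by rewrite /height leq_exp2r // /lam_bound /lam; lia.
have hE : energy S lam P Q <= 2 * (n * B).
  rewrite /energy -/B sdiffC mul2n -addnn leq_add2l /lam mulnAC.
  by rewrite leq_mul2r hP orbT.
have [t [th [ht hth hT]]] := descent_finds S_sym M0 nB hM hE.
have [cT cT'] := hc sel lam t th lamb ht hth.
rewrite -/P /candidate in cT cT'.
set T := level _ _ in hT cT cT'.
have bT : b T <= 3 * B.
  have : n * b T < 3 * (n * B) by apply: leq_ltn_trans hT; rewrite leq_addr.
  by rewrite mulnCA ltn_mul2l => /andP[_ /ltnW].
have dT : 128 * #|sdiff T P| <= 3 * n.
  have : lam * #|sdiff T P| < 3 * (n * B) by apply: leq_ltn_trans hT; rewrite leq_addl.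
  by rewrite /lam mulnAC mulnA ltn_mul2r => /andP[_ /ltnW].
have h1 := sdiff_card T P Q.
have h2 := card_sdiff T Q.
have h3 : #|Q| <= #|T| + #|sdiff T Q| by rewrite (sdiffC T Q); exact: card_sdiff.
have h4 : #|~: T| = n - #|T| by rewrite -(cardsC T) addKn.
have fin U : b U = b T -> 4 * n <= 25 * #|U| -> forall R, adm R ->
    b U * #|R| <= 10 * (b R * #|U|).
  move=> -> hU R hR; have := iso R hR.
  move: (b R) #|R| #|U| hU => br cr u hU h.
  have h5 : 4 * (b T * cr) <= 3 * (2 * (2 * B * cr)).
    by have := leq_mul bT (leqnn cr); lia.
  have h6 : 4 * (n * br) <= 25 * (u * br).
    by have := leq_mul hU (leqnn br); lia.
  lia.
have h5 : 128 * #|T| <= 68 * n by clear -dT hP h1 h2 q2; lia.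
have h6 : 4 * n <= 25 * #|T| by clear -dT hP h1 h3 q5; lia.
case: (leqP (2 * #|T|) n) => hn.
  exists T; split=> //; last exact: fin.
  by rewrite /adm hn andbT; clear -h6 n2; lia.
have h7 : 4 * n <= 25 * #|~: T| by rewrite h4; clear -h5; lia.
exists (~: T); split=> //; last by apply: fin => //; exact: boundaryC.
by rewrite /adm h4; clear -h5 n2 hn; lia.
Qed.

End Main.

(** * Recording the best candidate *)

Notation aIN := 0. Notation vN := 1. Notation vD := 2. Notation aROW := 3.
Notation vSB := 4. Notation vY := 5. Notation vLB := 6. Notation vM := 7.
Notation vTAU := 8. Notation vDD := 9. Notation vP2 := 10.
Notation aC := 11. Notation aNEW := 12. Notation aASG := 13. Notation vK := 14.
Notation aSEL := 15. Notation aP := 16. Notation aH := 17. Notation aH2 := 18.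
Notation aBEST := 19. Notation vBS := 20. Notation vBB := 21. Notation vSZ := 22.
Notation vBD := 23. Notation vPA := 24. Notation vPB := 25. Notation lx := 26.
Notation lk := 27. Notation li := 28. Notation lr := 29. Notation lp := 30.
Notation ll := 31. Notation lit := 32. Notation lth := 33. Notation ly := 34.
Notation lz := 35. Notation vUP := 36. Notation vDN := 37. Notation vCAR := 38.
Notation vX := 39. Notation lc := 40. Notation aOUT := 41.

Notation "c1 ;; c2" := (CSeq c1 c2) (at level 65, right associativity).

Definition Incr (v : nat) (e : expr) : cmd := Asg v (EAdd (V v) e).

Definition nbE (ex ek : expr) : expr :=
  EA aIN (EAdd (EA aROW ex) (EA aIN (EAdd (V vSB) ek))).

Definition Measure : cmd :=
  Asg vSZ (EC 0) ;; Asg vBD (EC 0) ;;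
  CFor lx (V vN) (CIf (EA aC (V lx))
    (Incr vSZ (EC 1) ;;
     CFor lk (V vD) (CIf (EA aC (nbE (V lx) (V lk))) CSkip (Incr vBD (EC 1))))
    CSkip).

(* [vPA] and [vPB] are the cross products [vBD * vBS] and [vBB * vSZ]. *)
Definition Compare : cmd :=
  Asg vPA (EC 0) ;; Asg vPB (EC 0) ;;
  CFor lx (V vN)
    (CIf (ESub (V vBS) (V lx)) (Incr vPA (V vBD)) CSkip ;;
     CIf (ESub (V vSZ) (V lx)) (Incr vPB (V vBB)) CSkip).

Definition Save : cmd :=
  Asg vBS (V vSZ) ;; Asg vBB (V vBD) ;; Map lx aBEST (V vN) (EA aC (V lx)).

Definition Commit : cmd :=
  CIf (ESub (V vPB) (V vPA))
    (CIf (ESub (EAdd (V vN) (EC 1)) (EAdd (V vSZ) (V vSZ))) Save CSkip) CSkip.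

Definition Consider : cmd := Measure ;; Compare ;; Commit.

Lemma nth_allpairs (A B C : Type) (f : A -> B -> C) x0 a0 b0 s t i j :
  i < size s -> j < size t ->
  nth x0 [seq f x y | x <- s, y <- t] (i * size t + j) = f (nth a0 s i) (nth b0 t j).
Proof.
elim: s i => //= x s IH [|i] hi hj; rewrite nth_cat size_map.
  by rewrite mul0n add0n hj (nth_map b0).
by rewrite ifN ?mulSn -?addnA ?addKn ?IH //; lia.
Qed.

Lemma exec_seq c1 c2 s : exec (c1 ;; c2) s = exec c2 (exec c1 s).
Proof. by []. Qed.

Lemma exec_skip s : exec CSkip s = s.
Proof. by []. Qed.

Lemma exec_if e c1 c2 s :
  exec (CIf e c1 c2) s = if eval e s == 0 then exec c2 s else exec c1 s.
Proof. by []. Qed.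

Lemma exec_asg v e s : exec (Asg v e) s = upd s v 0 (eval e s).
Proof. by []. Qed.

#[local] Arguments exec : simpl never.
#[local] Arguments eval : simpl never.

Lemma evalC c s : eval (EC c) s = c. Proof. by []. Qed.
Lemma evalV v s : eval (V v) s = s v 0. Proof. by []. Qed.
Lemma evalA a e s : eval (EA a e) s = s a (eval e s). Proof. by []. Qed.
Lemma evalD e1 e2 s : eval (EAdd e1 e2) s = eval e1 s + eval e2 s. Proof. by []. Qed.
Lemma evalB e1 e2 s : eval (ESub e1 e2) s = eval e1 s - eval e2 s. Proof. by []. Qed.
Definition evalE := (evalV, evalC, evalD, evalB, evalA).

Section Search.
Variables (G : finZmodType) (elt : 'I_#|G| -> G) (lab : G -> 'I_#|G|) (S : seq G).
Hypotheses (eltK : cancel elt lab) (labK : cancel lab elt).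
Implicit Types (Q T : {set G}) (s : store) (x y : G).
Local Notation n := #|G|.
Local Notation d := (size S).
Local Notation b := (cay_boundary S).
Local Notation inp := (encode_input elt lab S).

Lemma inp_table (i j : 'I_n) : nth 0 inp (2 + i * n + j) = lab (elt i + elt j)%R.
Proof.
rewrite /encode_input -addnA /= nth_cat size_allpairs size_enum_ord.
have hl : i * n + j < n * n by have := ltn_ord i; have := ltn_ord j; nia.
rewrite hl; have := @nth_allpairs _ _ _ (fun i j => lab (elt i + elt j)%R : nat) 0 i i
  (enum 'I_n) (enum 'I_n) i j.
by rewrite !size_enum_ord !nth_ord_enum => ->.
Qed.

Lemma inp_gen k : k < d -> nth 0 inp (2 + n * n + k) = lab (nth 0%R S k).
Proof.
move=> hk; rewrite /encode_input -addnA /= nth_cat size_allpairs size_enum_ord.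
by rewrite add0n ltnNge leq_addr /= addKn (nth_map 0%R).
Qed.

Definition Env s : Prop :=
  [/\ forall i, s aIN i = nth 0 inp i, s vN 0 = n & s vD 0 = d] /\
  [/\ forall i, i < n -> s aROW i = 2 + i * n & s vSB 0 = 2 + n * n] /\
  [/\ s vLB 0 = lam_bound S, s vM 0 = height S & s vTAU 0 = (height S).+1] /\
  [/\ s vDD 0 = cell_bound d & s vP2 0 = 2 ^ cell_bound d].

Lemma Env_eq s s' : (forall a, a < 11 -> s' a = s a) -> Env s -> Env s'.
Proof. by move=> h; rewrite /Env !h. Qed.

Lemma Env_upd s a i v : 10 < a -> Env s -> Env (upd s a i v).
Proof. by move=> ha; apply: Env_eq => c hc; rewrite upd_ne //; lia. Qed.

Lemma Env_exec c s : all (leq 11) (writes c) -> Env s -> Env (exec c s).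
Proof.
move=> hc; apply: Env_eq => a ha; rewrite exec_frame //.
by apply: contraTN ha => /(allP hc); rewrite -leqNgt.
Qed.

Lemma eval_nb s ex ek x k : Env s -> eval ex s = lab x -> eval ek s = k -> k < d ->
  eval (nbE ex ek) s = lab (x + nth 0%R S k)%R.
Proof.
move=> [[h1 _ _] [[h2 h3] _]] ex1 ek1 hk; rewrite /nbE !evalE ex1 ek1 h2 // h3 !h1 inp_gen //.
by rewrite inp_table !labK.
Qed.

Definition setof s a : {set G} := [set x | s a (lab x) != 0].

Lemma eq_setof s s' a : s a =1 s' a -> setof s a = setof s' a.
Proof. by move=> h; apply/setP => x; rewrite !inE h. Qed.

Lemma count_nth (p : pred G) : count p S = \sum_(k < d) p (nth 0%R S k).
Proof. by rewrite -sum1_count [LHS]big_mkcond (big_nth 0%R) big_mkord; apply: eq_bigr => k _; case: (p _). Qed.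

Definition leaving (C : {set G}) x := count (fun g => (x + g)%R \notin C) S.

Lemma boundary_leaving C : b C = \sum_(x in C) leaving C x.
Proof. by []. Qed.

Lemma leavingP s x : Env s -> s lx 0 = lab x ->
  exec (CFor lk (V vD) (CIf (EA aC (nbE (V lx) (V lk))) CSkip (Incr vBD (EC 1)))) s vBD 0
  = s vBD 0 + leaving (setof s aC) x.
Proof.
move=> E0 hx; set C := setof s aC.
pose I k (s' : store) := s' vBD 0 = s vBD 0 + \sum_(j < k) ((x + nth 0%R S j)%R \notin C).
rewrite /leaving count_nth; have -> : d = eval (V vD) s by case: E0 => -[_ _ <-].
apply: (for_ind (P := I)) => [|k s' hk fr IH]; first by rewrite /I big_ord0 addn0.
have hk' : k < d by move: hk; rewrite evalV; case: E0 => -[_ _ ->].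
have E1 : Env (upd s' lk 0 k).
  by apply: Env_upd => //; apply: Env_eq E0 => a ha; apply: fr; rewrite !inE; lia.
rewrite exec_if evalA (@eval_nb _ _ _ x k E1) ?evalV ?upd0 //; last by rewrite upd_ne // fr.
rewrite upd_ne // fr // /I big_ord_recr /= addnA -IH inE negbK.
by case: eqP => _; rewrite ?addn0 // exec_asg !evalE upd0 upd_ne.
Qed.

Lemma MeasureP s : Env s -> let s' := exec Measure s in
  s' vSZ 0 = #|setof s aC| /\ s' vBD 0 = b (setof s aC).
Proof.
move=> E0; rewrite /Measure !exec_seq !exec_asg; set C := setof s aC.
set s1 := upd (upd s _ _ _) _ _ _.
have E1 : Env s1 by do 2 apply: Env_upd => //.
pose I i (s' : store) := s' vSZ 0 = \sum_(x : G | lab x < i) (x \in C) /\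
  s' vBD 0 = \sum_(x : G | lab x < i) (if x \in C then leaving C x else 0).
have hn : eval (V vN) s1 = n by case: E1 => -[_ <- _].
set c := CFor _ _ _.
suff: I n (exec c s1).
  rewrite /I => -[-> ->]; split.
    by rewrite -sum1_card [RHS]big_mkcond; apply: eq_big => [x|x _]; rewrite ?ltn_ord //; case: (x \in C).
  by rewrite boundary_leaving [RHS]big_mkcond; apply: eq_bigl => x; rewrite ltn_ord.
rewrite -hn; apply: (for_ind (P := I)) => [|i s' hi fr [IH1 IH2]].
  by rewrite /I !big1 // => x.
rewrite hn in hi; pose x := elt (Ordinal hi).
have xi : lab x = i :> nat by rewrite eltK.
have sI (f : G -> nat) : \sum_(y : G | lab y < i.+1) f y = \sum_(y : G | lab y < i) f y + f x.
  rewrite (bigD1 x) /= ?xi // addnC; congr (_ + _); apply: eq_bigl => y.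
  rewrite ltnS [in RHS]ltn_neqAle andbC; congr (~~ _ && _).
  by rewrite -xi val_eqE (inj_eq (can_inj labK)).
rewrite /I !sI -IH1 -IH2 exec_if !evalE upd0 !upd_ne // fr // -xi.
have -> : s1 aC = s aC by [].
case: ifP => hC; first by rewrite inE hC /= /exec !upd_ne // !addn0.
rewrite inE hC /= exec_seq exec_asg; set s2 := upd (upd s' _ _ _) _ _ _.
have E2 : Env s2.
  by do 2 apply: Env_upd => //; apply: Env_eq E1 => a ha; apply: fr; rewrite !inE; lia.
have eC : setof s2 aC = C by apply: eq_setof => k; rewrite /s2 !upd_ne // fr.
rewrite (@leavingP _ x E2) ?eC ?exec_frame //.
Qed.

Lemma CompareP s : Env s -> s vBS 0 <= n -> s vSZ 0 <= n ->
  let s' := exec Compare s in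
  s' vPA 0 = s vBD 0 * s vBS 0 /\ s' vPB 0 = s vBB 0 * s vSZ 0.
Proof.
move=> E0 h1 h2; rewrite /Compare !exec_seq !exec_asg.
set s1 := upd (upd s _ _ _) _ _ _.
have hn : eval (V vN) s1 = n by case: E0 => -[_ <- _].
pose I i (s' : store) := s' vPA 0 = s vBD 0 * minn i (s vBS 0) /\
  s' vPB 0 = s vBB 0 * minn i (s vSZ 0).
set c := CFor _ _ _.
suff: I n (exec c s1) by rewrite /I (minn_idPr h1) (minn_idPr h2).
rewrite -hn; apply: (for_ind (P := I)) => [|i s' hi fr [IH1 IH2]].
  by rewrite /I !min0n !muln0.
rewrite /I exec_seq !exec_if !evalE upd0 !upd_ne // !fr //.
set s2 := upd s' lx 0 i; set s3 := (if _ then exec CSkip s2 else _).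
have -> : s3 vSZ 0 = s vSZ 0 by rewrite /s3; case: ifP => _; rewrite exec_frame // /s2 upd_ne // fr.
have e4 : s3 lx 0 = i by rewrite /s3; case: ifP => _; rewrite exec_frame // /s2 upd0.
rewrite e4.
have e5 : s3 vPA 0 = s vBD 0 * minn i.+1 (s vBS 0).
  rewrite /s3 -[s1 vBS 0]/(s vBS 0); case: eqP => h.
    by rewrite exec_frame // /s2 upd_ne // IH1; congr (_ * _); lia.
  rewrite exec_asg upd0 !evalE /s2 !upd_ne // IH1 fr // -[s1 vBD 0]/(s vBD 0) -mulnSr.
  by congr (_ * _); lia.
have e6 : s3 vPB 0 = s vBB 0 * minn i (s vSZ 0).
  by rewrite /s3; case: eqP => h; rewrite exec_frame // /s2 upd_ne // IH2.
have e7 : s3 vBB 0 = s vBB 0 by rewrite /s3; case: ifP => _; rewrite exec_frame // /s2 upd_ne // fr.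
case: eqP => h; first by rewrite exec_skip e5 e6; split=> //; congr (_ * _); lia.
rewrite exec_frame // e5; split=> //.
by rewrite exec_asg upd0 !evalE e6 e7 -mulnSr; congr (_ * _); lia.
Qed.

Definition BestOK s : Prop :=
  [/\ 0 < s vBS 0, s vBS 0 = #|setof s aBEST|, 2 * s vBS 0 <= n
    & b (setof s aBEST) <= s vBB 0].

Definition better s' s := s' vBB 0 * s vBS 0 <= s vBB 0 * s' vBS 0.
Definition beats s T := s vBB 0 * #|T| <= b T * s vBS 0.

Lemma better_refl s : better s s.
Proof. exact: leqnn. Qed.

Lemma better_trans s2 s1 s3 : 0 < s2 vBS 0 -> better s3 s2 -> better s2 s1 -> better s3 s1.
Proof.
rewrite /better => h2 h3 h1; rewrite -(leq_pmul2r h2).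
apply: (@leq_trans (s2 vBB 0 * s3 vBS 0 * s1 vBS 0)); first by rewrite mulnAC leq_mul2r h3 orbT.
by rewrite mulnAC [X in _ <= X]mulnAC leq_mul2r h1 orbT.
Qed.

Lemma beats_better s s' T : 0 < s vBS 0 -> better s' s -> beats s T -> beats s' T.
Proof.
rewrite /better /beats => h2 h3 h1; rewrite -(leq_pmul2r h2).
apply: (@leq_trans (s vBB 0 * s' vBS 0 * #|T|)); first by rewrite mulnAC leq_mul2r h3 orbT.
by rewrite mulnAC [X in _ <= X]mulnAC leq_mul2r h1 orbT.
Qed.

Definition Inv s := Env s /\ BestOK s.

Lemma BestOK_eq s s' : s' aBEST =1 s aBEST -> s' vBS 0 = s vBS 0 -> s' vBB 0 = s vBB 0 ->
  BestOK s -> BestOK s'.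
Proof. by move=> h1 h2 h3; rewrite /BestOK h2 h3 (eq_setof h1). Qed.

Lemma ConsiderP s : Inv s -> let s' := exec Consider s in
  [/\ Inv s', better s' s & adm (setof s aC) -> beats s' (setof s aC)].
Proof.
case=> E0 [q1 q2 q3 q4] s'; set C := setof s aC.
have EnvS : Env s' by apply: Env_exec E0.
rewrite /s' -[exec Consider s]/(exec Commit (exec Compare (exec Measure s))).
have [m1 m2] := MeasureP E0; set s1 := exec Measure s in m1 m2 *.
have E1 : Env s1 by apply: Env_exec E0.
have f1 a : a \in [:: aC; aBEST; vBS; vBB] -> s1 a = s a.
  by move=> ha; apply: exec_frame; move: a ha; apply/allP.
have [|| c1 c2] := CompareP E1.
- by rewrite f1 //; lia.
- by rewrite m1 max_card.
set s2 := exec Compare s1 in c1 c2 *.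
have f2 a : a \in [:: aC; aBEST; vBS; vBB] -> s2 a = s a.
  move=> ha; rewrite -(f1 a ha); apply: exec_frame; move: a ha; exact/allP.
have g2 a : a \in [:: vN; vSZ; vBD] -> s2 a = s1 a.
  by move=> ha; apply: exec_frame; move: a ha; apply/allP.
have same : Inv s2 /\ better s2 s.
  split; last by rewrite /better !f2.
  by split; [exact: Env_exec E1 | apply: (@BestOK_eq s); rewrite ?f2].
rewrite m2 f1 // in c1; rewrite f1 // m1 in c2; rewrite -/C in m1 m2 c1 c2.
rewrite exec_if !evalE c1 c2 exec_skip; case: eqP => h.
  by case: same => i1 i2; split=> // _; rewrite /beats !f2 // -subn_eq0 h.
rewrite exec_if exec_skip !evalE !g2 // m1; case: eqP => h'.
  case: same => i1 i2; split=> // /andP[_ hC].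
  by move: h' hC; case: E1 => -[_ -> _] _; lia.
have hC : 2 * #|C| <= n by move: h'; case: E1 => -[_ -> _] _; lia.
rewrite /Save !exec_seq !exec_asg.
set s3 := upd (upd s2 _ _ _) _ _ _.
have e1 : s3 vBS 0 = #|C| by rewrite /s3 upd_ne // upd0 !evalE g2.
have e2 : s3 vBB 0 = b C by rewrite /s3 upd0 !evalE upd_ne // g2.
set s4 := exec _ s3.
have e3 : s4 vBS 0 = #|C| by rewrite /s4 exec_frame.
have e4 : s4 vBB 0 = b C by rewrite /s4 exec_frame.
have E3 : Env s3 by do 2 apply: Env_upd => //; apply: Env_exec E1.
have e5 : setof s4 aBEST = C.
  apply/setP => x; rewrite !inE /s4 exec_map // evalV.
  have -> : s3 vN 0 = n by case: E3 => -[].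
  by rewrite ltn_ord !evalE upd0 upd_ne // /s3 !upd_ne // f2.
have C0 : 0 < #|C| by move: h; case: #|C| => //; rewrite muln0.
split; last by rewrite /beats e3 e4.
  by split; [apply: Env_exec E3 | rewrite /BestOK e3 e4 e5].
by rewrite /better e3 e4; lia.
Qed.

End Search.

(** * Building a net *)

Definition Mark : cmd := CFor lk (V vD) (CWr aNEW (nbE (V ly) (V lk)) (EC 1)).

Definition Grow : cmd :=
  Map ly aNEW (V vN) (EA aC (V ly)) ;;
  CFor ly (V vN) (CIf (EA aC (V ly)) Mark CSkip) ;;
  Map ly aC (V vN) (EA aNEW (V ly)).

Definition Ball : cmd :=
  Map ly aC (V vN) (EC 0) ;; CWr aC (V lc) (EC 1) ;;
  CFor li (V vN) (CIf (ESub (V lr) (V li)) Grow CSkip).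

Definition Assign : cmd :=
  CFor ly (V vN) (CIf (EA aC (V ly))
    (CIf (EA aASG (V ly)) CSkip (CWr aASG (V ly) (V vK))) CSkip).

Definition NewCell : cmd := Ball ;; Consider ;; Incr vK (EC 1) ;; Assign.

Definition Net : cmd :=
  Map ly aASG (V vN) (EC 0) ;; Asg vK (EC 0) ;;
  CFor lc (V vN) (CIf (EA aASG (V lc)) CSkip NewCell).

Lemma exec_wr a e1 e2 s : exec (CWr a e1 e2) s = upd s a (eval e1 s) (eval e2 s).
Proof. by []. Qed.

Section Search.
Variables (G : finZmodType) (elt : 'I_#|G| -> G) (lab : G -> 'I_#|G|) (S : seq G).
Hypotheses (eltK : cancel elt lab) (labK : cancel lab elt).
Implicit Types (Q T : {set G}) (s : store) (x y : G).
Local Notation n := #|G|.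
Local Notation d := (size S).
Local Notation b := (cay_boundary S).
Local Notation Env := (Env elt lab S).
Local Notation Inv := (Inv elt lab S).
Local Notation setof := (setof lab).
Local Notation beats := (beats S).
Local Notation ball := (ball S).

Lemma Env_n s : Env s -> s vN 0 = n. Proof. by case=> -[]. Qed.
Lemma Env_d s : Env s -> s vD 0 = d. Proof. by case=> -[]. Qed.

Lemma Env_loop s s' v k w : Env s -> (forall a, a \notin w -> s' a = s a) ->
  all (leq 11) (v :: w) -> Env (upd s' v 0 k).
Proof.
move=> E fr /= /andP[hv hw]; apply: Env_upd => //; apply: Env_eq E => a ha; apply: fr.
by apply: contraTN ha => /(allP hw); rewrite -leqNgt.
Qed.

Lemma setof_upd s a x v : v != 0 -> setof (upd s a (lab x) v) a = x |: setof s a.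
Proof.
move=> hv; apply/setP => y; rewrite !inE upd_same.
case: (altP (y =P x)) => [->|ne] /=; first by rewrite eqxx hv.
by rewrite ifN // -[_ == _]/(lab y == lab x) (inj_eq (can_inj labK)).
Qed.

Lemma MarkP s x : Env s -> s ly 0 = lab x ->
  setof (exec Mark s) aNEW = setof s aNEW :|: [set y | (y - x)%R \in S].
Proof.
move=> E0 hx.
pose I k (s' : store) := setof s' aNEW = setof s aNEW :|: [set y | (y - x)%R \in take k S].
have -> : [set y | (y - x)%R \in S] = [set y | (y - x)%R \in take d S] by rewrite take_size.
rewrite -(Env_d E0); apply: (for_ind (P := I)) => [|k s' hk fr IH].
  by rewrite /I take0; apply/setP => y; rewrite !inE orbF.
rewrite evalV (Env_d E0) in hk.
have E1 : Env (upd s' lk 0 k) by apply: Env_loop E0 fr _.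
rewrite exec_wr (@eval_nb _ _ _ _ labK _ _ _ x k E1) ?evalV ?upd0 //; last first.
  by rewrite upd_ne // fr.
rewrite /I setof_upd //; rewrite /I in IH.
have -> : setof (upd s' lk 0 k) aNEW = setof s' aNEW by apply: eq_setof.
rewrite IH (take_nth 0%R) //; apply/setP => y; rewrite !inE mem_rcons inE.
rewrite [(y - x == _)%R]subr_eq [(_ + x)%R]addrC.
by case: (y == _); rewrite /= ?orbT.
Qed.

Lemma GrowP s : Env s -> setof (exec Grow s) aC =
  [set y | (y \in setof s aC) || has (fun g => (y - g)%R \in setof s aC) S].
Proof.
move=> E0; set C := setof s aC.
rewrite /Grow -[exec _ s]/(exec (Map ly aC (V vN) (EA aNEW (V ly)))
  (exec (CFor ly (V vN) (CIf (EA aC (V ly)) Mark CSkip))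
  (exec (Map ly aNEW (V vN) (EA aC (V ly))) s))).
set s1 := exec (Map ly aNEW _ _) s.
have E1 : Env s1 by apply: Env_exec E0.
have N1 : setof s1 aNEW = C.
  apply/setP => y; rewrite !inE /s1 exec_map // evalV (Env_n E0) ltn_ord.
  by rewrite !evalE upd0.
have C1 : setof s1 aC = C by rewrite /s1; apply: eq_setof; rewrite exec_frame.
set s2 := exec _ s1.
have E2 : Env s2 by apply: Env_exec E1.
have -> : setof (exec (Map ly aC (V vN) (EA aNEW (V ly))) s2) aC = setof s2 aNEW.
  apply/setP => y; rewrite !inE exec_map // evalV (Env_n E2) ltn_ord.
  by rewrite !evalE upd0.
pose I i (s' : store) := setof s' aNEW =
  C :|: [set y | [exists x in C, (lab x < i) && ((y - x)%R \in S)]].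
have : I n s2.
  rewrite -(Env_n E1); apply: (for_ind (P := I)) => [|i s' hi fr IH].
    rewrite /I N1; apply/setP => y; rewrite !inE.
    suff -> : [exists x in C, (lab x < 0) && ((y - x)%R \in S)] = false by rewrite orbF.
    by apply/existsP => -[x /and3P[]].
  rewrite evalV (Env_n E1) in hi.
  have E' : Env (upd s' ly 0 i) by apply: Env_loop E1 fr _.
  pose x := elt (Ordinal hi); have xi : lab x = i :> nat by rewrite eltK.
  have step y : [exists z in C, (lab z < i.+1) && ((y - z)%R \in S)] =
     [exists z in C, (lab z < i) && ((y - z)%R \in S)] || ((x \in C) && ((y - x)%R \in S)).
    apply/existsP/orP => [[z /and3P[zC zi zS]]|[/existsP[z /and3P[zC zi zS]]|/andP[xC xS]]].
    - move: zi; rewrite ltnS leq_eqVlt => /orP[/eqP zi|zi]; last first.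
        by left; apply/existsP; exists z; rewrite zC zi.
      right; suff <- : z = x by rewrite zC.
      by apply: (can_inj labK); apply: val_inj; rewrite /= xi.
    - by exists z; rewrite zC zS ltnW.
    - by exists x; rewrite xC xS xi ltnSn.
  have hC : (upd s' ly 0 i aC i == 0) = (x \notin C).
    by rewrite upd_ne // fr // -C1 inE negbK xi.
  rewrite /I exec_if !evalE upd0 hC; case: ifP => [xC|/negbFE xC].
    rewrite exec_skip; have -> : setof (upd s' ly 0 i) aNEW = setof s' aNEW by apply: eq_setof.
    by rewrite IH; apply/setP => y; rewrite !inE step -[x \in C]negbK xC /= orbF.
  rewrite (@MarkP _ x E') ?upd0 ?xi //.
  have -> : setof (upd s' ly 0 i) aNEW = setof s' aNEW by apply: eq_setof.
  rewrite IH; apply/setP => y; rewrite [in RHS]inE [X in _ || X]inE step xC /=.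
  by rewrite !inE orbA.
rewrite /I => ->; apply/setP => y; rewrite [in LHS]inE [in RHS]inE [X in _ || X]inE; congr (_ || _).
apply/existsP/hasP => [[x /and3P[xC _ xS]]|[g gS gC]].
  by exists (y - x)%R => //; rewrite subKr.
by exists (y - g)%R; rewrite gC ltn_ord subKr.
Qed.

Lemma BallP s x r : Env s -> s lc 0 = lab x -> s lr 0 = r -> r <= n ->
  setof (exec Ball s) aC = ball r x.
Proof.
move=> E0 hx hr rn.
rewrite /Ball -[exec _ s]/(exec (CFor li (V vN) (CIf (ESub (V lr) (V li)) Grow CSkip))
  (exec (CWr aC (V lc) (EC 1)) (exec (Map ly aC (V vN) (EC 0)) s))).
set s1 := exec (Map _ _ _ _) s.
have E1 : Env s1 by apply: Env_exec E0.
set s2 := exec (CWr _ _ _) s1.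
have E2 : Env s2 by apply: Env_exec E1.
pose I i (s' : store) := setof s' aC = ball (minn i r) x.
suff : I n (exec (CFor li (V vN) (CIf (ESub (V lr) (V li)) Grow CSkip)) s2).
  by rewrite /I (minn_idPr rn).
rewrite -(Env_n E2); apply: (for_ind (P := I)) => [|i s' hi fr IH].
  rewrite /I min0n /= /s2 exec_wr evalV.
  have -> : s1 lc 0 = lab x by rewrite /s1 exec_frame.
  rewrite setof_upd //; apply/setP => y; rewrite !inE /s1 exec_map // evalV (Env_n E0).
  by rewrite ltn_ord evalC orbF.
have E' : Env (upd s' li 0 i) by apply: Env_loop E2 fr _.
have eC : setof (upd s' li 0 i) aC = setof s' aC by apply: eq_setof.
have er : upd s' li 0 i lr 0 = r.
  by rewrite upd_ne // fr // /s2 exec_wr upd_ne // /s1 exec_frame.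
rewrite /I exec_if !evalE upd0 er; case: eqP => h.
  by rewrite exec_skip eC IH; congr (ball _ _); lia.
have -> : minn i.+1 r = (minn i r).+1 by lia.
by rewrite GrowP // eC IH.
Qed.

Lemma AssignP s x : Env s -> exec Assign s aASG (lab x) =
  if (x \in setof s aC) && (s aASG (lab x) == 0) then s vK 0 else s aASG (lab x).
Proof.
move=> E0.
pose I i (s' : store) := forall j, s' aASG j =
  if [&& j < i, s aC j != 0 & s aASG j == 0] then s vK 0 else s aASG j.
suff h : I n (exec Assign s) by rewrite h ltn_ord inE.
rewrite -(Env_n E0); apply: (for_ind (P := I)) => [//|i s' hi fr IH j].
have IHi := IH i; rewrite ltnn /= in IHi.
rewrite !exec_if !evalE !upd0 !upd_ne // fr // IHi.
case: (altP (s aC i =P 0)) => hC.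
  rewrite exec_skip upd_ne // IH ltnS; case: (ltngtP j i) => //= ->.
  by rewrite hC.
case: (altP (s aASG i =P 0)) => hA; last first.
  rewrite exec_skip upd_ne // IH ltnS; case: (ltngtP j i) => //= ->.
  by rewrite (negbTE hA) andbF.
rewrite exec_wr !evalE upd_same upd0 !upd_ne // fr // IH ltnS.
by case: (ltngtP j i) => //= ->; rewrite hC hA.
Qed.

Definition kept : seq nat := iota 0 11 ++ [:: aBEST; vBS; vBB].
Definition quiet (c : cmd) : bool := all (fun a => a \notin kept) (writes c).
Definition agree s s' : Prop := forall a, a \in kept -> s' a = s a.

Lemma agree_exec c s : quiet c -> agree s (exec c s).
Proof. by move=> hc a ha; apply: exec_frame; apply: contraTN ha => /(allP hc). Qed.

Lemma agree_upd s a i v : a \notin kept -> agree s (upd s a i v).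
Proof. by move=> hc c ha; rewrite upd_ne //; apply: contraNneq hc => <-. Qed.

Lemma agree_trans s1 s2 s3 : agree s1 s2 -> agree s2 s3 -> agree s1 s3.
Proof. by move=> h1 h2 a ha; rewrite h2 ?h1. Qed.

Lemma agree_Inv s s' : agree s s' -> Inv s -> Inv s'.
Proof.
move=> h [E B]; split; last by apply: BestOK_eq B; rewrite h.
by apply: Env_eq E => a ha; apply: h; rewrite mem_cat mem_iota ha.
Qed.

Lemma agree_better s s' s0 : agree s s' -> better s s0 -> better s' s0.
Proof. by move=> h; rewrite /better !h. Qed.

Definition hits s T : Prop := adm T -> beats s T.

Lemma hits_better s s' T : Inv s -> better s' s -> hits s T -> hits s' T.
Proof. by case=> _ [h _ _ _] hb hT /hT; exact: beats_better. Qed.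

Lemma hits_agree s s' T : agree s s' -> hits s T -> hits s' T.
Proof. by move=> h hT /hT; rewrite /beats !h. Qed.

Lemma Inv_Env s : Inv s -> Env s. Proof. by case. Qed.

Lemma better_Inv_trans s1 s2 s3 : Inv s2 -> better s3 s2 -> better s2 s1 -> better s3 s1.
Proof. by case=> _ [h _ _ _]; exact: better_trans. Qed.

Lemma setof_ext s s' a : s' a = s a -> setof s' a = setof s a.
Proof. by move=> h; apply: eq_setof => i; rewrite h. Qed.

Lemma NewCellP s x r : Inv s -> s lc 0 = lab x -> s lr 0 = r -> r <= n ->
  let s' := exec NewCell s in
  [/\ Inv s', better s' s, hits s' (ball r x), s' vK 0 = (s vK 0).+1 &
    forall y, s' aASG (lab y) = if (y \in ball r x) && (s aASG (lab y) == 0)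
              then (s vK 0).+1 else s aASG (lab y)].
Proof.
move=> I0 hx hr rn /=.
rewrite -[exec NewCell s]/(exec Assign (exec (Incr vK (EC 1)) (exec Consider (exec Ball s)))).
set s1 := exec Ball s; have a1 : agree s s1 by apply: agree_exec.
have I1 := agree_Inv a1 I0.
have C1 : setof s1 aC = ball r x by apply: BallP => //; exact: Inv_Env.
have [I2 b2 h2] := ConsiderP eltK labK I1.
set s2 := exec Consider s1 in I2 b2 h2 *; rewrite C1 in h2.
have C2 : setof s2 aC = ball r x by rewrite -C1; apply: setof_ext; exact: exec_frame.
set s3 := exec (Incr _ _) s2; have a3 : agree s2 s3 by apply: agree_exec.
have I3 := agree_Inv a3 I2.
set s4 := exec Assign s3; have a4 : agree s3 s4 by apply: agree_exec.
have a24 := agree_trans a3 a4.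
have k3 : s3 vK 0 = (s vK 0).+1.
  by rewrite /s3 exec_asg upd0 !evalE addn1 /s2 /s1 !exec_frame.
split=> //.
- exact: agree_Inv a4 I3.
- apply: agree_better a24 _; apply: better_Inv_trans I1 b2 _.
  by apply: agree_better a1 _; exact: better_refl.
- exact: hits_agree a24 _.
- by rewrite /s4 exec_frame.
- move=> y; rewrite /s4 AssignP; last exact: Inv_Env.
  have -> : setof s3 aC = ball r x by rewrite -C2; apply: setof_ext; exact: exec_frame.
  by rewrite k3 /s3 exec_frame // /s2 exec_frame // /s1 exec_frame.
Qed.

Lemma NetP s r : Inv s -> s lr 0 = r -> r <= n ->
  let s' := exec Net s in
  [/\ Inv s', better s' s & exists cs asg, [/\ is_net S r cs asg, size cs <= n,
    forall x, s' aASG (lab x) = (asg x).+1 & forall c, c \in cs -> hits s' (ball r c)]].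
Proof.
move=> I0 hr rn; rewrite /=.
rewrite -[exec Net s]/(exec (CFor lc (V vN) (CIf (EA aASG (V lc)) CSkip NewCell))
  (exec (Asg vK (EC 0)) (exec (Map ly aASG (V vN) (EC 0)) s))).
set s1 := exec (Map _ _ _ _) s; set s2 := exec (Asg _ _) s1.
have a1 : agree s s1 by apply: agree_exec.
have a2 : agree s s2 by apply: agree_trans a1 _; apply: agree_exec.
have I2 := agree_Inv a2 I0.
have A2 x : s2 aASG (lab x) = 0.
  by rewrite /s2 exec_frame // /s1 exec_map // evalV (Env_n (Inv_Env I0)) ltn_ord.
pose J i (s' : store) := [/\ Inv s', better s' s & exists cs : seq G,
  [/\ s' vK 0 = size cs, size cs <= i & pairwise (fun x y => y \notin ball r x) cs] /\
  [/\ forall x, lab x < i -> s' aASG (lab x) != 0,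
     forall x, s' aASG (lab x) != 0 ->
       s' aASG (lab x) <= size cs /\ x \in ball r (nth 0%R cs (s' aASG (lab x)).-1),
     forall c y, c \in cs -> y \in ball r c -> s' aASG (lab y) != 0 &
     forall c, c \in cs -> hits s' (ball r c)]].
set c := CFor _ _ _.
have : J n (exec c s2).
  rewrite -(Env_n (Inv_Env I2)); apply: (for_ind (P := J)) => [|i s' hi fr].
    split=> //; first by apply: agree_better a2 _; exact: better_refl.
    exists [::]; split; first by split=> //; rewrite /s2 exec_asg upd0.
    by split=> // x; rewrite A2.
  case=> I' b' [cs [[k1 k2 k3] [m1 m2 m3 m4]]].
  rewrite evalV (Env_n (Inv_Env I2)) in hi.
  pose x := elt (Ordinal hi); have xi : lab x = i :> nat by rewrite eltK.
  set u := upd s' lc 0 i.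
  have au : agree s' u by apply: agree_upd.
  have Iu := agree_Inv au I'.
  have bu : better u s by exact: agree_better au b'.
  have eA : u aASG = s' aASG by [].
  have eL : u lc 0 = i by rewrite /u upd0.
  have hA : (s' aASG i == 0) = (s' aASG (lab x) == 0) by rewrite xi.
  rewrite exec_if !evalE eL eA hA; case: eqP => hx; last first.
    rewrite exec_skip; split=> //; exists cs; split; first by split=> //; exact: leqW.
    split=> // y; rewrite ltnS leq_eqVlt => /orP[/eqP yi|]; last exact: m1.
    by rewrite eA (_ : (lab y : nat) = lab x) ?yi //; apply/eqP.
  have [] := @NewCellP u x r Iu.
  - by rewrite /u upd0 xi.
  - by rewrite /u upd_ne // fr // /s2 /s1 !exec_frame.
  - by [].
  move=> I3 b3 h3 k4 A3; set w := exec NewCell u in I3 b3 h3 k4 A3 *.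
  have ek : u vK 0 = size cs by rewrite /u upd_ne.
  rewrite ek in k4 A3.
  split=> //; first exact: better_Inv_trans Iu b3 bu.
  exists (rcons cs x); split.
    rewrite size_rcons; split=> //; rewrite pairwise_rcons k3 andbT.
    by apply/allP => c0 hc0; apply/negP => /(m3 _ _ hc0); rewrite hx.
  have mono y : s' aASG (lab y) != 0 -> w aASG (lab y) = s' aASG (lab y).
    by move=> hy; rewrite A3 eA (negbTE hy) andbF.
  split.
  - move=> y; rewrite ltnS leq_eqVlt => /orP[/eqP yi|yi]; last by rewrite mono ?m1.
    have -> : y = x by apply: (can_inj labK); apply: val_inj; rewrite /= yi xi.
    by rewrite A3 ball_self eA hx.
  - move=> y; rewrite A3 eA; case: ifP => [/andP[hy _] _|hy1 hy].
      by rewrite size_rcons /= nth_rcons ltnn eqxx.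
    have [q1 q2] := m2 y hy; rewrite size_rcons leqW // nth_rcons ifT //.
    by move: hy q1; case: (s' aASG _).
  - move=> c0 y; rewrite mem_rcons inE => /orP[/eqP->|hc0] hy.
      by rewrite A3 hy eA; case: (altP (s' aASG (lab y) =P 0)).
    by rewrite mono; exact: m3 hc0 hy.
  - move=> c0; rewrite mem_rcons inE => /orP[/eqP->//|/m4].
    by move/(hits_agree au); exact: hits_better b3.
case=> I' b' [cs [[k1 k2 k3] [m1 m2 m3 m4]]]; split=> //.
exists cs, (fun x => (exec c s2 aASG (lab x)).-1); split=> //.
  split=> // x; have hx := m1 x (ltn_ord _); have [q1 q2] := m2 x hx; split=> //.
  by move: hx q1; case: (exec _ _ _ _).
by move=> x; rewrite prednK // lt0n m1.
Qed.

End Search.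

(** * Descents from all patterns *)

Definition Slopes : cmd :=
  CFor lk (V vD)
    (CIf (ESub (EA aH (nbE (V lx) (V lk))) (EA aH (V lx))) (Incr vUP (V vN)) CSkip ;;
     CIf (ESub (EA aH (V lx)) (EA aH (nbE (V lx) (V lk)))) (Incr vDN (V vN)) CSkip).

Definition Moved : expr := ESub (EAdd (EA aH (V lx)) (V vUP)) (V vDN).

Definition Move : cmd :=
  Asg vUP (EC 0) ;; Asg vDN (EC 0) ;;
  CIf (EA aP (V lx)) (Asg vUP (V ll)) (Asg vDN (V ll)) ;;
  Slopes ;; CWr aH2 (V lx) (ESub Moved (ESub Moved (V vM))).

Definition Step : cmd :=
  CFor lx (V vN) Move ;; Map ly aH (V vN) (EA aH2 (V ly)).

Definition Levels : cmd :=
  CFor lth (V vM)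
    (Map ly aC (V vN) (ESub (EA aH (V ly)) (V lth)) ;; Consider ;;
     Map ly aC (V vN) (ESub (EC 1) (ESub (EA aH (V ly)) (V lth))) ;; Consider).

Definition Descent : cmd :=
  Map ly aH (V vN) (EC 0) ;; CFor lit (V vTAU) (Levels ;; Step).

Definition Descents : cmd := CFor ll (V vLB) Descent.

Definition Count : cmd :=
  Asg vCAR (EC 1) ;;
  CFor ly (V vDD) (CIf (V vCAR)
    (CIf (EA aSEL (V ly)) (CWr aSEL (V ly) (EC 0))
       (CWr aSEL (V ly) (EC 1) ;; Asg vCAR (EC 0))) CSkip).

Definition Seed : cmd :=
  Map ly aP (V vN) (EA aSEL (ESub (EA aASG (V ly)) (EC 1))).

Definition Patterns : cmd :=
  Map ly aSEL (EAdd (V vDD) (V vN)) (EC 0) ;;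
  CFor lp (V vP2) (Seed ;; Descents ;; Count).

Definition Main : cmd := CFor lr (EAdd (V vN) (EC 1)) (Net ;; Patterns).

Definition bin (D : nat) (f : nat -> nat) := \sum_(k < D) f k * 2 ^ k.

Lemma bin_lt D f : (forall k, k < D -> f k <= 1) -> bin D f < 2 ^ D.
Proof.
rewrite /bin; elim: D => [|D IH] h; first by rewrite big_ord0.
rewrite big_ord_recr /= expnS; have := IH (fun k hk => h k (leqW hk)).
have := h D (ltnSn D); move: (\sum_(k < D) _) (2 ^ D) => u v.
by case: (f D) => [|[|]] // _; lia.
Qed.

Lemma bin_inj D f g : (forall k, k < D -> f k <= 1) -> (forall k, k < D -> g k <= 1) ->
  bin D f = bin D g -> forall k, k < D -> f k = g k.
Proof.
elim: D => // D IH hf hg.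
have hf' k : k < D -> f k <= 1 by move=> hk; apply: hf; exact: leqW.
have hg' k : k < D -> g k <= 1 by move=> hk; apply: hg; exact: leqW.
have := bin_lt hf'; have := bin_lt hg'; rewrite {3 4}/bin !big_ord_recr /= -/(bin D f) -/(bin D g).
move=> h1 h2 e; have eD : f D = g D.
  move: (hf D (ltnSn D)) (hg D (ltnSn D)) e.
    move: (bin D f) (bin D g) (2 ^ D) h1 h2 => u v w h1 h2.
    by case: (f D) => [|[|]] //; case: (g D) => [|[|]] //; lia.
move=> k; rewrite ltnS leq_eqVlt => /orP[/eqP->//|]; apply: IH => //.
by move: e; rewrite eD => /addIn.
Qed.

Section Search.
Variables (G : finZmodType) (elt : 'I_#|G| -> G) (lab : G -> 'I_#|G|) (S : seq G).
Hypotheses (eltK : cancel elt lab) (labK : cancel lab elt).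
Implicit Types (Q T : {set G}) (s : store) (x y : G).
Local Notation n := #|G|.
Local Notation d := (size S).
Local Notation b := (cay_boundary S).
Local Notation Env := (Env elt lab S).
Local Notation Inv := (Inv elt lab S).
Local Notation setof := (setof lab).
Local Notation hits := (hits S).
Local Notation ball := (ball S).

Lemma SlopesP s x h : Env s -> s lx 0 = lab x -> (forall y, s aH (lab y) = h y) ->
  let s' := exec Slopes s in
  s' vUP 0 = s vUP 0 + n * up S h x /\ s' vDN 0 = s vDN 0 + n * dn S h x.
Proof.
move=> E0 hx hh.
pose z k := (x + nth 0%R S k)%R.
pose I k (s' : store) := s' vUP 0 = s vUP 0 + n * \sum_(j < k) (h x < h (z j)) /\
  s' vDN 0 = s vDN 0 + n * \sum_(j < k) (h (z j) < h x).
rewrite /= /up /dn !count_nth -(Env_d E0).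
apply: (for_ind (P := I)) => [|k s' hk fr [IH1 IH2]].
  by rewrite /I !big_ord0 !muln0 !addn0.
rewrite evalV (Env_d E0) in hk.
set u := upd s' lk 0 k.
have E1 : Env u by apply: Env_loop E0 fr _.
have ex : eval (V lx) u = lab x by rewrite evalV /u upd_ne // fr.
have ek : eval (V lk) u = k by rewrite evalV /u upd0.
have eH y : u aH (lab y) = h y by rewrite /u upd_ne // fr.
rewrite /I exec_seq.
set v := exec (CIf _ _ _) u.
have E2 : Env v by apply: Env_exec E1.
have evx : eval (V lx) v = lab x by rewrite -ex !evalV /v exec_frame.
have evk : eval (V lk) v = k by rewrite -ek !evalV /v exec_frame.
have evH y : v aH (lab y) = h y by rewrite -eH /v exec_frame.
have c1 : v vUP 0 = s vUP 0 + n * \sum_(j < k.+1) (h x < h (z j)).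
  rewrite big_ord_recr /= mulnDr addnA -IH1 /v exec_if evalB !(@evalA aH) ex.
  rewrite (@eval_nb _ _ _ _ labK _ _ _ x k E1) // !eH subn_eq0 leqNgt.
  case: (h x < _) => /=; last by rewrite muln0 addn0.
  by rewrite exec_asg upd0 !evalE (Env_n E1) muln1 /u upd_ne.
have c2 : v vDN 0 = s vDN 0 + n * \sum_(j < k) (h (z j) < h x).
  by rewrite -IH2 /v exec_frame.
split; first by rewrite -c1 exec_frame.
rewrite big_ord_recr /= mulnDr addnA -c2 exec_if evalB !(@evalA aH) evx.
rewrite (@eval_nb _ _ _ _ labK _ _ _ x k E2) // !evH subn_eq0 leqNgt.
case: (_ < h x) => /=; last by rewrite muln0 addn0.
by rewrite exec_asg upd0 !evalE (Env_n E2) muln1.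
Qed.

Lemma StepP s lam h : Env s -> s ll 0 = lam -> (forall y, s aH (lab y) = h y) ->
  forall y, exec Step s aH (lab y) = descend S (height S) lam (setof s aP) h y.
Proof.
move=> E0 hl hh y.
rewrite -[exec Step s]/(exec (Map ly aH (V vN) (EA aH2 (V ly))) (exec (CFor lx (V vN) Move) s)).
set s1 := exec (CFor _ _ _) s.
have E1 : Env s1 by apply: Env_exec E0.
rewrite exec_map // evalV (Env_n E1) ltn_ord !evalE upd0 upd_ne //.
pose I i (s' : store) := forall y, lab y < i ->
  s' aH2 (lab y) = descend S (height S) lam (setof s aP) h y.
suff : I n s1 by apply; exact: ltn_ord.
rewrite -(Env_n E0); apply: (@for_ind I lx (V vN) Move s) => [//|i s' hi fr IH].
rewrite evalV (Env_n E0) in hi.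
pose x := elt (Ordinal hi); have xi : lab x = i :> nat by rewrite eltK.
set u := upd s' lx 0 i.
have E2 : Env u by apply: Env_loop E0 fr _.
rewrite -[exec Move u]/(exec (CWr aH2 (V lx) (ESub Moved (ESub Moved (V vM))))
  (exec Slopes (exec (CIf (EA aP (V lx)) (Asg vUP (V ll)) (Asg vDN (V ll)))
  (exec (Asg vDN (EC 0)) (exec (Asg vUP (EC 0)) u))))).
set u1 := exec (Asg vDN _) _.
have E3 : Env u1 by rewrite /u1 !exec_asg; do 2 apply: Env_upd => //.
set u2 := exec (CIf _ _ _) u1.
have E4 : Env u2 by apply: Env_exec E3.
have xu2 : u2 lx 0 = lab x by rewrite /u2 exec_frame // /u1 !exec_frame // /u upd0 xi.
have hu2 z : u2 aH (lab z) = h z.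
  by rewrite /u2 exec_frame // /u1 !exec_frame // /u upd_ne // fr.
have [p1 p2] := SlopesP E4 xu2 hu2.
have P1 : u1 aP (lab x) = s aP (lab x) by rewrite /u1 !exec_frame // /u upd_ne // fr.
have L1 : u1 ll 0 = lam by rewrite /u1 !exec_frame // /u upd_ne // fr.
have X1 : u1 lx 0 = lab x by rewrite /u1 !exec_frame // /u upd0 xi.
have [q1 q2] : u2 vUP 0 = lam * (x \in setof s aP) /\ u2 vDN 0 = lam * (x \notin setof s aP).
  rewrite /u2 exec_if !evalE X1 P1 inE.
  case: eqP => _ /=; rewrite exec_asg upd0 upd_ne // !evalE L1 muln1 muln0; split=> //.
set u3 := exec Slopes u2 in p1 p2 *.
have E5 : Env u3 by apply: Env_exec E4.
have X3 : u3 lx 0 = lab x by rewrite /u3 exec_frame.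
have H3 : u3 aH (lab x) = h x by rewrite /u3 exec_frame.
have M3 : u3 vM 0 = height S by case: E5 => _ [_ [[]]].
move=> z; rewrite exec_wr /Moved !evalE X3 H3 M3 p1 p2 q1 q2 upd_same ltnS leq_eqVlt.
case: (altP (lab z =P lab x)) => [e _|ne].
  have -> : z = x by exact: (can_inj labK).
  rewrite eqxx /descend ![n * _ + _]addnC.
  by rewrite /minn; case: ltnP => hc; lia.
rewrite -xi -![nat_of_ord _ == nat_of_ord _]/(_ == _ :> 'I_n) (negbTE ne) /= => hz.
rewrite /u3 exec_frame // /u2 exec_frame // /u1 !exec_frame // /u upd_ne //.
by apply: IH; rewrite -xi.
Qed.

Lemma LevelsP s h : Inv s -> (forall y, s aH (lab y) = h y) ->
  let s' := exec Levels s in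
  [/\ Inv s', better s' s & forall th, th < height S ->
     hits s' (level h th) /\ hits s' (~: level h th)].
Proof.
move=> I0 hh; rewrite /=.
pose J i (s' : store) := [/\ Inv s', better s' s & forall th, th < i ->
     hits s' (level h th) /\ hits s' (~: level h th)].
have hM : s vM 0 = height S by case: (Inv_Env I0) => _ [_ [[]]].
suff : J (height S) (exec Levels s) by [].
rewrite -hM; apply: (for_ind (P := J)) => [|i s' hi fr [I' b' h']].
  by split=> //; exact: better_refl.
set u := upd s' lth 0 i; have au : agree s' u by apply: agree_upd.
have Iu := agree_Inv au I'; have bu := agree_better au b'.
set c1 := Map ly aC (V vN) (ESub (EA aH (V ly)) (V lth)).
set c2 := Map ly aC (V vN) (ESub (EC 1) (ESub (EA aH (V ly)) (V lth))).
rewrite -[exec _ u]/(exec Consider (exec c2 (exec Consider (exec c1 u)))).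
set s1 := exec c1 u; have a1 : agree u s1 by apply: agree_exec.
have I1 := agree_Inv a1 Iu.
have C1 : setof s1 aC = level h i.
  apply/setP => y; rewrite !inE /s1 /c1 exec_map // evalV (Env_n (Inv_Env Iu)) ltn_ord.
  by rewrite -[eval _ _]/(s' aH (lab y) - i) fr // hh subn_eq0 -ltnNge.
have [I2 b2 h2] := ConsiderP eltK labK I1; rewrite C1 in h2.
set s2 := exec Consider s1 in I2 b2 h2 *.
set s3 := exec c2 s2; have a3 : agree s2 s3 by apply: agree_exec.
have I3 := agree_Inv a3 I2.
have C3 : setof s3 aC = ~: level h i.
  apply/setP => y; rewrite !inE /s3 /c2 exec_map // evalV (Env_n (Inv_Env I2)) ltn_ord.
  rewrite -[eval _ _]/(1 - (s2 aH (lab y) - s2 lth 0)) /s2 !exec_frame //.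
  by rewrite /s1 !exec_frame // -[u lth 0]/i -[u aH]/(s' aH) fr // hh; lia.
have [I4 b4 h4] := ConsiderP eltK labK I3; rewrite C3 in h4.
set s4 := exec Consider s3 in I4 b4 h4 *.
have b41 : better s4 s1.
  by apply: better_Inv_trans I3 b4 _; exact: agree_better a3 b2.
have b4u : better s4 u.
  by apply: better_Inv_trans I1 b41 _; apply: agree_better a1 _; exact: better_refl.
have tr T : hits s' T -> hits s4 T by move/(hits_agree au); exact: (hits_better Iu b4u).
split=> //; first exact: better_Inv_trans Iu b4u bu.
move=> th; rewrite ltnS leq_eqVlt => /orP[/eqP->|/h'[q1 q2]]; last by split; apply: tr.
split=> //; apply: (hits_better I3 b4); exact: hits_agree a3 _.
Qed.

Lemma DescentP s lam P : Inv s -> s ll 0 = lam -> setof s aP = P ->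
  let s' := exec Descent s in
  [/\ Inv s', better s' s & forall t th, t <= height S -> th < height S ->
     hits s' (candidate S lam P t th) /\ hits s' (~: candidate S lam P t th)].
Proof.
move=> I0 hl hP; rewrite /=.
rewrite -[exec Descent s]/(exec (CFor lit (V vTAU) (Levels ;; Step))
  (exec (Map ly aH (V vN) (EC 0)) s)).
set s1 := exec (Map _ _ _ _) s; have a1 : agree s s1 by apply: agree_exec.
have I1 := agree_Inv a1 I0.
pose it t := iter t (descend S (height S) lam P) (fun=> 0).
pose J i (s' : store) := [/\ Inv s', better s' s, forall y, s' aH (lab y) = it i y &
  forall t th, t < i -> th < height S ->
     hits s' (level (it t) th) /\ hits s' (~: level (it t) th)].
have hT : s1 vTAU 0 = (height S).+1 by case: (Inv_Env I1) => _ [_ [[]]].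
set c := CFor _ _ _.
suff : J (height S).+1 (exec c s1) by case=> q1 q2 _ q4; split.
rewrite -hT; apply: (for_ind (P := J)) => [|i s' hi fr [I' b' h' k']].
  split=> //; first by apply: agree_better a1 _; exact: better_refl.
  by move=> y; rewrite /s1 exec_map // evalV (Env_n (Inv_Env I0)) ltn_ord.
set u := upd s' lit 0 i; have au : agree s' u by apply: agree_upd.
have Iu := agree_Inv au I'; have bu := agree_better au b'.
have hu y : u aH (lab y) = it i y by rewrite /u upd_ne.
have [I2 b2 h2] := LevelsP Iu hu.
rewrite exec_seq; set s2 := exec Levels u in I2 b2 h2 *.
set s3 := exec Step s2; have a3 : agree s2 s3 by apply: agree_exec.
have b3 : better s3 u by apply: agree_better a3 b2.
have tr T : hits s' T -> hits s3 T by move/(hits_agree au); exact: (hits_better Iu b3).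
split.
- exact: agree_Inv a3 I2.
- exact: better_Inv_trans Iu b3 bu.
- move=> y; rewrite /s3 (@StepP _ lam (it i)) //.
  + have -> : setof s2 aP = P; last by [].
    rewrite -hP; apply: setof_ext; rewrite /s2 exec_frame // /u upd_ne // fr //.
    by rewrite /s1 exec_frame.
  + exact: Inv_Env.
  + by rewrite /s2 exec_frame // /u upd_ne // fr // /s1 exec_frame.
  + by move=> z; rewrite /s2 exec_frame.
- move=> t th; rewrite ltnS leq_eqVlt => /orP[/eqP-> hth|ht hth].
    by have [q1 q2] := h2 th hth; split; apply: hits_agree a3 _.
  by have [q1 q2] := k' t th ht hth; split; apply: tr.
Qed.

Lemma DescentsP s P : Inv s -> setof s aP = P ->
  let s' := exec Descents s in
  [/\ Inv s', better s' s & forall lam t th,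
     lam < lam_bound S -> t <= height S -> th < height S ->
     hits s' (candidate S lam P t th) /\ hits s' (~: candidate S lam P t th)].
Proof.
move=> I0 hP; rewrite /=.
pose J i (s' : store) := [/\ Inv s', better s' s & forall lam t th,
     lam < i -> t <= height S -> th < height S ->
     hits s' (candidate S lam P t th) /\ hits s' (~: candidate S lam P t th)].
have hL : s vLB 0 = lam_bound S by case: (Inv_Env I0) => _ [_ [[]]].
suff : J (lam_bound S) (exec Descents s) by [].
rewrite -hL; apply: (for_ind (P := J)) => [|i s' hi fr [I' b' h']].
  by split=> //; exact: better_refl.
set u := upd s' ll 0 i; have au : agree s' u by apply: agree_upd.
have Iu := agree_Inv au I'; have bu := agree_better au b'.
have hl : u ll 0 = i by rewrite /u upd0.
have hPu : setof u aP = P by rewrite -hP; apply: setof_ext; rewrite /u upd_ne // fr.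
have [I2 b2 h2] := DescentP Iu hl hPu.
split=> //; first exact: better_Inv_trans Iu b2 bu.
move=> lam t th; rewrite ltnS leq_eqVlt => /orP[/eqP->|hlam] ht hth; first exact: h2.
have tr T : hits s' T -> hits (exec Descent u) T.
  by move/(hits_agree au); exact: (hits_better Iu b2).
by have [q1 q2] := h' lam t th hlam ht hth; split; apply: tr.
Qed.

Lemma CountP s D : s vDD 0 = D -> (forall k, k < D -> s aSEL k <= 1) ->
  let s' := exec Count s in
  [/\ bin D (s' aSEL) + s' vCAR 0 * 2 ^ D = (bin D (s aSEL)).+1,
      forall k, k < D -> s' aSEL k <= 1 & forall k, D <= k -> s' aSEL k = s aSEL k].
Proof.
move=> hD h01.
rewrite /= -[exec Count s]/(exec (CFor ly (V vDD) (CIf (V vCAR)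
    (CIf (EA aSEL (V ly)) (CWr aSEL (V ly) (EC 0))
       (CWr aSEL (V ly) (EC 1) ;; Asg vCAR (EC 0))) CSkip)) (exec (Asg vCAR (EC 1)) s)).
set s1 := exec (Asg _ _) s; set c := CFor _ _ _.
have S1 : s1 aSEL = s aSEL by [].
have D1 : s1 vDD 0 = D by [].
pose J j (s' : store) := [/\ bin j (s' aSEL) + s' vCAR 0 * 2 ^ j = (bin j (s aSEL)).+1,
   s' vCAR 0 <= 1, forall k, k < j -> s' aSEL k <= 1 & forall k, j <= k -> s' aSEL k = s aSEL k].
suff : J D (exec c s1) by case.
rewrite -D1; apply: (for_ind (P := J)) => [|j s' hj fr [e1 e2 e3 e4]].
  by rewrite /J /bin !big_ord0 S1; split.
rewrite evalV D1 in hj.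
set u := upd s' ly 0 j.
have uS : u aSEL = s' aSEL by [].
have uC : u vCAR 0 = s' vCAR 0 by [].
have uj : u ly 0 = j by rewrite /u upd0.
have sj : s' aSEL j = s aSEL j by rewrite e4.
have binS (f : nat -> nat) : bin j.+1 f = bin j f + f j * 2 ^ j by rewrite /bin big_ord_recr.
have binU (v : nat) (w : store) a : bin j (upd w a j v a) = bin j (w a).
  apply: eq_bigr => k _; rewrite upd_same ifN // neq_ltn; apply/orP; left; exact: ltn_ord.
have eC : s' vCAR 0 = 0 \/ s' vCAR 0 = 1 by lia.
rewrite !exec_if !evalE uj uS uC; case: eC => eC; rewrite eC /=.
  rewrite exec_skip; split.
  - by rewrite uS uC eC !binS sj; move: e1; rewrite eC; lia.
  - by rewrite uC eC.
  - move=> k; rewrite ltnS leq_eqVlt => /orP[/eqP->|]; rewrite uS; last exact: e3.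
    by rewrite sj h01.
  - by move=> k hk; rewrite uS e4 // ltnW.
have s01 := h01 j hj.
case: (altP (s' aSEL j =P 0)) => h0.
  rewrite exec_seq exec_asg exec_wr !evalE uj; set w := upd (upd u _ _ _) _ _ _.
  have wS : w aSEL = upd u aSEL j 1 aSEL by [].
  have wC : w vCAR 0 = 0 by rewrite /w upd0.
  split.
  - rewrite wC mul0n addn0 wS binS binU upd_same eqxx uS mul1n binS -sj h0 mul0n addn0 -e1 eC.
    by rewrite mul1n.
  - by rewrite wC.
  - move=> k hk; rewrite wS upd_same; case: (altP (k =P j)) => // kj; rewrite uS e3 //; lia.
  - by move=> k hk; rewrite wS upd_same ifN ?uS ?e4 //; lia.
rewrite exec_wr !evalE uj; set w := upd u _ _ _.
have wC : w vCAR 0 = 1 by rewrite /w upd_ne // uC.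
have s1' : s aSEL j = 1 by rewrite -sj; move: h0; rewrite sj; lia.
split.
- rewrite wC mul1n /w binS binU upd_same eqxx uS mul0n addn0 binS s1' mul1n expnS.
  by move: e1; rewrite eC; lia.
- by rewrite wC.
- move=> k hk; rewrite /w upd_same; case: (altP (k =P j)) => // kj; rewrite uS e3 //; lia.
- by move=> k hk; rewrite /w upd_same ifN ?uS ?e4 //; lia.
Qed.

Lemma PatternsP s (asg : G -> nat) : Inv s ->
  (forall x, s aASG (lab x) = (asg x).+1) -> (forall x, asg x < n) ->
  let s' := exec Patterns s in
  [/\ Inv s', better s' s & forall sel lam t th,
     lam < lam_bound S -> t <= height S -> th < height S ->
     let T := candidate S lam (pattern S sel asg) t th in hits s' T /\ hits s' (~: T)].
Proof.
move=> I0 hA hn; rewrite /=.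
rewrite -[exec Patterns s]/(exec (CFor lp (V vP2) (Seed ;; Descents ;; Count))
  (exec (Map ly aSEL (EAdd (V vDD) (V vN)) (EC 0)) s)).
set s1 := exec (Map _ _ _ _) s; have a1 : agree s s1 by apply: agree_exec.
have I1 := agree_Inv a1 I0.
set D := cell_bound d.
have hD w : Inv w -> w vDD 0 = D by case=> -[_ [_ [_ [-> _]]]].
pose code (sel : nat -> bool) := bin D (fun k => sel k).
pose J i (s' : store) := [/\ Inv s', better s' s,
  [/\ i < 2 ^ D -> bin D (s' aSEL) = i, forall k, k < D -> s' aSEL k <= 1 &
     forall k, D <= k < D + n -> s' aSEL k = 0] &
  forall sel lam t th, code sel < i ->
     lam < lam_bound S -> t <= height S -> th < height S ->
     let T := candidate S lam (pattern S sel asg) t th in hits s' T /\ hits s' (~: T)].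
have hP2 : s1 vP2 0 = 2 ^ D by case: (Inv_Env I1) => _ [_ [_ [_ ->]]].
set c := CFor _ _ _.
have : J (2 ^ D) (exec c s1).
  rewrite -hP2; apply: (for_ind (P := J)) => [|i s' hi fr [I' b' [j1 j2 j3] h']].
    have z k : k < D + n -> s1 aSEL k = 0.
      move=> hk; rewrite /s1 exec_map // evalD !evalV (Env_n (Inv_Env I0)) hD //.
      by rewrite hk evalC.
    split=> //; first by apply: agree_better a1 _; exact: better_refl.
    split=> [_|k hk|k /andP[_ hk]]; last 2 first.
    - by rewrite z //; lia.
    - exact: z.
    by rewrite /bin big1 // => k _; rewrite z //; have := ltn_ord k; lia.
  rewrite evalV hP2 in hi; have {}j1 := j1 hi.
  set u := upd s' lp 0 i; have au : agree s' u by apply: agree_upd.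
  have Iu := agree_Inv au I'; have bu := agree_better au b'.
  rewrite -[exec _ u]/(exec Count (exec Descents (exec Seed u))).
  set s2 := exec Seed u; have a2 : agree u s2 by apply: agree_exec.
  have I2 := agree_Inv a2 Iu.
  have [I3 b3 h3] := DescentsP I2 (erefl _).
  set s3 := exec Descents s2 in I3 b3 h3 *.
  have S3 : s3 aSEL = s' aSEL by rewrite /s3 exec_frame // /s2 exec_frame.
  have [||k1 k2 k3] := @CountP s3 D.
  - exact: hD.
  - by move=> k hk; rewrite S3; exact: j2.
  set s4 := exec Count s3 in k1 k2 k3 *; have a4 : agree s3 s4 by apply: agree_exec.
  have b3u : better s3 u.
    by apply: better_Inv_trans I2 b3 _; apply: agree_better a2 _; exact: better_refl.
  have b4u : better s4 u by exact: agree_better a4 b3u.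
  have tr T : hits s' T -> hits s4 T by move/(hits_agree au); exact: (hits_better Iu b4u).
  split.
  - exact: agree_Inv a4 I3.
  - exact: better_Inv_trans Iu b4u bu.
  - split=> [hi1|//|k hk]; last by rewrite k3 ?S3 ?j3 //; case/andP: hk.
    by move: k1; rewrite S3 j1; case: (s4 vCAR 0) => [|q]; [lia | rewrite mulSn; lia].
  - move=> sel lam t th; rewrite ltnS leq_eqVlt => /orP[/eqP es|hsel] hlam ht hth; last first.
      by have [q1 q2] := h' sel lam t th hsel hlam ht hth; split; apply: tr.
    have eP : setof s2 aP = pattern S sel asg.
      apply/setP => x; rewrite !inE /s2 exec_map // evalV (Env_n (Inv_Env Iu)) ltn_ord.
      rewrite !evalE upd0 !upd_ne //.
      have -> : u aASG (lab x) = (asg x).+1.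
        by rewrite /u upd_ne // fr // /s1 exec_frame.
      rewrite subn1 /= -/D; have -> : u aSEL = s' aSEL by [].
      case: (ltnP (asg x) D) => hx /=; last first.
        by rewrite j3 // hx (leq_trans (hn x)) // leq_addl.
      have -> : s' aSEL (asg x) = sel (asg x).
        apply: (@bin_inj D (s' aSEL) (fun k => sel k)) => //.
          by move=> k _; case: (sel k).
        by rewrite j1 -es.
      by case: (sel _).
    have := h3 lam t th hlam ht hth; rewrite eP => -[q1 q2].
    by split; apply: hits_agree a4 _.
case=> q1 q2 _ q4; split=> // sel lam t th; apply: q4.
by apply: bin_lt => k _; case: (sel k).
Qed.

Lemma MainP s : Inv s -> let s' := exec Main s in
  Inv s' /\ searched S (hits s').
Proof.
move=> I0; rewrite /=.
pose J i (s' : store) := Inv s' /\ forall r, r < i -> exists cs asg,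
  [/\ is_net S r cs asg, forall c, c \in cs -> hits s' (ball r c) &
  forall sel lam t th, lam < lam_bound S -> t <= height S -> th < height S ->
      let T := candidate S lam (pattern S sel asg) t th in hits s' T /\ hits s' (~: T)].
suff : J n.+1 (exec Main s) by [].
have hb : eval (EAdd (V vN) (EC 1)) s = n.+1.
  by rewrite !evalE (Env_n (Inv_Env I0)) addn1.
rewrite -hb; apply: (for_ind (P := J)) => [//|i s' hi fr [I' h']].
rewrite hb ltnS in hi.
set u := upd s' lr 0 i; have au : agree s' u by apply: agree_upd.
have Iu := agree_Inv au I'.
have er : u lr 0 = i by rewrite /u upd0.
have [I1 b1 [cs [asg [n1 n2 n3 n4]]]] := NetP eltK labK Iu er hi.
rewrite exec_seq; set s1 := exec Net u in I1 b1 n3 n4 *.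
have hn x : asg x < n by apply: leq_trans n2; case: n1 => _ /(_ x)[].
have [I2 b2 h2] := PatternsP I1 n3 hn.
set s2 := exec Patterns s1 in I2 b2 h2 *.
have tr T : hits s' T -> hits s2 T.
  by move/(hits_agree au)/(hits_better Iu b1); exact: (hits_better I1 b2).
split=> // r; rewrite ltnS leq_eqVlt => /orP[/eqP->|/h'[cs' [asg' [m1 m2 m3]]]].
  by exists cs, asg; split=> // c /n4; exact: (hits_better I1 b2).
exists cs', asg'; split=> // [c /m2|sel lam t th q1 q2 q3]; first exact: tr.
by have [w1 w2] := m3 sel lam t th q1 q2 q3; split; apply: tr.
Qed.

End Search.

(** * The whole search *)

Definition Double (v : nat) : cmd := Asg v (EAdd (V v) (V v)).

Definition Header : cmd := Asg vN (EA aIN (EC 0)) ;; Asg vD (EA aIN (EC 1)).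

Definition Rows : cmd :=
  Asg vX (EC 2) ;; CFor ly (V vN) (CWr aROW (V ly) (V vX) ;; Incr vX (V vN)) ;;
  Asg vSB (V vX).

Definition LamBound : cmd :=
  Asg vY (EC 0) ;; CFor ly (V vN) (Incr vY (V vD)) ;;
  Asg vLB (V vY) ;; CFor ly (EC 8) (Double vLB).

Definition TwiceLamBound : cmd := Asg vX (EAdd (V vLB) (V vLB)).

Definition Height : cmd :=
  Asg vM (EC 0) ;; CFor ly (V vX) (Incr vM (V vX)) ;; Asg vTAU (EAdd (V vM) (EC 1)).

Definition CellBound (c : nat) : cmd :=
  Asg vDD (EC 2) ;;
  CFor ly (V vD)
    (CFor lz (EC c) (Double vDD) ;;
     CFor lz (EC 4) (Asg vX (EC 0) ;; CFor lk (V vD) (Incr vX (V vDD)) ;; Asg vDD (V vX))).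

Definition PatternBound : cmd := Asg vP2 (EC 1) ;; CFor ly (V vDD) (Double vP2).

Definition Init : cmd :=
  Map ly aBEST (V vN) (EC 0) ;; CWr aBEST (EC 0) (EC 1) ;;
  Asg vBS (EC 1) ;; Asg vBB (V vD).

(* The label [n] names no element and so is ignored when the output is decoded. *)
Definition Output : cmd :=
  CFor ly (V vN) (CIf (EA aBEST (V ly)) (CWr aOUT (V ly) (V ly)) (CWr aOUT (V ly) (V vN))).

Definition phases : seq cmd :=
  [:: Header; Rows; LamBound; TwiceLamBound; Height; CellBound 17; PatternBound; Init; Main; Output].

Fixpoint sequence (l : seq cmd) : cmd := if l is c :: l' then c ;; sequence l' else CSkip.

Definition Whole : cmd := sequence phases.

Lemma exec_sequence c l s : exec (sequence (c :: l)) s = exec (sequence l) (exec c s).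
Proof. by []. Qed.

Lemma incr_loop v b a c s : v != a -> v != c -> a != c ->
  exec (CFor v b (Incr a (V c))) s a 0 = s a 0 + eval b s * s c 0.
Proof.
move=> va vc ac; pose I k (s' : store) := s' a 0 = s a 0 + k * s c 0.
apply: (for_ind (P := I)) => [|k s' hk fr IH]; first by rewrite /I mul0n addn0.
rewrite /I exec_asg upd0 !evalE !upd_ne 1?eq_sym // IH fr; first by rewrite mulSn; lia.
by rewrite /= !inE negb_or eq_sym vc eq_sym ac.
Qed.

Lemma double_loop v b a s : v != a ->
  exec (CFor v b (Double a)) s a 0 = s a 0 * 2 ^ eval b s.
Proof.
move=> va; pose I k (s' : store) := s' a 0 = s a 0 * 2 ^ k.
apply: (for_ind (P := I)) => [|k s' hk fr IH]; first by rewrite /I muln1.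
by rewrite /I exec_asg upd0 !evalE upd_ne 1?eq_sym // IH expnS mulnCA mul2n addnn.
Qed.

Lemma RowsP s n : s vN 0 = n ->
  (forall i, i < n -> exec Rows s aROW i = 2 + i * n) /\ exec Rows s vSB 0 = 2 + n * n.
Proof.
move=> hn; rewrite /Rows !exec_seq; set s1 := exec (Asg vX _) s; set c := CFor _ _ _.
have h1 : s1 vN 0 = n by [].
pose I i (s' : store) := s' vX 0 = 2 + i * n /\ forall j, j < i -> s' aROW j = 2 + j * n.
have : I n (exec c s1).
  rewrite -{1}h1; apply: (@for_ind I ly (V vN)) => [//|i s' hi fr [e1 e2]].
  rewrite exec_seq exec_wr !evalE; set u := upd s' ly 0 i.
  rewrite -[u ly 0]/i -[u vX 0]/(s' vX 0); split.
    rewrite exec_asg upd0 !evalE -[upd _ _ _ _ vX 0]/(s' vX 0) e1.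
    by rewrite -[upd _ _ _ _ vN 0]/(s' vN 0) fr // h1 mulSn; lia.
  move=> j; rewrite ltnS leq_eqVlt exec_frame // upd_same.
  by case: (altP (j =P i)) => [-> _|_ /= hj]; rewrite ?e1 // -[u aROW]/(s' aROW) e2.
by case=> e1 e2; rewrite exec_asg upd0 evalV e1; split=> // i /e2 <-.
Qed.

Lemma CellBoundP c s d : s vD 0 = d -> exec (CellBound c) s vDD 0 = 2 * (2 ^ c * d ^ 4) ^ d.
Proof.
move=> hd; rewrite /CellBound exec_seq; set s1 := exec (Asg vDD _) s.
have h1 : s1 vD 0 = d by [].
pose I i (s' : store) := s' vDD 0 = 2 * (2 ^ c * d ^ 4) ^ i.
rewrite -{2}h1; apply: (@for_ind I ly (V vD)) => [|i s' hi fr IH].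
  by rewrite /I expn0.
rewrite /I exec_seq; set u := upd s' ly 0 i; set s2 := exec _ u.
have e2 : s2 vDD 0 = 2 * (2 ^ c * d ^ 4) ^ i * 2 ^ c.
  by rewrite /s2 double_loop // evalC -IH.
have hd2 : s2 vD 0 = d by rewrite /s2 exec_frame // /u upd_ne // fr.
pose J k (s' : store) := s' vDD 0 = s2 vDD 0 * d ^ k.
have : J 4 (exec (CFor lz (EC 4) (Asg vX (EC 0) ;; CFor lk (V vD) (Incr vX (V vDD)) ;; Asg vDD (V vX))) s2).
  apply: (@for_ind J lz (EC 4)) => [|k s3 hk fr3 IH3]; first by rewrite /J muln1.
  rewrite /J !exec_seq exec_asg upd0 evalV incr_loop // evalV.
  set w := exec (Asg _ _) _; rewrite -[w vX 0]/0 -[w vDD 0]/(s3 vDD 0) -[w vD 0]/(s3 vD 0).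
  by rewrite fr3 // hd2 IH3 expnS mulnCA.
by rewrite /J => ->; rewrite e2 [_ ^ i.+1]expnSr !mulnA.
Qed.

Section Search.
Variables (G : finZmodType) (elt : 'I_#|G| -> G) (lab : G -> 'I_#|G|) (S : seq G).
Hypotheses (eltK : cancel elt lab) (labK : cancel lab elt).
Implicit Types (Q T : {set G}) (s : store) (x y : G).
Local Notation n := #|G|.
Local Notation d := (size S).
Local Notation b := (cay_boundary S).
Local Notation inp := (encode_input elt lab S).
Local Notation Env := (Env elt lab S).
Local Notation Inv := (Inv elt lab S).
Local Notation setof := (setof lab).
Local Notation hits := (hits S).

Definition input_store : store := fun a i => if a == aIN then nth 0 inp i else 0.

Lemma LamBoundP s : s vN 0 = n -> s vD 0 = d -> exec LamBound s vLB 0 = lam_bound S.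
Proof.
move=> h1 h2; rewrite /LamBound !exec_seq double_loop // evalC exec_asg upd0 evalV.
rewrite incr_loop // evalV /lam_bound.
set w := exec _ s; rewrite -[w vY 0]/0 -[w vN 0]/(s vN 0) -[w vD 0]/(s vD 0) h1 h2.
by rewrite add0n mulnC.
Qed.

Lemma HeightP s : s vX 0 = 2 * lam_bound S ->
  exec Height s vM 0 = height S /\ exec Height s vTAU 0 = (height S).+1.
Proof.
move=> h1; rewrite /Height !exec_seq exec_asg; set s2 := exec (Asg vM _) s.
have e : exec (CFor ly (V vX) (Incr vM (V vX))) s2 vM 0 = height S.
  by rewrite incr_loop // evalV -[s2 vM 0]/0 -[s2 vX 0]/(s vX 0) h1.
by rewrite upd_ne // upd0 !evalE e addn1.
Qed.

Definition s_setup : store :=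
  exec PatternBound (exec (CellBound 17) (exec Height (exec TwiceLamBound
    (exec LamBound (exec Rows (exec Header input_store)))))).

Lemma setupP : Env s_setup.
Proof.
rewrite /s_setup.
have f c s a : a \notin writes c -> exec c s a = s a by exact: exec_frame.
set s1 := exec Header _; have n1 : s1 vN 0 = n by [].
have d1 : s1 vD 0 = d by [].
have i1 i : s1 aIN i = nth 0 inp i by [].
clearbody s1; set s2 := exec Rows s1; have [r1 r2] := RowsP n1.
have f2 := f Rows s1; rewrite -/s2 in r1 r2 f2; clearbody s2.
have n2 : s2 vN 0 = n by rewrite f2.
have d2 : s2 vD 0 = d by rewrite f2.
set s3 := exec LamBound s2; have l3 : s3 vLB 0 = lam_bound S by exact: LamBoundP.
have f3 := f LamBound s2; rewrite -/s3 in f3; clearbody s3.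
set s4 := exec TwiceLamBound s3.
have x4 : s4 vX 0 = 2 * lam_bound S by rewrite mul2n -addnn -l3.
have f4 := f TwiceLamBound s3; rewrite -/s4 in f4; clearbody s4.
set s5 := exec Height s4; have [m5 t5] := HeightP x4.
have f5 := f Height s4; rewrite -/s5 in m5 t5 f5; clearbody s5.
set s6 := exec (CellBound 17) s5.
have c6 : s6 vDD 0 = cell_bound d by apply: CellBoundP; rewrite f5 // f4 // f3.
have f6 := f (CellBound 17) s5; rewrite -/s6 in f6; clearbody s6.
set s7 := exec PatternBound s6.
have p7 : s7 vP2 0 = 2 ^ cell_bound d.
  by rewrite /s7 /PatternBound exec_seq double_loop // evalV exec_asg upd0 upd_ne // c6 mul1n.
have f7 := f PatternBound s6; rewrite -/s7 in f7; clearbody s7.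
split; first split.
- by move=> i; rewrite f7 // f6 // f5 // f4 // f3 // f2.
- by rewrite f7 // f6 // f5 // f4 // f3.
- by rewrite f7 // f6 // f5 // f4 // f3.
split; first split.
- by move=> i hi; rewrite f7 // f6 // f5 // f4 // f3 // r1.
- by rewrite f7 // f6 // f5 // f4 // f3.
split; first split.
- by rewrite f7 // f6 // f5 // f4.
- by rewrite f7 // f6.
- by rewrite f7 // f6.
by split=> //; rewrite f7.
Qed.

Hypotheses (S_sym : symmetric_mset S) (n2 : 2 <= n) (d1 : 0 < d).

Lemma InitP s : Env s -> Inv (exec Init s).
Proof.
move=> E0; split; first by apply: Env_exec E0.
rewrite /Init !exec_seq !exec_asg !evalC !evalV.
set s1 := exec (Map _ _ _ _) s.
set s2 := upd s1 _ _ _.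
set s3 := upd _ vBB _ _.
pose x0 := elt (Ordinal (ltnW n2 : 0 < n)).
have e : setof s3 aBEST = [set x0].
  have x00 : lab x0 = 0 :> nat by rewrite eltK.
  have -> : setof s3 aBEST = setof s2 aBEST by apply: eq_setof.
  have -> : s2 = upd s1 aBEST (lab x0) 1 by rewrite x00.
  rewrite (setof_upd labK) //; apply/setP => x; rewrite !inE /s1.
  by rewrite exec_map // evalV (Env_n E0) ltn_ord evalC orbF.
have eB : s3 vBB 0 = d.
  by rewrite /s3 upd0 -[upd _ _ _ _ vD]/(s1 vD) /s1 exec_frame // (Env_d E0).
rewrite /BestOK e cards1 eB -[s3 vBS 0]/1; split=> //.
by apply: leq_trans (boundary_le _ _) _; rewrite cards1 mul1n.
Qed.

Lemma OutputP s x : Env s -> exec Output s aOUT (lab x) =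
  if s aBEST (lab x) == 0 then n else lab x.
Proof.
move=> E0; pose I i (s' : store) := forall j, j < i ->
  s' aOUT j = if s aBEST j == 0 then n else j.
suff : I n (exec Output s) by apply; exact: ltn_ord.
rewrite -(Env_n E0); apply: (@for_ind I ly (V vN)) => [//|i s' hi fr IH j hj].
rewrite /I in IH; set u := upd s' ly 0 i.
rewrite exec_if !exec_wr !evalE -[u ly 0]/i -[u aBEST]/(s' aBEST) -[u vN]/(s' vN).
rewrite !fr // (Env_n E0) (fun_if (fun w : store => w aOUT j)) !upd_same -[u aOUT]/(s' aOUT).
move: hj; rewrite ltnS leq_eqVlt; case: (altP (j =P i)) => [-> _|_ /= hj].
  by case: ifP.
by rewrite IH //; case: (s aBEST i == 0).
Qed.

Definition s_final : store := exec Output (exec Main (exec Init s_setup)).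

Lemma exec_Whole : exec Whole input_store = s_final.
Proof. by rewrite /Whole /phases !exec_sequence. Qed.

Theorem final_correct : s_final aIN 0 = n /\ exists Q : {set G}, [/\
  forall x, s_final aOUT (lab x) = if x \in Q then nat_of_ord (lab x) else n, adm Q &
  forall T, adm T -> b Q * #|T| <= 10 * (b T * #|Q|)].
Proof.
have I1 := InitP setupP.
have [I2 h2] := MainP eltK labK I1.
set s := exec Main _ in I2 h2.
have [[in0 _ _] _] := Inv_Env I2.
split; first by rewrite /s_final exec_frame // in0.
have [T [hT aT tT]] := search_approx S_sym n2 d1 h2.
case: I2 => E [q1 q2 q3 q4]; exists (setof s aBEST); split.
- move=> x; rewrite /s_final OutputP // inE; by case: (_ == 0).
- by rewrite /adm -q2 q1 q3.
- move=> U hU; have := hT aT; rewrite /beats => h.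
  have t0 : 0 < #|T| by case/andP: aT.
  rewrite -q2 -(leq_pmul2r t0).
  apply: (@leq_trans (s vBB 0 * #|T| * #|U|)).
    by rewrite mulnAC leq_mul2r leq_mul2r q4 !orbT.
  apply: (@leq_trans (b T * s vBS 0 * #|U|)); first by rewrite leq_mul2r h orbT.
  rewrite mulnAC; apply: leq_trans (leq_mul (tT U hU) (leqnn _)) _.
  by rewrite -!mulnA (mulnC #|T|).
Qed.

End Search.

(** * Cost of the search *)

Fixpoint overhead (c : cmd) : nat :=
  match c with
  | CSkip => 0
  | CWr a e1 e2 => ecost e1 + ecost e2 + 10
  | CSeq c1 c2 => overhead c1 + overhead c2
  | CIf e c1 c2 => ecost e + 3 + (overhead c1 + overhead c2)
  | CFor v e c => ecost e + 12 + overhead c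
  end.

Fixpoint nest (c : cmd) : nat :=
  match c with
  | CSkip | CWr _ _ _ => 0
  | CSeq c1 c2 | CIf _ c1 c2 => maxn (nest c1) (nest c2)
  | CFor _ _ c => (nest c).+1
  end.

Fixpoint bounded (X : nat) (c : cmd) (s : store) : bool :=
  match c with
  | CSkip | CWr _ _ _ => true
  | CSeq c1 c2 | CIf _ c1 c2 => bounded X c1 s && bounded X c2 s
  | CFor _ e c => (eval e s <= X) && bounded X c s
  end.

Lemma scost_bound X c s : 0 < X -> bounded X c s -> scost c s <= overhead c * X ^ nest c.
Proof.
move=> X0; have Xp k : 0 < X ^ k by rewrite expn_gt0 X0.
have mono u k l : k <= l -> u * X ^ k <= u * X ^ l by move=> h; rewrite leq_mul2l leq_pexp2l ?orbT.
elim: c => [|a e1 e2|c1 IH1 c2 IH2|e c1 IH1 c2 IH2|v e c IH] //=.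
- by rewrite muln1.
- case/andP=> /IH1 h1 /IH2 h2; rewrite mulnDl.
  by apply: leq_add; [apply: leq_trans h1 (mono _ _ _ (leq_maxl _ _)) | apply: leq_trans h2 (mono _ _ _ (leq_maxr _ _))].
- case/andP=> /IH1 h1 /IH2 h2; rewrite mulnDl [(overhead c1 + _) * _]mulnDl.
  apply: leq_add; first by apply: leq_pmulr.
  by apply: leq_add; [apply: leq_trans h1 (mono _ _ _ (leq_maxl _ _)) | apply: leq_trans h2 (mono _ _ _ (leq_maxr _ _))].
- case/andP=> he /IH h.
  have h1 : eval e s * (9 + scost c s) <= X * (9 * X ^ nest c + overhead c * X ^ nest c).
    by apply: leq_mul => //; apply: leq_add => //; apply: leq_pmulr.
  have h2 : ecost e + 3 <= (ecost e + 3) * X ^ (nest c).+1 by apply: leq_pmulr.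
  apply: leq_trans (leq_add h2 h1) _; rewrite -mulnDl mulnCA -expnS -mulnDl.
  by rewrite leq_mul2r; apply/orP; right; lia.
Qed.

Definition phase_ok (c : cmd) : bool := static c && (nest c <= 7).

Lemma phase_cost X c s : 0 < X -> phase_ok c -> bounded X c s ->
  cost c s <= overhead c * X ^ 7.
Proof.
move=> X0 /andP[h1 h2] h3; apply: leq_trans (cost_static s h1) _.
by apply: leq_trans (scost_bound X0 h3) _; rewrite leq_mul2l leq_pexp2l ?orbT.
Qed.

Fixpoint run_bounded (X : nat) (l : seq cmd) (s : store) : bool :=
  if l is c :: l' then bounded X c s && run_bounded X l' (exec c s) else true.

Lemma run_boundedE X c l s :
  run_bounded X (c :: l) s = bounded X c s && run_bounded X l (exec c s).
Proof. by []. Qed.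

Lemma sequence_cost X l s : 0 < X -> all phase_ok l -> run_bounded X l s ->
  cost (sequence l) s <= overhead (sequence l) * X ^ 7.
Proof.
move=> X0; elim: l s => //= c l IH s /andP[h1 h2] /andP[h3 h4].
by rewrite mulnDl; apply: leq_add; [exact: phase_cost | exact: IH].
Qed.

Lemma phases_ok : all phase_ok phases.
Proof. by []. Qed.

Lemma cok_Whole : cok Whole.
Proof. by []. Qed.

Lemma cwid_Whole : cwid Whole <= 60.
Proof. by []. Qed.

Section Search.
Variables (G : finZmodType) (elt : 'I_#|G| -> G) (lab : G -> 'I_#|G|) (S : seq G).
Hypotheses (eltK : cancel elt lab) (labK : cancel lab elt).
Hypotheses (S_sym : symmetric_mset S) (n2 : 2 <= #|G|) (d1 : 0 < size S).
Local Notation n := #|G|.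
Local Notation d := (size S).

Definition scale := 2 ^ cell_bound d * (height S).+1.

Lemma scale_ge : [/\ 0 < scale, n.+1 <= scale, d <= scale, 17 <= scale & lam_bound S + lam_bound S <= scale] /\
  [/\ (height S).+1 <= scale, cell_bound d + n <= scale & 2 ^ cell_bound d <= scale].
Proof.
have h1 : 0 < 2 ^ cell_bound d by rewrite expn_gt0.
have h2 : cell_bound d <= 2 ^ cell_bound d by rewrite ltnW // ltn_expl.
have h3 : 512 * n <= lam_bound S + lam_bound S.
  rewrite /lam_bound; have : n * 1 <= n * d by rewrite leq_mul2l d1 orbT.
  by lia.
have h4 : 512 * d <= lam_bound S + lam_bound S.
  rewrite /lam_bound; have : 1 * d <= n * d by rewrite leq_mul2r (ltnW n2) orbT.
  by lia.
have h5 : lam_bound S + lam_bound S <= height S.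
  rewrite /height addnn -mul2n -{1}[2 * _]muln1 expnS expn1 leq_mul2l; lia.
have h6 : height S <= 2 ^ cell_bound d * height S by rewrite leq_pmull.
rewrite /scale mulnS; move: (2 ^ cell_bound d) (cell_bound d) (height S) (lam_bound S) h1 h2 h3 h4 h5 h6.
move=> p q r u h1 h2 h3 h4 h5; move: (p * r) => w h6.
have n2' := n2; move: #|G| h3 n2' => m h3 m2; move: (size S) h4 => e h4.
split; split; lia.
Qed.

Lemma main_bounded s : Env elt lab S s -> bounded scale Main s.
Proof.
have [[x0 x1 x2 x3 x4] [x5 x6 x7]] := scale_ge.
have y1 : n <= scale by exact: ltnW.
have y2 : lam_bound S <= scale by apply: leq_trans x4; exact: leq_addr.
have y3 : height S <= scale by exact: ltnW.
have y4 : cell_bound d <= scale by apply: leq_trans x6; exact: leq_addr.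
case=> -[_ a2 a3] [_ [[a4 a5 a6] [a7 a8]]].
by rewrite /= !evalE a2 a3 a4 a5 a6 a7 a8 addn1 x1 y1 x2 y2 y3 x5 x6 x7 y4.
Qed.

Lemma vN_bounded s : s vN 0 = n ->
  [/\ bounded scale Rows s, bounded scale LamBound s, bounded scale Init s &
      bounded scale Output s].
Proof.
have [[x0 x1 x2 x3 x4] [x5 x6 x7]] := scale_ge.
have y1 : n <= scale by exact: ltnW.
have y8 : 8 <= scale by apply: leq_trans x3.
by move=> e; rewrite /= !evalE e y1 y8.
Qed.

Lemma vX_bounded s : s vX 0 = lam_bound S + lam_bound S -> bounded scale Height s.
Proof.
have [[x0 x1 x2 x3 x4] [x5 x6 x7]] := scale_ge.
by move=> e; rewrite /= !evalE e x4.
Qed.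

Lemma vD_bounded s : s vD 0 = d -> bounded scale (CellBound 17) s.
Proof.
have [[x0 x1 x2 x3 x4] [x5 x6 x7]] := scale_ge.
have y4 : 4 <= scale by apply: leq_trans x3.
by move=> e; rewrite /= !evalE e x2 x3 y4.
Qed.

Lemma vDD_bounded s : s vDD 0 = cell_bound d -> bounded scale PatternBound s.
Proof.
have [[x0 x1 x2 x3 x4] [x5 x6 x7]] := scale_ge.
have y4 : cell_bound d <= scale by apply: leq_trans x6; exact: leq_addr.
by move=> e; rewrite /= !evalE e y4.
Qed.

Lemma phases_bounded : run_bounded scale phases (input_store elt lab S).
Proof.
have E7 := setupP elt lab S; have I8 := InitP eltK labK n2 E7.
have [I9 _] := MainP eltK labK I8; rewrite /s_setup in E7 I8 I9.
rewrite /phases !run_boundedE; set s0 := input_store _ _ _ in E7 I8 I9 *.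
have n1 : exec Header s0 vN 0 = n by [].
have nr : exec Rows (exec Header s0) vN 0 = n by rewrite exec_frame; [exact: n1|].
have dr : exec Rows (exec Header s0) vD 0 = d by rewrite exec_frame.
have l3 := LamBoundP nr dr.
have x4 : exec TwiceLamBound (exec LamBound (exec Rows (exec Header s0))) vX 0
  = lam_bound S + lam_bound S by rewrite -l3.
have d5 : exec Height (exec TwiceLamBound (exec LamBound (exec Rows (exec Header s0)))) vD 0 = d.
  by do 3 (rewrite exec_frame; last by []); exact: dr.
have c6 := CellBoundP 17 d5; rewrite -/(cell_bound d) in c6.
apply/andP; split; first by [].
apply/andP; split; first by case: (vN_bounded n1).
apply/andP; split; first by case: (vN_bounded nr).
apply/andP; split; first by [].
apply/andP; split; first exact: vX_bounded.
apply/andP; split; first exact: vD_bounded.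
apply/andP; split; first exact: vDD_bounded.
apply/andP; split; first by case: (vN_bounded (Env_n E7)).
apply/andP; split; first exact: main_bounded (Inv_Env I8).
apply/andP; split; last by [].
by case: (vN_bounded (Env_n (Inv_Env I9))).
Qed.

Lemma whole_cost : cost Whole (input_store elt lab S) <= overhead Whole * scale ^ 7.
Proof.
have [[x0 _ _ _ _] _] := scale_ge.
exact: (sequence_cost x0 phases_ok phases_bounded).
Qed.

End Search.

(** * Loading the input and unloading the output *)

Notation memory := (nat -> nat).

Definition copy_code (p a b : nat) : seq instr :=
  [:: ISub 3 0 1; IJz 3 (p + 10); ILoad 3 a; IStore b 3; IConst 3 1; IAdd 1 1 3;
      IConst 3 64; IAdd 2 2 3; IConst 3 0; IJz 3 p].

Definition pass (r : nat) : seq instr := [:: IStore 3 r; IAdd 3 3 4].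

Definition fetch (t : nat) : seq instr := IConst 5 2 :: nseq t (IAdd 5 5 0) ++ [:: ILoad 5 5].

(* When [n < 4] the admissible sets are the singletons, and [0] is a correct answer. *)
Definition guard : seq instr :=
  [:: IConst 3 4; ISub 3 3 0; IJz 3 6; IConst 0 1; IConst 1 0; IHalt].

Definition square : seq instr :=
  [:: IConst 3 0; IAdd 4 0 3;
      IAdd 3 3 0; IConst 5 1; ISub 4 4 5; IJz 4 14; IConst 5 0; IJz 5 8].

(* Registers 3, 4, 5 hold the table entries (0,1), (0,2), (0,3); these are free
   for use because, the group being commutative, they can be fetched again from
   the entries (1,0), (2,0), (3,0). *)
Definition relocate : seq instr :=
  [:: IAdd 3 3 1; IConst 4 64; IAdd 3 3 4] ++
  pass 0 ++ pass 1 ++ pass 2 ++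
  fetch 1 ++ pass 5 ++ fetch 2 ++ pass 5 ++ fetch 3 ++ pass 5 ++
  flatten [seq pass r | r <- iota 6 26] ++
  [:: IConst 4 (64 * 32); ISub 0 3 4; IConst 1 32; IConst 2 0; IAdd 2 2 3].

Definition prelude : seq instr :=
  let l := guard ++ square ++ relocate in l ++ copy_code (size l) 1 2.

Definition emit (k : nat) : seq instr :=
  [:: IConst k (64 * k.-1 + aOUT); IAdd k k 0; ILoad k k].

Definition epilogue (p : nat) : seq instr :=
  [:: IConst 1 32; IConst 2 (64 * 31 + aOUT); IAdd 2 2 0] ++ copy_code (p + 3) 2 1 ++
  flatten [seq emit k | k <- iota 1 31] ++ [:: ILoad 0 0; IHalt].

Definition machine : program :=
  let l1 := prelude in let l2 := compile (size l1) 1 Whole in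
  l1 ++ l2 ++ epilogue (size (l1 ++ l2)).

Lemma copy_step P p a b m base : code_at P p (copy_code p a b) ->
  (a == 1) || (a == 2) -> (b == 1) || (b == 2) ->
  m 0 = base -> m 1 < base -> 3 < m a -> 3 < m b -> exists m',
  [/\ reach P (p, m) 10 (p, m'), m' 0 = base, m' 1 = (m 1).+1, m' 2 = m 2 + 64 &
    forall j, 3 < j -> m' j = if j == m b then m (m a) else m j].
Proof.
move=> hc ha hb m0 m1 ma mb.
have h i : i < 10 -> nth IHalt P (p + i) = nth IHalt (copy_code p a b) i by exact: hc.
pose u1 := mem_upd m 3 (base - m 1).
pose u2 := mem_upd u1 3 (u1 (u1 a)).
pose u3 := mem_upd u2 (u2 b) (u2 3).
pose u4 := mem_upd u3 3 1.
pose u5 := mem_upd u4 1 (u4 1 + u4 3).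
pose u6 := mem_upd u5 3 64.
pose u7 := mem_upd u6 2 (u6 2 + u6 3).
pose u8 := mem_upd u7 3 0.
have a3 : a != 3 by case/orP: ha => /eqP->.
have b3 : b != 3 by case/orP: hb => /eqP->.
have ub : u2 b = m b by rewrite /u2 /u1 !mem_updE !ifN.
exists u8; split.
- exists 10 => //=.
  have s0 : ram_step P (p, m) = Some (p + 1, u1).
    by rewrite /ram_step -{1}[p]addn0 h //= addn1 m0.
  have s1 : ram_step P (p + 1, u1) = Some (p + 2, u1).
    by rewrite /ram_step h // /= /u1 mem_updE eqxx ifN ?addn1 ?addn2 // -lt0n subn_gt0.
  have s2 : ram_step P (p + 2, u1) = Some (p + 3, u2) by rewrite /ram_step h // -addnS.
  have s3 : ram_step P (p + 3, u2) = Some (p + 4, u3) by rewrite /ram_step h // -addnS.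
  have s4 : ram_step P (p + 4, u3) = Some (p + 5, u4) by rewrite /ram_step h // -addnS.
  have s5 : ram_step P (p + 5, u4) = Some (p + 6, u5) by rewrite /ram_step h // -addnS.
  have s6 : ram_step P (p + 6, u5) = Some (p + 7, u6) by rewrite /ram_step h // -addnS.
  have s7 : ram_step P (p + 7, u6) = Some (p + 8, u7) by rewrite /ram_step h // -addnS.
  have s8 : ram_step P (p + 8, u7) = Some (p + 9, u8) by rewrite /ram_step h // -addnS.
  have s9 : ram_step P (p + 9, u8) = Some (p, u8) by rewrite /ram_step h.
  by rewrite s0 /= s1 /= s2 /= s3 /= s4 /= s5 /= s6 /= s7 /= s8 /= s9.
- rewrite /u8 /u7 /u6 /u5 /u4 !mem_updE /= /u3 mem_updE ub ifN; last by lia.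
  by rewrite /u2 /u1 !mem_updE.
- rewrite /u8 /u7 /u6 /u5 !mem_updE /= /u4 !mem_updE /= /u3 mem_updE ub ifN; last by lia.
  by rewrite /u2 /u1 !mem_updE addn1.
- rewrite /u8 /u7 !mem_updE /= /u6 !mem_updE /= /u5 mem_updE /= /u4 mem_updE /=.
  by rewrite /u3 mem_updE ub ifN; [rewrite /u2 /u1 !mem_updE | lia].
- move=> j hj.
  have [j1 j2 j3] : [/\ j != 1, j != 2 & j != 3] by split; lia.
  rewrite /u8 mem_updE ifN // /u7 mem_updE ifN // /u6 mem_updE ifN // /u5 mem_updE ifN //.
  rewrite /u4 mem_updE ifN // /u3 mem_updE ub; case: eqP => _; last first.
    by rewrite /u2 mem_updE ifN // /u1 mem_updE ifN.
  rewrite /u2 mem_updE eqxx /u1 !mem_updE (negbTE a3) ifN //; lia.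
Qed.

Lemma copy_loop P p a b base (J : nat -> memory -> Prop) :
  code_at P p (copy_code p a b) ->
  (a == 1) || (a == 2) -> (b == 1) || (b == 2) ->
  (forall k m, J k m -> [/\ m 0 = base, m 1 = k, 3 < m a & 3 < m b]) ->
  (forall k m m', k < base -> J k m -> m' 0 = base -> m' 1 = k.+1 -> m' 2 = m 2 + 64 ->
     (forall j, 3 < j -> m' j = if j == m b then m (m a) else m j) -> J k.+1 m') ->
  forall k m, k <= base -> J k m -> exists m',
    reach P (p, m) (10 * (base - k) + 2) (p + 10, mem_upd m' 3 0) /\ J base m'.
Proof.
move=> hc ha hb J1 J2 k m kb.
rewrite -{1}(subKn kb); move: (base - k) (leq_subr k base) => q hq.
elim: q m hq => [|q IH] m hq.
  rewrite subn0 => hJ; exists m; split=> //; have [m0 m1 _ _] := J1 _ _ hJ.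
  exists 2 => //=.
  have s0 : ram_step P (p, m) = Some (p.+1, mem_upd m 3 0).
    by rewrite /ram_step -{1}[p]addn0 hc //= m0 m1 subnn.
  have s1 : ram_step P (p.+1, mem_upd m 3 0) = Some (p + 10, mem_upd m 3 0).
    by rewrite /ram_step -{1}addn1 hc //= mem_updE eqxx.
  by rewrite s0 /= s1.
move=> hJ; have [m0 m1 ma mb] := J1 _ _ hJ.
have kb' : m 1 < base by rewrite m1; lia.
have [m' [h1 e0 e1 e2 e3]] := copy_step hc ha hb m0 kb' ma mb.
have hJ' : J (base - q) m'.
  have -> : base - q = (base - q.+1).+1 by lia.
  by apply: (J2 _ m) => //; [lia | rewrite e1 m1].
have [m'' [h2 h3]] := IH m' (ltnW hq) hJ'.
exists m''; split=> //; apply: reach_le (reach_trans h1 h2); lia.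
Qed.

Section Machine.
Variables (G : finZmodType) (elt : 'I_#|G| -> G) (lab : G -> 'I_#|G|) (S : seq G).
Hypotheses (eltK : cancel elt lab) (labK : cancel lab elt).
Local Notation n := #|G|.
Local Notation d := (size S).
Local Notation inp := (encode_input elt lab S).

Definition base := n * n + d + 64.

Lemma size_inp : size inp <= base.
Proof.
rewrite /encode_input /= size_cat size_allpairs size_enum_ord size_map /base.
by rewrite -[X in X <= _]addn2 leq_add2l.
Qed.

Definition stored K (m : memory) : Prop := forall j, base <= j ->
  m j = if ((j - base) %% 64 == 0) && ((j - base) %/ 64 < K)
        then nth 0 inp ((j - base) %/ 64) else 0.

Lemma stored_ext K m m' : (forall j, base <= j -> m' j = m j) -> stored K m -> stored K m'.
Proof. by move=> h hs j hj; rewrite h // hs. Qed.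

Lemma stored_next K m m' : stored K m ->
  (forall j, base <= j -> m' j = if j == base + 64 * K then nth 0 inp K else m j) ->
  stored K.+1 m'.
Proof.
move=> hs h j hj; rewrite h // hs //; case: eqP => [->|ne].
  by rewrite addKn modnMr mulKn // ltnS leqnn.
case: (altP ((j - base) %% 64 =P 0)) => //= e.
have : (j - base) %/ 64 != K.
  apply/eqP => eK; apply: ne; rewrite -(subnKC hj) (divn_eq (j - base) 64) e eK; lia.
by rewrite ltnS [in RHS]leq_eqVlt => /negbTE ->.
Qed.

Lemma stored_rep m : m 0 = base -> stored base m -> rep base (input_store elt lab S) m.
Proof.
move=> m0 hs; split=> // a i ha; rewrite -addnA hs ?leq_addr // addKn /input_store.
have -> : (64 * i + a) %% 64 = a by rewrite mulnC modnMDl modn_small.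
have -> : (64 * i + a) %/ 64 = i by rewrite mulnC divnMDl // divn_small // addn0.
case: eqP => //= _; case: ltnP => // h; rewrite nth_default //.
exact: leq_trans size_inp h.
Qed.

Hypothesis n4 : 4 <= n.

Lemma inp_comm t : t < n -> nth 0 inp (2 + t * n) = nth 0 inp (2 + t).
Proof.
move=> tn; have n0 : 0 < n by lia.
have := inp_table elt lab S (Ordinal tn) (Ordinal n0).
have := inp_table elt lab S (Ordinal n0) (Ordinal tn).
by rewrite /= mul0n !addn0 addrC => -> ->.
Qed.

Lemma square_reach P mi : code_at P 6 square ->
  (forall j, (j < 3) || (5 < j) -> mi j = nth 0 inp j) -> exists m,
  [/\ reach P (6, mi) (6 * n + 2) (14, m), m 3 = n * n &
   forall j, (j < 3) || (5 < j) -> m j = nth 0 inp j].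
Proof.
move=> hc hmi; have h i : i < 8 -> nth IHalt P (6 + i) = nth IHalt square i by exact: hc.
pose m1 := mem_upd mi 3 0; pose m2 := mem_upd m1 4 (m1 0 + m1 3).
have start : reach P (6, mi) 2 (8, m2).
  exists 2 => //=; have s0 : ram_step P (6, mi) = Some (7, m1) by rewrite /ram_step (h 0).
  by rewrite s0 /= /ram_step (h 1).
suff loop i m : i < n -> m 3 = i * n -> m 4 = n - i ->
   (forall j, (j < 3) || (5 < j) -> m j = nth 0 inp j) ->
   exists m', [/\ reach P (8, m) (6 * (n - i)) (14, m'), m' 3 = n * n &
   forall j, (j < 3) || (5 < j) -> m' j = nth 0 inp j].
  have [||||m' [q1 q2 q3]] := loop 0 m2 _ _ _ _.
  - by lia.
  - by [].
  - by rewrite /m2 mem_updE -[m1 3]/0 -[m1 0]/(mi 0) addn0 subn0 hmi.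
  - by move=> j hj; rewrite /m2 mem_updE ifN /m1 ?mem_updE ?ifN ?hmi //; lia.
  - exists m'; split=> //; apply: reach_le (reach_trans start q1); lia.
move=> hi; move e : (n - i) => q; elim: q i hi e m => [|q IH] i hi e m m3 m4 hm; first by lia.
pose u1 := mem_upd m 3 (m 3 + m 0); pose u2 := mem_upd u1 5 1.
pose u3 := mem_upd u2 4 (u2 4 - u2 5); pose u4 := mem_upd u3 5 0.
have m0 : m 0 = n by rewrite hm.
have s0 : ram_step P (8, m) = Some (9, u1) by rewrite /ram_step (h 2).
have s1 : ram_step P (9, u1) = Some (10, u2) by rewrite /ram_step (h 3).
have s2 : ram_step P (10, u2) = Some (11, u3) by rewrite /ram_step (h 4).
have e3 : u3 3 = i.+1 * n by rewrite /u3 /u2 /u1 !mem_updE /= m3 m0 mulSn addnC.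
have e4 : u3 4 = q by rewrite /u3 mem_updE /= /u2 /u1 !mem_updE /= m4; lia.
have ej j : (j < 3) || (5 < j) -> u3 j = nth 0 inp j.
  by move=> hj; rewrite /u3 /u2 /u1 !mem_updE !ifN ?hm //; lia.
case: (posnP q) => q0.
  have s3 : ram_step P (11, u3) = Some (14, u3) by rewrite /ram_step (h 5) //= e4 q0.
  exists u3; split=> //.
    by exists 4; [lia | rewrite /= s0 /= s1 /= s2 /= s3].
  by rewrite e3; congr (_ * _); lia.
have s3 : ram_step P (11, u3) = Some (12, u3).
  by rewrite /ram_step (h 5) //= e4 gtn_eqF.
have s4 : ram_step P (12, u3) = Some (13, u4) by rewrite /ram_step (h 6).
have s5 : ram_step P (13, u4) = Some (8, u4) by rewrite /ram_step (h 7).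
have [|||||m' [q1 q2 q3]] := IH i.+1 _ _ u4 _ _ _.
- by lia.
- by lia.
- by rewrite /u4 mem_updE /= e3.
- by rewrite /u4 mem_updE /= e4.
- by move=> j hj; rewrite /u4 mem_updE ifN ?ej //; lia.
exists m'; split=> //; rewrite mulnS; apply: reach_trans q1.
by exists 6 => //; rewrite /= s0 /= s1 /= s2 /= s3 /= s4 /= s5.
Qed.

Definition Pre k (m : memory) : Prop :=
  [/\ m 0 = n, m 1 = d, m 2 = nth 0 inp 2, m 3 = base + 64 * k & m 4 = 64] /\
  (forall j, 6 <= j < base -> m j = nth 0 inp j) /\ stored k m.

Lemma base_gt : 64 <= base. Proof. exact: leq_addl. Qed.

Lemma passP k r m : Pre k m -> (r != 3) && (r != 4) -> m r = nth 0 inp k ->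
  Pre k.+1 (srun (pass r) m).
Proof.
move=> [[m0 m1 m2 m3 m4] [mr ms]] /andP[r3 r4] hr.
have bg := base_gt.
pose u := mem_upd m (m 3) (m r).
have hu j : j < base -> u j = m j by move=> hj; rewrite /u mem_updE ifN // m3; lia.
rewrite -[srun _ _]/(mem_upd u 3 (u 3 + u 4)); set w := mem_upd u _ _.
have w3 : w 3 = base + 64 * k.+1 by rewrite /w mem_updE eqxx !hu ?m3 ?m4; lia.
have hw j : j != 3 -> w j = u j by move=> hj; rewrite /w mem_updE ifN.
split.
  by rewrite w3 !hw // !hu ?m0 ?m1 ?m2 ?m4 //; lia.
split; first by move=> j /andP[h1 h2]; rewrite hw ?hu ?mr ?h1 //; lia.
apply: (stored_next ms) => j hj; rewrite hw; last by lia.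
by rewrite /u mem_updE m3 hr.
Qed.

Lemma fetchP k t m : Pre k m -> 0 < t < 4 ->
  Pre k (srun (fetch t) m) /\ srun (fetch t) m 5 = nth 0 inp (2 + t).
Proof.
move=> hP ht; have [[m0 m1 m2 m3 m4] [mr ms]] := hP; have bg := base_gt.
rewrite /fetch -cat1s !srun_cat.
have aux q (w : memory) : (forall j, j != 5 -> w j = m j) ->
   let w' := srun (nseq q (IAdd 5 5 0)) w in
   w' 5 = w 5 + q * n /\ forall j, j != 5 -> w' j = m j.
  elim: q w => [|q IH] w hw /=; first by rewrite addn0.
  have [|a1 a2] := IH (mem_upd w 5 (w 5 + w 0)).
    by move=> j hj; rewrite mem_updE ifN ?hw.
  by split=> //; rewrite a1 mem_updE /= (hw 0) // m0 mulSn addnA.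
have [|a1 a2] := aux t (srun [:: IConst 5 2] m).
  by move=> j hj; rewrite /= mem_updE ifN.
move: (srun (nseq t _) _) a1 a2 => w a1 a2; rewrite /=.
have {}a1 : w 5 = 2 + t * n by rewrite a1.
have h6 : 6 <= 2 + t * n < base.
  rewrite /base; apply/andP; split; first by have : 1 * 4 <= t * n; [apply: leq_mul; lia | lia].
  have : t * n <= n * n by rewrite leq_mul2r; apply/orP; right; lia.
  by lia.
have hv : w (w 5) = nth 0 inp (2 + t).
  by rewrite a1 a2 ?mr // ?inp_comm //; lia.
split; last by rewrite mem_updE /= hv.
have hx j : j != 5 -> mem_upd w 5 (w (w 5)) j = m j.
  by move=> hj; rewrite mem_updE ifN // a2.
split; first by rewrite !hx.
split; first by move=> j hj; rewrite hx ?mr //; lia.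
by apply: stored_ext ms => j hj; rewrite hx //; lia.
Qed.

Lemma passesP st len m : 6 <= st -> st + len <= 64 -> Pre st m ->
  Pre (st + len) (srun (flatten [seq pass r | r <- iota st len]) m).
Proof.
elim: len st m => [|len IH] st m h1 h2 hP; first by rewrite addn0.
have -> : flatten [seq pass r | r <- iota st len.+1] =
  pass st ++ flatten [seq pass r | r <- iota st.+1 len] by [].
rewrite srun_cat addnS -addSn.
apply: IH; [lia | lia |]; apply: passP => //; first by lia.
by case: hP => _ [hr _]; apply: hr; have := base_gt; lia.
Qed.

Definition Loading k (m : memory) : Prop :=
  [/\ m 0 = base, m 1 = k, m 2 = base + 64 * k & 32 <= k] /\
  (forall j, 32 <= j < base -> m j = nth 0 inp j) /\ stored k m.

Lemma relocateP m : m 3 = n * n -> (forall j, (j < 3) || (5 < j) -> m j = nth 0 inp j) ->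
  Loading 32 (srun relocate m).
Proof.
move=> m3 hm; have bg := base_gt.
pose u0 := srun [:: IAdd 3 3 1; IConst 4 64; IAdd 3 3 4] m.
pose u1 := srun (pass 0) u0; pose u2 := srun (pass 1) u1; pose u3 := srun (pass 2) u2.
pose u4 := srun (pass 5) (srun (fetch 1) u3).
pose u5 := srun (pass 5) (srun (fetch 2) u4).
pose u6 := srun (pass 5) (srun (fetch 3) u5).
have -> : srun relocate m =
  srun [:: IConst 4 (64 * 32); ISub 0 3 4; IConst 1 32; IConst 2 0; IAdd 2 2 3]
   (srun (flatten [seq pass r | r <- iota 6 26]) u6) by rewrite /relocate !srun_cat.
have P0 : Pre 0 u0.
  pose a1 := mem_upd m 3 (m 3 + m 1); pose a2 := mem_upd a1 4 64.
  have -> : u0 = mem_upd a2 3 (a2 3 + a2 4) by [].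
  set w := mem_upd a2 3 _.
  have h j : (j < 3) || (5 < j) -> w j = nth 0 inp j.
    by move=> hj; rewrite /w mem_updE ifN /a2 ?mem_updE ?ifN /a1 ?mem_updE ?ifN ?hm //; lia.
  split.
    rewrite (h 0) // (h 1) // (h 2) // /w !mem_updE /=; split=> //.
    by rewrite /a2 /a1 !mem_updE /= m3 hm // muln0 addn0.
  split; first by move=> j hj; rewrite h //; lia.
  move=> j hj; rewrite ltn0 andbF h; last by lia.
  by rewrite nth_default //; exact: leq_trans size_inp hj.
have P1 : Pre 1 u1 by apply: passP => //; case: P0 => -[].
have P2 : Pre 2 u2 by apply: passP => //; case: P1 => -[].
have P3 : Pre 3 u3 by apply: passP => //; case: P2 => -[].
have [P3' e3] := fetchP P3 (isT : 0 < 1 < 4).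
have P4 : Pre 4 u4 := passP (r := 5) P3' isT e3.
have [P4' e4] := fetchP P4 (isT : 0 < 2 < 4).
have P5 : Pre 5 u5 := passP (r := 5) P4' isT e4.
have [P5' e5] := fetchP P5 (isT : 0 < 3 < 4).
have P6 : Pre 6 u6 := passP (r := 5) P5' isT e5.
have P7 := @passesP 6 26 u6 isT isT P6; rewrite -[6 + 26]/32 in P7.
move: (srun (flatten _) u6) P7 => w [[w0 w1 w2 w3 w4] [wr ws]].
pose v1 := mem_upd w 4 (64 * 32); pose v2 := mem_upd v1 0 (v1 3 - v1 4).
pose v3 := mem_upd v2 1 32; pose v4 := mem_upd v3 2 0.
rewrite -[srun _ w]/(mem_upd v4 2 (v4 2 + v4 3)); set v := mem_upd v4 _ _.
have hv j : (2 < j) && (j != 4) -> v j = w j.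
  move=> hj; rewrite /v mem_updE ifN; last by lia.
  rewrite /v4 mem_updE ifN; last by lia.
  rewrite /v3 mem_updE ifN; last by lia.
  rewrite /v2 mem_updE ifN; last by lia.
  by rewrite /v1 mem_updE ifN //; lia.
have e43 : v4 3 = base + 64 * 32 by rewrite -w3.
have v0 : v 0 = base.
  by rewrite -[v 0]/(w 3 - 64 * 32) w3 addnK.
split; first by split=> //; rewrite -[v 2]/(v4 2 + v4 3) e43.
split; first by move=> j hj; rewrite hv ?wr //; lia.
by apply: stored_ext ws => j hj; rewrite hv //; lia.
Qed.

Lemma prelude_reach P : code_at P 0 prelude -> exists m,
  reach P (0, nth 0 inp) (20 * base + 100) (size prelude, m) /\
  rep base (input_store elt lab S) m.
Proof.
move=> hc; have bg := base_gt.
have [] : code_at P 0 (guard ++ square ++ relocate) /\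
   code_at P (size (guard ++ square ++ relocate))
     (copy_code (size (guard ++ square ++ relocate)) 1 2) by exact: code_at_cat hc.
set p := size _ => h1 hcopy.
case/code_at_cat: h1 => hg; rewrite add0n => /code_at_cat[hs hr].
have h i : i < 6 -> nth IHalt P i = nth IHalt guard i by move=> hi; rewrite -hg.
pose u1 := mem_upd (nth 0 inp) 3 4; pose u2 := mem_upd u1 3 (u1 3 - u1 0).
have r0 : reach P (0, nth 0 inp) 3 (6, u2).
  have e : u2 3 = 0 by rewrite -[u2 3]/(4 - n); apply/eqP; rewrite subn_eq0.
  have q0 : ram_step P (0, nth 0 inp) = Some (1, u1) by rewrite /ram_step h.
  have q1 : ram_step P (1, u1) = Some (2, u2) by rewrite /ram_step h.
  have q2 : ram_step P (2, u2) = Some (6, u2) by rewrite /ram_step h //= e.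
  by exists 3 => //; rewrite /= q0 /= q1 /= q2.
have hu2 j : (j < 3) || (5 < j) -> u2 j = nth 0 inp j.
  by move=> hj; rewrite /u2 mem_updE ifN /u1 ?mem_updE ?ifN //; lia.
have [m1 [r1 e1 hm1]] := square_reach hs hu2.
have hL := relocateP e1 hm1.
have r2 := srun_reach m1 (isT : all straight relocate) hr.
have [|||m2 [r3 hm2]] := @copy_loop P p 1 2 base Loading hcopy isT isT _ _ 32 _ _ hL.
- move=> k m [[m_0 m_1 m_2 k32] _]; split=> //; first by rewrite m_1; lia.
  by rewrite m_2; lia.
- move=> k m m' kb [[a0 a1 a2 k32] [ar ast]] b0 b1 b2 bj.
  split; first by split=> //; [rewrite b2 a2; lia | lia].
  rewrite a1 a2 in bj.
  split=> [j /andP[j1 j2]|].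
    by rewrite bj; [rewrite ifN ?ar ?j1 //; lia | lia].
  apply: (stored_next ast) => j hj; rewrite bj; last by lia.
  by rewrite ar // k32 kb.
- by lia.
exists (mem_upd m2 3 0); split.
  have -> : size prelude = p + 10 by [].
  apply: reach_le (reach_trans r0 (reach_trans r1 (reach_trans r2 r3))).
  have -> : size relocate = 84 by [].
  have : n <= n * n by rewrite leq_pmulr //; lia.
  rewrite /base; move: (n * n) (size S) => u v; lia.
case: hm2 => [[a0 _ _ _] [_ ast]]; apply: stored_rep; first by rewrite mem_updE.
by apply: stored_ext ast => j hj; rewrite mem_updE ifN //; lia.
Qed.

Definition Unloading (s : store) k (m : memory) : Prop :=
  [/\ m 0 = base, m 1 = k, m 2 = base + (64 * k.-1 + aOUT) & 32 <= k] /\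
  (forall j, 32 <= j < k -> m j = s aOUT j.-1) /\
  (forall a i, a < 64 -> m (base + 64 * i + a) = s a i).

Definition Emitting (s : store) k (m : memory) : Prop :=
  [/\ m 0 = base, forall j, 0 < j < k -> m j = s aOUT j.-1,
     forall j, 32 <= j < base -> m j = s aOUT j.-1 &
     forall a i, a < 64 -> m (base + 64 * i + a) = s a i].

Lemma emitP s k m : 0 < k < 32 -> Emitting s k m -> Emitting s k.+1 (srun (emit k) m).
Proof.
move=> hk [m0 m1 m2 m3]; have bg := base_gt.
pose u1 := mem_upd m k (64 * k.-1 + aOUT); pose u2 := mem_upd u1 k (u1 k + u1 0).
rewrite -[srun _ m]/(mem_upd u2 k (u2 (u2 k))).
have hu j : j != k -> u2 j = m j by move=> hj; rewrite /u2 mem_updE ifN // /u1 mem_updE ifN.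
have uk : u2 (u2 k) = s aOUT k.-1.
  have -> : u2 k = base + 64 * k.-1 + aOUT.
    rewrite /u2 mem_updE eqxx /u1 mem_updE eqxx mem_updE ifN ?m0; last by lia.
    by rewrite addnC addnA.
  by rewrite hu ?m3 //; lia.
split.
- by rewrite mem_updE ifN ?hu //; lia.
- move=> j /andP[j0]; rewrite ltnS leq_eqVlt mem_updE => /orP[/eqP->|jk]; first by rewrite eqxx uk.
  by rewrite ifN ?hu ?m1 ?j0 //; lia.
- by move=> j hj; rewrite mem_updE ifN ?hu ?m2 //; lia.
- by move=> a i ha; rewrite mem_updE ifN ?hu ?m3 //; lia.
Qed.

Lemma emitsP s len st m : 0 < st -> st + len <= 32 -> Emitting s st m ->
  Emitting s (st + len) (srun (flatten [seq emit k | k <- iota st len]) m).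
Proof.
elim: len st m => [|len IH] st m h1 h2 hP; first by rewrite addn0.
have -> : flatten [seq emit r | r <- iota st len.+1] =
  emit st ++ flatten [seq emit r | r <- iota st.+1 len] by [].
by rewrite srun_cat addnS -addSn; apply: IH; [lia | lia | apply: emitP => //; lia].
Qed.

Lemma epilogue_reach P p s m : code_at P p (epilogue p) -> rep base s m -> s aIN 0 = n ->
  exists x, [/\ reach P (p, m) (10 * base + 200) x, ram_step P x = None &
    ram_output x = [seq s aOUT i.-1 | i <- iota 1 n]].
Proof.
move=> hc [m0 mr] sn; have bg := base_gt.
have [h1 hc1] := code_at_cat hc; have [h2 hc2] := code_at_cat hc1.
have [h3 /code_at_cons[h4 /code_at_cons[h5 _]]] := code_at_cat hc2.
set l1 := [:: _; _; _] in h1 h2 hc1 hc2 h3 h4 h5.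
set l3 := flatten _ in h3 h4 h5.
have e1 : size l1 = 3 by []. rewrite e1 in h2 h3 h4 h5.
have e2 : size (copy_code (p + 3) 2 1) = 10 by []. rewrite e2 in h3 h4 h5.
have r1 := srun_reach m (isT : all straight l1) h1; rewrite e1 in r1.
have hU : Unloading s 32 (srun l1 m).
  pose u1 := mem_upd m 1 32; pose u2 := mem_upd u1 2 (64 * 31 + aOUT).
  rewrite -[srun _ m]/(mem_upd u2 2 (u2 2 + u2 0)); set u := mem_upd _ _ _.
  have hu j : 2 < j -> u j = m j.
    by move=> hj; rewrite /u /u2 /u1 !mem_updE !ifN //; lia.
  split; first split=> //.
  - by rewrite -[u 2]/(64 * 31 + aOUT + m 0) m0 addnC.
  - split; first by move=> j; lia.
    by move=> a i ha; rewrite hu ?mr //; lia.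
have [|||m2 [r3 [[a0 _ _ _] [aj ar]]]] :=
  @copy_loop P (p + 3) 2 1 base (Unloading s) h2 isT isT _ _ 32 _ _ hU.
- move=> k w [[w0 w1 w2 k32] _]; split=> //; last by rewrite w1; lia.
  by rewrite w2; lia.
- move=> k w w' kb [[w0 w1 w2 k32] [wj wr]] b0 b1 b2 bj.
  rewrite w1 w2 in bj; split; first by split=> //; [rewrite b2 w2; lia | lia].
  split=> [j /andP[j1 j2]|a i ha].
    rewrite bj; last by lia.
    case: eqP => [->|jk]; first by rewrite addnA wr.
    by rewrite wj // j1 /=; lia.
  by rewrite bj; [rewrite ifN ?wr //; lia | lia].
- by lia.
set m3 := mem_upd m2 3 0 in r3.
have hE : Emitting s 1 m3.
  split; first by rewrite /m3 mem_updE.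
  - by move=> j; lia.
  - by move=> j hj; rewrite /m3 mem_updE ifN ?aj //; lia.
  - by move=> a i ha; rewrite /m3 mem_updE ifN ?ar //; lia.
have hs : all straight l3 by [].
have r4 := srun_reach m3 hs h3.
have [] := @emitsP s 31 1 m3 isT isT hE; rewrite -/l3 -[1 + 31]/32.
move: (srun l3 m3) r4 => m4 r4 q0 q1 q2 q3.
pose m5 := mem_upd m4 0 (m4 (m4 0)).
have r5 : reach P (p + 3 + 10 + size l3, m4) 1 ((p + 3 + 10 + size l3).+1, m5).
  by apply: reach1; rewrite /ram_step h4.
exists ((p + 3 + 10 + size l3).+1, m5); split.
- apply: reach_le (reach_trans r1 (reach_trans r3 (reach_trans r4 r5))).
  have -> : size l3 = 93 by [].
  by lia.
- by rewrite /ram_step h5.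
- rewrite /ram_output [LHS]/=.
  have -> : m5 0 = n.
    rewrite -[m5 0]/(m4 (m4 0)) q0 -sn -(q3 0 0 isT).
    by rewrite muln0 !addn0.
  apply/eq_in_map => i; rewrite mem_iota => /andP[i1 i2].
  have ib : i < base.
    have : n <= n * n by rewrite leq_pmulr //; lia.
    rewrite /base; move: (n * n) (size S) i2 => u v; lia.
  rewrite -[m5 i]/(mem_upd m4 0 (m4 (m4 0)) i) mem_updE ifN; last by lia.
  by case: (ltnP i 32) => hi; [apply: q1 | apply: q2]; lia.
Qed.

End Machine.

(** * Correctness of the machine *)

Lemma code_at_mid l1 l l2 : code_at (l1 ++ l ++ l2) (size l1) l.
Proof. by move=> i hi; rewrite !nth_cat ltnNge leq_addr /= addKn hi. Qed.

Section Machine.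
Variables (G : finZmodType) (elt : 'I_#|G| -> G) (lab : G -> 'I_#|G|) (S : seq G).
Hypotheses (eltK : cancel elt lab) (labK : cancel lab elt).
Hypotheses (S_sym : symmetric_mset S) (n2 : 2 <= #|G|) (d1 : 0 < size S).
Local Notation n := #|G|.
Local Notation d := (size S).
Local Notation b := (cay_boundary S).
Local Notation inp := (encode_input elt lab S).

Definition sparse_output (Q : {set G}) : Prop :=
  adm Q /\ forall T, adm T -> b Q * #|T| <= 10 * (b T * #|Q|).

Lemma base_scale : base S <= scale S.
Proof.
have [[_ _ _ _ _] [h _ _]] := scale_ge n2 d1; apply: leq_trans (ltnW h).
rewrite /base /height; set a := 2 * _.
have wn : n * 1 <= n * d by rewrite leq_mul2l d1 orbT.
have wd : 1 * d <= n * d by rewrite leq_mul2r (ltnW n2) orbT.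
have an : n.+1 <= a by rewrite /a /lam_bound; lia.
have ad : d + 64 <= a by rewrite /a /lam_bound; lia.
rewrite -addnA expnS expn1; apply: (@leq_trans (a * n + a)).
  by apply: leq_add => //; rewrite leq_mul2r (ltnW an) orbT.
by rewrite -mulnSr leq_mul2l an orbT.
Qed.

Definition time_factor := overhead Whole + 400.

Lemma machine_small : n < 4 -> exists t out,
  [/\ ram_runs machine inp t out, t <= time_factor * scale S ^ 7 &
      sparse_output (decode_output lab out)].
Proof.
move=> n4; have [[x0 _ _ _ _] _] := scale_ge n2 d1.
exists 5, [:: 0]; split.
- have h i : i < 6 -> nth IHalt machine i = nth IHalt guard i.
    by case: i => [|[|[|[|[|[|]]]]]].
  move: machine h => P h.
  pose u1 := mem_upd (nth 0 inp) 3 4; pose u2 := mem_upd u1 3 (u1 3 - u1 0).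
  pose u3 := mem_upd u2 0 1; pose u4 := mem_upd u3 1 0.
  have e : u2 3 = 4 - n by [].
  exists (5, u4); split; last by split=> //; rewrite /ram_step h.
  have q0 : ram_step P (0, nth 0 inp) = Some (1, u1) by rewrite /ram_step h.
  have q1 : ram_step P (1, u1) = Some (2, u2) by rewrite /ram_step h.
  have q2 : ram_step P (2, u2) = Some (3, u2).
    by rewrite /ram_step h //= e ifN // subn_eq0 -ltnNge.
  have q3 : ram_step P (3, u2) = Some (4, u3) by rewrite /ram_step h.
  have q4 : ram_step P (4, u3) = Some (5, u4) by rewrite /ram_step h.
  rewrite -[ram_init _]/(0, nth 0 inp); move: (0, nth 0 inp) q0 => z q0.
  by rewrite /= q0 /= q1 /= q2 /= q3 /= q4.
- have : 0 < scale S ^ 7 by rewrite expn_gt0 x0.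
  rewrite /time_factor; move: (overhead Whole) (scale S ^ 7) => u v; nia.
- have n0 : 0 < n by exact: ltnW.
  pose x := elt (Ordinal n0).
  have eQ : decode_output lab [:: 0] = [set x].
    apply/setP => y; rewrite !inE; apply/eqP/eqP => [e|->]; last by rewrite eltK.
    by apply: (can_inj labK); apply: val_inj; rewrite eltK.
  rewrite eQ; split; first by rewrite /adm cards1 muln1.
  move=> T /andP[T0 T2]; have /cards1P[y ->] : #|T| == 1.
    by move: T0 T2 n4; move: #|T| #|G| => u v; lia.
  have -> : [set y] = shift (y - x)%R [set x].
    by apply/setP => z; rewrite !inE subr_eq addrC subrK.
  rewrite boundary_shift card_shift cards1; lia.
Qed.

Lemma decode_final (Q : {set G}) (s : store) :
  (forall x, s aOUT (lab x) = if x \in Q then nat_of_ord (lab x) else n) ->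
  decode_output lab [seq s aOUT i.-1 | i <- iota 1 n] = Q.
Proof.
move=> h; apply/setP => x; rewrite inE; apply/mapP/idP => [[i]|hx].
  rewrite mem_iota => /andP[i1 i2] e.
  have hi : i.-1 < n by lia.
  pose y := elt (Ordinal hi); have yi : lab y = i.-1 :> nat by rewrite eltK.
  have := h y; rewrite yi -e; case: ifP => [hy exy|_ en].
    suff -> : x = y by [].
    by apply: (can_inj labK); apply: val_inj; rewrite /= exy yi.
  by have := ltn_ord (lab x); rewrite en ltnn.
exists (lab x).+1; last by rewrite /= h hx.
by rewrite mem_iota /= add1n ltnS ltn_ord.
Qed.

Theorem machine_correct : exists t out,
  [/\ ram_runs machine inp t out, t <= time_factor * scale S ^ 7 &
      sparse_output (decode_output lab out)].
Proof.
case: (ltnP n 4) => [|n4]; first exact: machine_small.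
have [[x0 _ _ _ _] _] := scale_ge n2 d1.
have hbs := base_scale.
rewrite /machine; set l1 := prelude; set l2 := compile _ 1 Whole.
set l3 := epilogue _; set P := l1 ++ l2 ++ l3.
have c1 := @code_at_mid [::] l1 (l2 ++ l3); rewrite cat0s -/P in c1.
have c2 := @code_at_mid l1 l2 l3; rewrite -/P in c2.
have c3 : code_at P (size (l1 ++ l2)) l3.
  by have := @code_at_mid (l1 ++ l2) l3 [::]; rewrite cats0 -catA -/P.
have [m1 [r1 rep1]] := @prelude_reach G elt lab S n4 P c1.
have bg := base_gt S.
have hw : 1 + cwid Whole <= base S by apply: leq_trans bg; have := cwid_Whole; lia.
have [m2 [r2 rep2 _]] := compP c2 isT hw cok_Whole rep1.
rewrite exec_Whole in rep2.
have [s0 [Q [hQ aQ oQ]]] := final_correct eltK labK S_sym n2 d1.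
rewrite -/l2 -size_cat in r2.
have [x [r3 hx ox]] := epilogue_reach n4 c3 rep2 s0.
have [t ht et] := reach_trans r1 (reach_trans r2 r3).
exists t, [seq s_final elt lab S aOUT i.-1 | i <- iota 1 n]; split.
- by exists x.
- apply: leq_trans ht _; have hc := whole_cost eltK labK n2 d1.
  have h7 : scale S <= scale S ^ 7 by rewrite -{1}[scale S]expn1 leq_pexp2l.
  rewrite /time_factor mulnDl.
  move: (cost Whole _) (overhead Whole) (scale S ^ 7) hc h7 => u q w hc h7.
  by move: (q * w) hc => v hc; clear -hc h7 hbs x0; lia.
- by rewrite (decode_final hQ).
Qed.

End Machine.

(** * The running time *)

Lemma cell_bound_pow c e : 1 < e -> (2 ^ c * e ^ 4) ^ e <= e ^ ((c + 4) * e).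
Proof.
move=> e1; have e0 : 0 < e by exact: ltnW.
rewrite expnM leq_exp2r // expnD leq_mul2r; apply/orP; right.
by case: c => [|c] //; rewrite leq_exp2r.
Qed.

(* Exponent of 2 in the running time. *)
Definition load (F e : nat) : nat := F + 140 + 14 * e + 7 * cell_bound e.

Lemma load_pow F e : 1 < e -> load F e <= e ^ ((F + 189) * e).
Proof.
move=> e1; have e0 : 0 < e by exact: ltnW.
have := cell_bound_pow 17 e1; rewrite -[17 + 4]/21 => h.
have ee : e <= e ^ (21 * e).
  by rewrite -{1}[e]expn1 leq_pexp2l // muln_gt0 e0.
have p0 : 0 < e ^ (21 * e) by rewrite expn_gt0 e0.
have h1 : load F e <= (F + 168) * e ^ (21 * e).
  rewrite /load /cell_bound; move: ((2 ^ 17 * e ^ 4) ^ e) (e ^ (21 * e)) h ee p0 => u v h ee p0.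
  have : F <= F * v by rewrite leq_pmulr.
  by rewrite mulnDl; lia.
apply: leq_trans h1 _.
have -> : (F + 189) * e = (F + 168) * e + 21 * e by rewrite -mulnDl -addnA.
rewrite expnD leq_mul2r; apply/orP; right.
apply: leq_trans (ltnW (ltn_expl _ e1)) _.
by rewrite leq_pexp2l // leq_pmulr.
Qed.

Lemma time_bound (G : finZmodType) (S : seq G) F : 1 < #|G| -> 0 < size S ->
  F * scale S ^ 7 <= #|G| ^ (14 + load F 1) * 2 ^ (size S ^ ((F + 189) * size S)).
Proof.
move=> n2 d0; set n := #|G| in n2 *; set d := size S in d0 *.
have key : F * scale S ^ 7 <= n ^ 14 * 2 ^ load F d.
  have hh : (height S).+1 <= 2 ^ 20 * (n * d) ^ 2.
    rewrite /height /lam_bound -/n -/d.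
    have w0 : 0 < n * d by rewrite muln_gt0 d0 ltnW.
    apply: (@leq_trans ((2 ^ 10 * (n * d)) ^ 2)); last by rewrite expnMn -expnM.
    rewrite ltn_exp2r // mulnA ltn_mul2r w0 //.
  have hX : scale S <= 2 ^ cell_bound d * (2 ^ 20 * (n * d) ^ 2).
    by rewrite /scale leq_mul2l hh orbT.
  have hd : d ^ 14 <= 2 ^ (14 * d).
    by rewrite [14 * d]mulnC expnM leq_exp2r // ltnW // ltn_expl.
  apply: (@leq_trans (2 ^ F * (2 ^ cell_bound d * (2 ^ 20 * (n * d) ^ 2)) ^ 7)).
    by rewrite leq_mul ?leq_exp2r // ltnW // ltn_expl.
  have -> : (2 ^ cell_bound d * (2 ^ 20 * (n * d) ^ 2)) ^ 7 =
      2 ^ (7 * cell_bound d) * (2 ^ 140 * (n ^ 14 * d ^ 14)).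
    rewrite (expnMn _ _ 7) (expnMn _ _ 7) (expnMn n d 2) (expnMn _ _ 7).
    by rewrite -(expnM 2 (cell_bound d)) -(expnM 2 20) -(expnM n) -(expnM d) (mulnC 7).
  rewrite /load (expnD 2 (F + 140 + 14 * d)) (expnD 2 (F + 140)) (expnD 2 F).
  move: (2 ^ F) (2 ^ (7 * cell_bound d)) (2 ^ 140) (n ^ 14) (d ^ 14) (2 ^ (14 * d)) hd.
  move=> u v w x y z hd.
  have -> : u * (v * (w * (x * y))) = u * v * w * x * y by rewrite !mulnA.
  have -> : x * (u * w * z * v) = u * v * w * x * z.
    by nia.
  by rewrite leq_mul2l hd orbT.
apply: leq_trans key _.
case: (ltnP 1 d) => [d1|d1].
  rewrite leq_mul ?leq_pexp2l ?leq_addr ?load_pow //; exact: ltnW.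
have -> : d = 1 by apply/eqP; rewrite eqn_leq d1.
rewrite expnD -mulnA leq_mul2l; apply/orP; right.
apply: (@leq_trans (n ^ load F 1)); first by rewrite leq_exp2r ?leq_addr // /load; lia.
by rewrite leq_pmulr // expn_gt0.
Qed.

Local Open Scope R_scope.

Lemma INR_expn m k : INR (m ^ k)%N = INR m ^ k.
Proof. by elim: k => //= k IH; rewrite expnS mult_INR IH. Qed.

Lemma INR_leq m k : (m <= k)%N -> INR m <= INR k.
Proof. by move/leP; exact: le_INR. Qed.

Lemma pow2_exp k : 2 ^ k <= exp (INR k).
Proof.
elim: k => [|k IH]; first by rewrite /= exp_0; Lra.lra.
rewrite S_INR exp_plus [_ ^ _]/=.
have h := exp_ineq1_le 1; have p := pow_le 2 k.
have q := exp_pos (INR k); Lra.nra.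
Qed.

Lemma time_bound_real (G : finZmodType) (S : seq G) F t : (1 < #|G|)%N -> (0 < size S)%N ->
  (t <= F * scale S ^ 7)%N ->
  INR t <= Rpower (INR #|G|) (INR (14 + load F 1)) *
    exp (Rpower (INR (size S)) (INR (F + 189) * INR (size S))).
Proof.
move=> n2 d0 ht.
have pos k : (0 < k)%N -> 0 < INR k by move/ltP; exact: lt_0_INR.
have h := INR_leq (leq_trans ht (time_bound F n2 d0)).
rewrite mult_INR in h; apply: Rle_trans h _.
have -> : Rpower (INR #|G|) (INR (14 + load F 1)) = INR (#|G| ^ (14 + load F 1))%N.
  by rewrite Rpower_pow ?INR_expn //; apply: pos; exact: ltnW.
have -> : Rpower (INR (size S)) (INR (F + 189) * INR (size S)) =
    INR (size S ^ ((F + 189) * size S))%N.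
  by rewrite -mult_INR multE Rpower_pow ?INR_expn //; exact: pos.
apply: Rmult_le_compat_l; first exact: pos_INR.
rewrite INR_expn; have -> : INR 2 = 2 by rewrite /=; Lra.lra.
exact: pow2_exp.
Qed.

Lemma cay_volE (G : finZmodType) (S : seq G) Q : cay_vol S Q = (#|Q| * size S)%N.
Proof. by rewrite /cay_vol sum_nat_const. Qed.

Lemma conductance_approx (G : finZmodType) (S : seq G) Q : (0 < size S)%N ->
  sparse_output S Q -> cay_conductance S Q <= 10 * cay_phi S.
Proof.
move=> d0 [/andP[Q0 _] hQ].
have pos k : (0 < k)%N -> 0 < INR k by move/ltP; exact: lt_0_INR.
have vQ : 0 < INR (cay_vol S Q) by apply: pos; rewrite cay_volE muln_gt0 Q0.
apply: (big_ind (fun x => cay_conductance S Q <= 10 * x)).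
- apply: (Rmult_le_reg_r _ _ _ vQ); rewrite /cay_conductance /Rdiv Rmult_assoc Rinv_l; last Lra.lra.
  have := INR_leq (boundary_le S Q); rewrite -cay_volE; Lra.lra.
- by move=> x y hx hy; rewrite /Rmin; case: Rle_dec.
- move=> T /andP[T0 hT].
  have aT : adm T.
    rewrite /adm card_gt0 T0 /=; move: hT; rewrite !cay_volE mulnA leq_mul2r cardsT.
    by rewrite eqn0Ngt d0.
  have vT : 0 < INR (cay_vol S T) by apply: pos; rewrite cay_volE muln_gt0 card_gt0 T0.
  have key : (cay_boundary S Q * cay_vol S T <= 10 * (cay_boundary S T * cay_vol S Q))%N.
    by rewrite !cay_volE !mulnA leq_mul2r -mulnA hQ ?orbT.
  have := INR_leq key; rewrite !mult_INR -[INR 10]/(INR 10) => h.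
  rewrite /cay_conductance /Rdiv.
  apply: (Rmult_le_reg_r _ _ _ vQ); rewrite Rmult_assoc Rinv_l; last Lra.lra.
  apply: (Rmult_le_reg_r _ _ _ vT).
  have -> : 10 * (INR (cay_boundary S T) * / INR (cay_vol S T)) * INR (cay_vol S Q) * INR (cay_vol S T)
    = 10 * (INR (cay_boundary S T) * INR (cay_vol S Q)) * (/ INR (cay_vol S T) * INR (cay_vol S T)) by Lra.lra.
  rewrite Rinv_l; last Lra.lra.
  have e10 : INR 10 = 10 by rewrite /=; Lra.lra.
  rewrite e10 in h; Lra.lra.
Qed.

Theorem theorem1p2 :
  exists C1 C2 C3 : R, Rlt 0 C1 /\ Rlt 0 C2 /\ Rlt 0 C3 /\
  exists P : program,
  forall (G : finZmodType) (elt : 'I_#|G| -> G) (lab : G -> 'I_#|G|),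
    cancel elt lab -> cancel lab elt ->
  forall S : seq G, symmetric_mset S ->
    (2 <= #|G|)%N -> (0 < size S)%N ->
  exists (t : nat) (out : seq nat),
    ram_runs P (encode_input elt lab S) t out /\
    Rle (INR t)
        (Rmult (Rpower (INR #|G|) C2)
               (exp (Rpower (INR (size S)) (Rmult C3 (INR (size S)))))) /\
    let Q := decode_output lab out in
    (1 <= #|Q|)%N /\ (2 * #|Q| <= #|G|)%N /\
    Rle (cay_conductance S Q) (Rmult C1 (cay_phi S)).
Proof.
have pos k : (0 < k)%N -> 0 < INR k by move/ltP; exact: lt_0_INR.
exists 10, (INR (14 + load time_factor 1)), (INR (time_factor + 189)).
split; first Lra.lra.
split; first by apply: pos; rewrite addn_gt0.
split; first by apply: pos; rewrite addn_gt0 orbT.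
exists machine => G elt lab eltK labK S S_sym n2 d0.
have [t [out [hrun ht hout]]] := machine_correct eltK labK S_sym n2 d0.
exists t, out; split=> //; split; first exact: time_bound_real ht.
have [/andP[Q0 Q2] _] := hout.
by split=> //; split=> //; exact: conductance_approx.
Qed.
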